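(* Let $p\ge1$ be an integer, let $\mu_p=\frac{2^2(p+2)^2}{(p^2+4p+8)^2}$, and let $\varphi_{1,p,\mu_p}$ be the explicit solution $$\varphi_{1,p,\mu_p}(x)=\left[\frac{(p+1)(p+4)(3p+4)}{8(p+2)}\right]^{1/p}\operatorname{sech}^{4/p}\left[\frac{p\sqrt{p^2+4p+8}}{4(p+2)}\,x\right]$$ of the equation $$\mu_p\partial_x^4\varphi-\partial_x^2\varphi+c\,\varphi=\frac{1}{p+1}\varphi^{p+1}\quad\text{on }\mathbb{R}\qquad(\ast)_c$$ with $c=1$. There exist $\delta_p>0$ and $\tilde\delta_p>0$ such that for every $c>0$ with $|c-1|<\delta_p$ there exists a unique even solution $\varphi_{c,p,\mu_p}\in H^4(\mathbb{R})$ of $(\ast)_c$ in the ball of $H^4(\mathbb{R})$ centered at $\varphi_{1,p,\mu_p}$ with radius $\tilde\delta_p$. Moreover, the function $c\mapsto\varphi_{c,p,\mu_p}$ is of class $C^1$ from $]1-\delta_p,1+\delta_p[$ into $H^4(\mathbb{R})$.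
   Context: All functions are real-valued; ''even'' means $u(-x)=u(x)$. *)

(* Defs.v *)
From HB Require Import structures.
From mathcomp Require Import all_boot all_order all_algebra.
From mathcomp Require Import ring_quotient ring lra.
From mathcomp Require Import all_classical all_reals all_analysis.

Set Implicit Arguments.
Unset Strict Implicit.
Unset Printing Implicit Defensive.
Import Order.TTheory GRing.Theory Num.Theory.
Import numFieldNormedType.Exports.
Local Open Scope classical_set_scope.
Local Open Scope ring_scope.

Section WeakDerivative.
Context {R : realType}.
Local Notation mu := (@lebesgue_measure R).

(* C_c^oo(R) *)
Definition test_function (phi : R -> R) : Prop :=
  (forall (n : nat) (x : R), derivable (derive1n n phi) x 1) /\
  (exists M : R, forall x, M < `|x| -> phi x = 0).

(* [g] is a [k]-th weak derivative of [f]. Only applied to [f], [g] in L^2, for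
   which both integrands are integrable ([Rintegral] is total). *)
Definition weak_deriv (k : nat) (f g : R -> R) : Prop :=
  forall phi, test_function phi ->
    (\int[mu]_x (f x * derive1n k phi x) =
     (-1) ^+ k * \int[mu]_x (g x * phi x))%R.

Lemma derive1_outside (f : R -> R) (M : R) :
  (forall x, M < `|x| -> f x = 0) -> forall x, M < `|x| -> derive1 f x = 0.
Proof.
move=> f0 x Mx.
rewrite derive1E (@near_eq_derive _ _ _ _ (cst 0)) ?derive_cst//.
have : (fun y : R => `|y|) @ x --> `|x| by exact: norm_continuous.
move=> /cvgr_gt /(_ _ Mx); apply: filterS => y; exact: f0.
Qed.

Lemma test_function_Lfun2 (phi : R -> R) (k : nat) :
  test_function phi -> (derive1n k phi : measurableTypeR R -> R) \in Lfun mu 2.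
Proof.
move=> [dphi [M phiM]].
set f := derive1n k phi.
have f0 x : M < `|x| -> f x = 0.
  rewrite /f; elim: k {f} x => [//|k IH] x; rewrite derive1nS.
  exact: derive1_outside.
have cf : continuous f.
  by move=> x; apply: differentiable_continuous; apply/derivable1_diffP; exact: dphi.
have mf : measurable_fun setT f by exact: measurable_realfun.continuous_measurable_fun.
rewrite inE; apply/andP; split; rewrite inE//=.
rewrite /finite_norm unlock poweR_lty//.
have -> : (\int[mu]_x (`|(EFin \o f) x| `^ 2) =
    \int[mu]_(x in `[(- M)%R, M]) ((f x ^+ 2)%:E))%E.
  rewrite [RHS]integral_mkcond; apply: eq_integral => x _.
  rewrite patchE; case: ifPn => [_|].
    by rewrite /= powR_mulrn// real_normK// num_real.
  rewrite notin_setE/= in_itv/= => /negP.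
  rewrite -ler_norml -ltNge => /f0 /= ->.
  by rewrite normr0 powR0.
apply: integrable_lty => //.
apply: (@continuous_compact_integrable R (fun x => f x ^+ 2) `[-M, M]).
  exact: segment_compact.
apply: continuous_subspaceT => x.
exact: (@continuous_comp _ _ _ f (fun y : R => y ^+ 2)
  x (cf x) (@exprn_continuous _ _ _)).
Qed.

Lemma Lfun2_test_integrable (f psi : measurableTypeR R -> R) :
  f \in Lfun mu 2 -> psi \in Lfun mu 2 ->
  mu.-integrable setT (EFin \o (fun x => f x * psi x)).
Proof. by move=> f2 psi2; apply/Lfun1_integrable; exact: Lfun2_mul_Lfun1. Qed.

Lemma weak_deriv_linear (k : nat) (a : R) (f g f' g' : measurableTypeR R -> R) :
  f \in Lfun mu 2 -> g \in Lfun mu 2 -> f' \in Lfun mu 2 -> g' \in Lfun mu 2 ->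
  weak_deriv k f f' -> weak_deriv k g g' ->
  weak_deriv k (fun x => a * f x + g x) (fun x => a * f' x + g' x).
Proof.
move=> f2 g2 f'2 g'2 wf wg phi tphi.
have linI (u v psi : measurableTypeR R -> R) :
    u \in Lfun mu 2 -> v \in Lfun mu 2 -> psi \in Lfun mu 2 ->
    (\int[mu]_x ((a * u x + v x) * psi x) =
     a * \int[mu]_x (u x * psi x) + \int[mu]_x (v x * psi x))%R.
  move=> u2 v2 psi2.
  have iu := Lfun2_test_integrable u2 psi2.
  rewrite -RintegralZl// -RintegralD//.
  - by apply: eq_Rintegral => x _; rewrite mulrDl mulrA.
  - exact: (integrableZl measurableT a iu).
  - exact: Lfun2_test_integrable.
have tphi0 := test_function_Lfun2 0 tphi.
rewrite !linI//; last exact: test_function_Lfun2.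
by rewrite (wf _ tphi) (wg _ tphi) mulrDr mulrCA.
Qed.
End WeakDerivative.


Section Euclid.
Context (R : realType) (n : nat).
Implicit Types a b : 'I_n -> R.

Definition l2norm a : R := Num.sqrt (\sum_i a i ^+ 2).

Lemma sqr_l2norm a : l2norm a ^+ 2 = \sum_i a i ^+ 2.
Proof. by rewrite sqr_sqrtr// sumr_ge0// => i _; exact: sqr_ge0. Qed.

Lemma l2norm_eq0 a : l2norm a = 0 -> forall i, a i = 0.
Proof.
move=> a0 i; have /eqP := sqr_l2norm a; rewrite a0 expr0n/= eq_sym psumr_eq0.
  by move=> /allP/(_ i (mem_index_enum _)); rewrite sqrf_eq0 => /eqP.
by move=> j _; exact: sqr_ge0.
Qed.

Lemma l2norm_CS a b : \sum_i a i * b i <= l2norm a * l2norm b.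
Proof.
have [/l2norm_eq0 a0|a0] := eqVneq (l2norm a) 0.
  by rewrite big1 ?mulr_ge0 ?sqrtr_ge0// => i _; rewrite a0 mul0r.
have [/l2norm_eq0 b0|b0] := eqVneq (l2norm b) 0.
  by rewrite big1 ?mulr_ge0 ?sqrtr_ge0// => i _; rewrite b0 mulr0.
have ab0 : 0 < l2norm a * l2norm b by rewrite mulr_gt0// lt_neqAle eq_sym sqrtr_ge0 ?a0 ?b0.
set t := l2norm a in ab0 *; set s := l2norm b in ab0 *.
have : 0 <= \sum_i (s * a i - t * b i) ^+ 2 by apply: sumr_ge0 => i _; exact: sqr_ge0.
have -> : \sum_i (s * a i - t * b i) ^+ 2 =
    s ^+ 2 * \sum_i a i ^+ 2 - 2 * s * t * \sum_i a i * b i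
    + t ^+ 2 * \sum_i b i ^+ 2.
  rewrite !big_distrr/= -sumrB -big_split/=; apply: eq_bigr => i _; ring.
rewrite -!sqr_l2norm -/t -/s => h; rewrite -subr_ge0 -(pmulr_rge0 _ ab0).
by nra.
Qed.

Lemma l2normD a b : l2norm (fun i => a i + b i) <= l2norm a + l2norm b.
Proof.
rewrite -[leRHS]ger0_norm ?addr_ge0 ?sqrtr_ge0// -sqrtr_sqr ler_wsqrtr//.
rewrite sqrrD !sqr_l2norm.
under eq_bigr do rewrite sqrrD.
by rewrite !big_split/= lerD2r lerD2l mulr2n lerD ?l2norm_CS.
Qed.

Lemma ler_l2norm a b : (forall i, 0 <= a i <= b i) -> l2norm a <= l2norm b.
Proof.
move=> ab; rewrite ler_wsqrtr// ler_sum// => i _.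
by have /andP[a0 /(lerXn2r _)->] := ab i; rewrite // nnegrE; have := ab i; lra.
Qed.

Lemma l2normZ (r : R) a : 0 <= r -> l2norm (fun i => r * a i) = r * l2norm a.
Proof.
move=> r0; rewrite /l2norm; under eq_bigr do rewrite exprMn.
by rewrite -big_distrr/= sqrtrM ?sqr_ge0// sqrtr_sqr ger0_norm.
Qed.
End Euclid.

Section Jets.
Context (R : realType) (m : nat).
Local Notation mu := (@lebesgue_measure R).
Local Notation L2 := (LfunType mu (lee1n 2)).

Definition L2norm (f : L2) : R := fine ('N[mu]_2[EFin \o f])%E.

Lemma L2norm_ge0 f : 0 <= L2norm f.
Proof. by rewrite fine_ge0// Lnorm_ge0. Qed.

Lemma L2normZ a f : L2norm (a *: f) = `|a| * L2norm f.
Proof.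
by apply: EFin_inj; rewrite EFinM !finite_norm_fine LnormZ.
Qed.

Lemma L2normD f g : L2norm (f + g) <= L2norm f + L2norm g.
Proof. exact: ler_LnormD. Qed.

Lemma L2norm_eq0 (f : L2) : f = 0 %[ae mu] -> L2norm f = 0.
Proof.
move=> f0; rewrite /L2norm unlock.
rewrite (@ae_eq_integral _ _ _ mu setT (cst 0%E))// ?integral_cst ?mul0e//.
- by rewrite poweR_EFin powR0.
- exact: (measurable_int mu (Lfun_integrable (ler1n R 2) (LfunP f))).
- by apply: filterS f0 => x /(_ I) fx _; rewrite /= fx normr0 powR0.
Qed.

(* An element of H^m(R) is carried together with its weak derivatives: a jet is
   a family [u 0, ..., u m] of L^2 functions where [u k] is a [k]-th weak
   derivative of [u 0]. Weak derivatives being unique almost everywhere, [u 0]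
   determines the other components almost everywhere, so that quotienting jets
   by almost everywhere equality gives H^m(R) = W^{m,2}(R). *)
Definition jet_pred : {pred {ffun 'I_m.+1 -> L2}} :=
  [pred u : {ffun 'I_m.+1 -> L2} |
    `[< forall k : 'I_m.+1, weak_deriv k (u ord0) (u k) >]].

Lemma jet_submod_closed : submod_closed jet_pred.
Proof.
split=> [|a u v].
  apply/asboolP => k phi tphi.
  by under eq_Rintegral do rewrite ffunE mul0r;
     under [in RHS]eq_Rintegral do rewrite ffunE mul0r;
     rewrite Rintegral_cst ?mul0r ?mulr0.
move=> /asboolP wu /asboolP wv; apply/asboolP => k; rewrite !ffunE.
by apply: weak_deriv_linear; rewrite ?LfunP//.
Qed.

HB.instance Definition _ := GRing.isSubmodClosed.Build R _ jet_pred jet_submod_closed.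

Record jet := Jet { jet_val :> {ffun 'I_m.+1 -> L2}; jetP : jet_val \in jet_pred }.

HB.instance Definition _ := [isSub for jet_val].
HB.instance Definition _ := [Choice of jet by <:].
HB.instance Definition _ := [SubChoice_isSubLmodule of jet by <:].


Definition null_jet : {pred jet} :=
  [pred u : jet | `[< forall k, jet_val u k = 0 %[ae mu] >] ].

Lemma null_jet_submod_closed : submod_closed null_jet.
Proof.
split=> [|a u v]; first by apply/asboolP => k; apply: aeW => x _; rewrite ffunE.
move=> /asboolP u0 /asboolP v0; apply/asboolP => k.
apply: filterS2 (u0 k) (v0 k) => x /(_ I) ux /(_ I) vx _.
rewrite /= !ffunE.
transitivity (a * jet_val u k x + jet_val v k x); first by [].
by rewrite ux vx; exact: (etrans (addr0 _) (mulr0 a)).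
Qed.

HB.instance Definition _ :=
  GRing.isSubmodClosed.Build R jet null_jet null_jet_submod_closed.

(* (\sum_(k <= m) ||u^(k)||_2^2)^(1/2) *)
Definition jet_norm (u : jet) : R := l2norm (fun k => L2norm (jet_val u k)).

Lemma jet_normD u v : jet_norm (u + v) <= jet_norm u + jet_norm v.
Proof.
apply: le_trans (l2normD _ _); apply: ler_l2norm => k.
by rewrite L2norm_ge0 ffunE L2normD.
Qed.

Lemma jet_normZ a u : jet_norm (a *: u) = `|a| * jet_norm u.
Proof.
rewrite -l2normZ//; congr l2norm; apply/funext => k.
by rewrite ffunE L2normZ.
Qed.

Lemma jet_norm_eq0 u : jet_norm u = 0 <-> u \in null_jet.
Proof.
split=> [/l2norm_eq0 u0|/asboolP u0].
  by apply/asboolP => k; apply: fine_Lnormr_eq0; exact: u0.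
rewrite /jet_norm /l2norm big1 ?sqrtr0// => k _.
by rewrite L2norm_eq0 ?expr0n.
Qed.

Local Open Scope quotient_scope.

Definition sobolev := Quotient.quot null_jet.
HB.instance Definition _ := GRing.Zmodule.on sobolev.
HB.instance Definition _ := EqQuotient.on sobolev.

Implicit Types U V : sobolev.

Lemma pi_sobolevD (u v : jet) : \pi_sobolev (u + v) = \pi_sobolev u + \pi_sobolev v.
Proof. exact: (@raddfD _ _ (\pi_(Quotient.quot null_jet)) u v). Qed.

Lemma pi_sobolevP (u v : jet) : \pi_sobolev u = \pi_sobolev v <-> u - v \in null_jet.
Proof.
split=> [/eqP|uv]; first by rewrite -(@Quotient.idealrBE _ null_jet).
by apply/eqP; rewrite -(@Quotient.idealrBE _ null_jet).
Qed.

Definition sobolev_scale (a : R) U : sobolev := \pi_sobolev (a *: repr U).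

Lemma pi_sobolevZ a (u : jet) : \pi_sobolev (a *: u) = sobolev_scale a (\pi_sobolev u).
Proof.
apply/pi_sobolevP; rewrite -scalerBr rpredZ//.
by apply/pi_sobolevP; rewrite reprK.
Qed.

Lemma sobolev_scaleA a b U :
  sobolev_scale a (sobolev_scale b U) = sobolev_scale (a * b) U.
Proof. by rewrite -[U]reprK -(pi_sobolevZ b) -(pi_sobolevZ a) -pi_sobolevZ scalerA. Qed.

Lemma sobolev_scale1 : left_id 1 sobolev_scale.
Proof. by move=> U; rewrite -[U]reprK -pi_sobolevZ scale1r. Qed.

Lemma sobolev_scaleDr : right_distributive sobolev_scale +%R.
Proof.
move=> a U V; rewrite -[U]reprK -[V]reprK.
by rewrite -pi_sobolevD -!pi_sobolevZ scalerDr pi_sobolevD.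
Qed.

Lemma sobolev_scaleDl U : {morph sobolev_scale^~ U : a b / a + b}.
Proof. by move=> a b /=; rewrite -[U]reprK -!pi_sobolevZ scalerDl pi_sobolevD. Qed.

HB.instance Definition _ := GRing.Zmodule_isLmodule.Build R sobolev
  sobolev_scaleA sobolev_scale1 sobolev_scaleDr sobolev_scaleDl.

Definition sobolev_norm U : R := jet_norm (repr U).

Lemma sobolev_norm_pi (u : jet) : sobolev_norm (\pi_sobolev u) = jet_norm u.
Proof.
have le (v w : jet) : \pi_sobolev v = \pi_sobolev w -> jet_norm v <= jet_norm w.
  move=> /pi_sobolevP/jet_norm_eq0 vw; rewrite -(subrK w v).
  by apply: le_trans (jet_normD _ _) _; rewrite vw add0r.
by apply/le_anti/andP; split; apply: le; rewrite reprK.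
Qed.

Lemma sobolev_normD U V : sobolev_norm (U + V) <= sobolev_norm U + sobolev_norm V.
Proof.
by rewrite -[U]reprK -[V]reprK -pi_sobolevD !sobolev_norm_pi jet_normD.
Qed.

Lemma sobolev_normZ (a : R) U : sobolev_norm (a *: U) = `|a| * sobolev_norm U.
Proof.
rewrite -[U]reprK -[X in sobolev_norm X]pi_sobolevZ.
by rewrite !sobolev_norm_pi jet_normZ.
Qed.

Lemma sobolev_norm_eq0 U : sobolev_norm U = 0 -> U = 0.
Proof.
move=> /jet_norm_eq0 U0; rewrite -[U]reprK.
transitivity (\pi_sobolev (0 : jet)); first by apply/pi_sobolevP; rewrite subr0.
exact: (@raddf0 _ _ (\pi_(Quotient.quot null_jet))).
Qed.

HB.instance Definition _ := Lmodule_isNormed.Build R sobolev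
  sobolev_normD sobolev_normZ sobolev_norm_eq0.

Definition weak_derivative (k : 'I_m.+1) U : R -> R := jet_val (repr U) k.

Definition sobolev_fun U : R -> R := weak_derivative ord0 U.

(* The representative [sobolev_fun U] is arbitrary in its class, hence the
   almost everywhere quantifiers here and in [is_solution]. *)
Definition represents U (f : R -> R) : Prop :=
  {ae mu, forall x : R, sobolev_fun U x = f x}.

Definition sobolev_even U : Prop :=
  {ae mu, forall x : R, sobolev_fun U (- x) = sobolev_fun U x}.

End Jets.

Arguments sobolev : clear implicits.

Definition C1_on_oo {R : realType} {V : normedModType R} (f : R -> V)
    (a b : R) : Prop :=
  forall c : R, a < c < b ->
    derivable f c 1 /\ {for c, continuous (derive1 f)}.

Section Equation.
Context {R : realType}.
Local Notation mu := (@lebesgue_measure R).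

Definition sech (x : R) : R := 2 / (expR x + expR (- x)).

Definition mu_ (p : nat) : R :=
  (2 ^+ 2 * (p%:R + 2) ^+ 2) / (p%:R ^+ 2 + 4 * p%:R + 8) ^+ 2.

Definition explicit_solution (p : nat) (x : R) : R :=
  (((p%:R + 1) * (p%:R + 4) * (3 * p%:R + 4)) / (8 * (p%:R + 2)))
    `^ (1 / p%:R) *
  sech (p%:R * Num.sqrt (p%:R ^+ 2 + 4 * p%:R + 8) / (4 * (p%:R + 2)) * x)
    `^ (4 / p%:R).

(* m phi'''' - phi'' + c phi = phi^(p+1) / (p+1), as an equality in L^2 *)
Definition is_solution (m c : R) (p : nat) (phi : sobolev R 4) : Prop :=
  {ae mu, forall x : R,
    m * weak_derivative (inord 4) phi x - weak_derivative (inord 2) phi x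
    + c * sobolev_fun phi x = 1 / (p%:R + 1) * sobolev_fun phi x ^+ p.+1}.

End Equation.

(* Main.v *)
Require Import Defs.
From mathcomp Require Import all_boot all_order all_algebra.
From mathcomp Require Import ring lra.
From mathcomp Require Import all_classical all_reals all_analysis.
From mathcomp Require Import measurable_realfun.

Set Implicit Arguments.
Unset Strict Implicit.
Unset Printing Implicit Defensive.
Import Order.TTheory GRing.Theory Num.Theory.
Import numFieldNormedType.Exports.
Local Open Scope classical_set_scope.
Local Open Scope ring_scope.

(** Let [r = 4 / p], let [beta] be the wave number of the explicit solution, [S x = sech (beta x)] and
[phi = S ^ r], so that the explicit solution is [Phi = amp * phi]. The value of [mu_p] is the one for
which [mu d^4 - d^2 + 1 = mu (d^2 - a^2) (d^2 - b^2)] with [a = beta r] and [b = beta (r + 2)]. This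
operator is therefore inverted by solving four equations [u' = f - k u], [k] in [{a, b, - a, - b}]
([solve_decay], [Msol_exists]); its inverse [T] maps L^2 into H^4. Moreover [phi] satisfies
[(d^2 - a^2) (d^2 - b^2) phi = const S^4 phi] ([ground_Msol]), which contains the case [c = 1].

Write a solution as [Phi + h]. As [Phi ^ p = Pot] is a multiple of [S^4], the equation reads
[h = T (Pot h + F (c, h))], where [F] is quadratic in [h] up to terms that vanish with [c - 1]. The
point is that [1 - T Pot] is invertible on even functions. One has [T (Pot phi) = (p + 1) phi]. The
complement of [phi] is the set of functions of zero moment [\int S^4 phi h = 0]; it is stable under
[T Pot] by Green's formula ([moment_resolvent]), and there [T Pot] contracts the norm of [S^2 h] in
L^2 by a factor [rho < 1] ([spectral_gap]). The gap comes from a pointwise identity: if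
[(d^2 - a^2) (d^2 - b^2) u = f] with [u] even of zero moment, then [f u] minus [beta^4 gap_const S^4 u^2]
is a sum of squares plus the derivative of a quantity that vanishes at 0 and at infinity. The squares
come from completing the square in the operator and from a weighted Poincare inequality; the latter
is where the zero moment enters, and it is proved by a Riccati inequality.

Separating the component along [phi], which can be solved for explicitly since [p + 1 <> 1], the
equation becomes [h = gap_op h + reduced_op (F (c, h))] with [gap_op] a contraction. The contraction
principle, in the space of even functions with bounds on [|h|], on the L^2 norm of [h] and on that of
[S^2 h], gives existence and uniqueness of a small [h] for [c] near 1 ([small_solution],
[solution_uniq]). The linearized equation has a solution [k] by the same principle, and Taylor
expansion of the power bounds [h (c') - h (c) - (c' - c) k] by a multiple of [(c' - c)^2] in H^4, and
[k (c') - k (c)] by a multiple of [|c' - c|] ([branch_C1]); this is more than the C^1 property.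

What precedes concerns functions and their classical derivatives. A chain of four square-integrable
derivatives defines an element of H^4. Conversely an even weak solution close to [Phi] in H^4 has a
continuous representative, hence so does its right-hand side [f], and the difference with the
classical solution [T f] is annihilated in the weak sense by [(d^2 - a^2) (d^2 - b^2)]; peeling off the four
first-order factors, none of which has a nonzero solution in L^2, this difference is zero
([weak_homogeneous], [weak_is_classical]). *)

(** * Derivatives valid at every point *)

Section Deriv.
Context {R : realType}.
Implicit Types (f g F G : R -> R) (a b x y z : R).

(** A relation rather than the operator [derive1]: derivatives are then computed by applying rules,
and no side condition of differentiability is left behind. *)
Definition dv f f' := forall x, is_derive x (1 : R) f (f' x).

Lemma dv_eq f f' g : dv f f' -> f' =1 g -> dv f g.
Proof. by move=> df e x; rewrite -e. Qed.

Lemma dv_cst a : dv (fun=> a) (fun=> 0).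
Proof. by move=> x; exact: is_derive_cst. Qed.

Lemma dv_id : dv (fun x => x) (fun=> 1).
Proof. by move=> x; exact: is_derive_id. Qed.

Lemma dvD f f' g g' : dv f f' -> dv g g' ->
  dv (fun x => f x + g x) (fun x => f' x + g' x).
Proof. by move=> df dg x; apply: is_deriveD. Qed.

Lemma dvN f f' : dv f f' -> dv (fun x => - f x) (fun x => - f' x).
Proof. by move=> df x; apply: is_deriveN. Qed.

Lemma dvB f f' g g' : dv f f' -> dv g g' ->
  dv (fun x => f x - g x) (fun x => f' x - g' x).
Proof. by move=> df dg; apply: dvD => //; exact: dvN. Qed.

Lemma dvM f f' g g' : dv f f' -> dv g g' ->
  dv (fun x => f x * g x) (fun x => f' x * g x + f x * g' x).
Proof.
move=> df dg x; apply: (is_derive_eq (@is_deriveM _ _ f g x 1 _ _ (df x) (dg x))).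
by rewrite /GRing.scale/= addrC; congr (_ + _); rewrite mulrC.
Qed.

Lemma dvX f f' n : dv f f' ->
  dv (fun x => f x ^+ n.+1) (fun x => n.+1%:R * f x ^+ n * f' x).
Proof.
move=> df; elim: n => [|n IH].
  by apply: (dv_eq df) => x; rewrite expr0 !mul1r.
have -> : (fun x => f x ^+ n.+2) = (fun x => f x * f x ^+ n.+1).
  by apply/funext => x; rewrite exprS.
by apply: (dv_eq (dvM df IH)) => x; rewrite [n.+2%:R]mulrSr !exprS; ring.
Qed.

Lemma dv_comp f f' g g' : dv f f' -> dv g g' ->
  dv (fun x => f (g x)) (fun x => f' (g x) * g' x).
Proof.
move=> df dg x; have dgx := dg x; have dfx := df (g x).
have := @is_derive1_comp _ f g x _ _ dfx dgx.
by [].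
Qed.

Lemma dv_exp f f' : dv f f' -> dv (fun x => expR (f x)) (fun x => expR (f x) * f' x).
Proof.
by apply: dv_comp => x; exact: is_derive_expR.
Qed.

Lemma dv_inv f f' : (forall x, f x != 0) -> dv f f' ->
  dv (fun x => (f x)^-1) (fun x => - f' x / f x ^+ 2).
Proof.
move=> f0 df x; have h := @is_deriveV _ f x _ 1 (f0 x) (df x).
apply: (is_derive_eq h); rewrite /GRing.scale/= mulrC mulrN mulNr//.
Qed.

Lemma dv_continuous f f' : dv f f' -> continuous f.
Proof.
move=> df x; apply: differentiable_continuous; apply/derivable1_diffP.
by have [] := df x.
Qed.

Lemma dv_derive1 f f' : dv f f' -> derive1 f = f'.
Proof. by move=> df; apply/funext => x; rewrite derive1E; have [_] := df x. Qed.

Lemma dv_uniq f f' g : dv f f' -> dv f g -> f' =1 g.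
Proof. by move=> /dv_derive1 <- /dv_derive1 <-. Qed.

Lemma dv_le f f' a b : dv f f' -> (forall z, a < z < b -> 0 <= f' z) ->
  a <= b -> f a <= f b.
Proof.
move=> df pos; rewrite le_eqVlt => /orP[/eqP->//|ab].
have [||c + e] := @MVT _ f f' a b ab.
- by move=> x _; exact: df.
- by apply: continuous_subspaceT; exact: (dv_continuous df).
by rewrite in_itv/= => /pos c0; rewrite -subr_ge0 e mulr_ge0// subr_ge0 ltW.
Qed.

Lemma dv_incr f f' a b : dv f f' -> (forall z, 0 <= f' z) -> a <= b -> f a <= f b.
Proof. by move=> df p; apply: (dv_le df) => z _. Qed.

Lemma dv_incr0 f f' a b : dv f f' -> (forall z, 0 <= z -> 0 <= f' z) ->
  0 <= a -> a <= b -> f a <= f b.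
Proof.
by move=> df p a0; apply: (dv_le df) => z /andP[az _]; apply: p; exact: le_trans (ltW az).
Qed.

Lemma dv0_cst f f' : dv f f' -> (forall z, f' z = 0) -> forall x y, f x = f y.
Proof.
move=> df f0.
have le x y : x <= y -> f x = f y.
  move=> xy; apply/le_anti; rewrite (dv_incr df _ xy) ?andTb//=; last by move=> z; rewrite f0.
  by rewrite -lerN2 (dv_incr (dvN df) _ xy)// => z; rewrite f0 oppr0.
by move=> x y; have /orP[/le//|/le ->//] := le_total x y.
Qed.

Lemma dv_diff F G f : dv F f -> dv G f -> forall x y, F y - F x = G y - G x.
Proof.
move=> dF dG x y; have := dv0_cst (dvB dF dG) (fun z => subrr _) y x; lra.
Qed.

(** Near [x] the integral from the moving base point [- (|x| + 1)] differs by a constant from one with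
a fixed base point, to which the fundamental theorem of calculus applies. *)
Lemma primitive f : continuous f -> exists F, dv F f.
Proof.
move=> cf; pose mu := @lebesgue_measure R.
have intf a b : mu.-integrable `[a, b] (EFin \o f).
  apply: continuous_compact_integrable; first exact: segment_compact.
  exact: continuous_subspaceT.
pose I a b := \int[mu]_(t in `[a, b]) f t.
have split a b c : a <= b -> b <= c -> I a c = I a b + I b c.
  move=> ab bc; have := @Rintegral_itvB R f (BLeft a) (BRight c) b.
  move=> /(_ (intf a c)); rewrite !bnd_simp => /(_ ab bc) e.
  apply/eqP; rewrite addrC -subr_eq; apply/eqP.
  by rewrite /I e Rintegral_itv_obnd_cbnd//; apply: integrableS (intf b c) => //; exact: subset_itv_oc_cc.
exists (fun x => I (- (`|x| + 1)) x - I (- (`|x| + 1)) 0) => x.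
pose M := `|x| + 2.
suff h : is_derive x 1 (fun y => I (- M) y - I (- M) 0) (f x).
  apply: near_eq_is_derive h; near=> y.
  have yM : `|y| < `|x| + 1.
    near: y; apply: (cvgr_lt `|x|); last by rewrite ltrDl.
    exact: norm_continuous.
  have h1 : - (`|y| + 1) <= y by have := ler_norm (- y); rewrite normrN; lra.
  have h2 : - M <= - (`|y| + 1) by rewrite /M; lra.
  have h3 : - (`|y| + 1) <= 0 by have := normr_ge0 y; lra.
  by rewrite (split _ _ _ h2 h1) (split _ _ _ h2 h3); ring.
have xM : - M < x by have := ler_norm (- x); rewrite normrN /M; lra.
have [|d1 d2] := @continuous_FTC1 R f (BLeft (- M)) x (x + 1) _ (intf _ _) xM (cf x).
  lra.
have dI : is_derive x 1 (fun y => I (- M) y) (f x).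
  by apply: DeriveDef; [exact: d1|rewrite -derive1E; exact: d2].
by apply: (is_derive_eq (is_deriveB dI (is_derive_cst _ _ _))); rewrite subr0.
Unshelve. all: by end_near. Qed.
End Deriv.

(** * Square-integrability of continuous functions *)

Section Improper.
Context {R : realType}.
Implicit Types (f g F G E e : R -> R) (a b x y z : R).

(** Convergence of an improper integral towards the lower end of [P] by domination: [G + E] and
[E - G] are monotone there, so that [G] has a limit, at distance at most [E - inf E] from [G]. *)
Lemma improper_Ny G g E e m (P : R -> Prop) x0 :
  (forall x y, y <= x -> P x -> P y) -> P x0 ->
  dv G g -> dv E e -> (forall x, P x -> `|g x| <= e x) -> (forall x, P x -> m <= E x) ->
  exists l m0 : R, [/\ m <= m0, forall x, P x -> `|G x - l| <= E x - m0 &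
     forall eps, 0 < eps -> exists2 x, P x & E x <= m0 + eps].
Proof.
move=> Pd P0 dG dE ge mE.
have gb x : P x -> - e x <= g x <= e x by move=> /ge; rewrite ler_norml.
have incD x y : P y -> x <= y -> G x + E x <= G y + E y.
  move=> Py xy; apply: (dv_le (dvD dG dE) _ xy) => z /andP[_ zy].
  by have /gb := Pd _ _ (ltW zy) Py; lra.
have incB x y : P y -> x <= y -> E x - G x <= E y - G y.
  move=> Py xy; apply: (dv_le (dvB dE dG) _ xy) => z /andP[_ zy].
  by have /gb := Pd _ _ (ltW zy) Py; lra.
pose SE := [set E x | x in P]; pose SG := [set G x + E x | x in P].
have infE : has_inf SE.
  by split; [exists (E x0), x0|exists m => _ [x Px <-]; exact: mE].
have infG : has_inf SG.
  split; first by exists (G x0 + E x0), x0.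
  exists (2 * m + G x0 - E x0) => _ [x Px <-].
  have mx := mE _ Px; have m0 := mE _ P0.
  have [x0x|/ltW xx0] := leP x0 x; first by have := incD _ _ Px x0x; lra.
  by have := incB _ _ P0 xx0; lra.
set e0 := inf SE; set l1 := inf SG.
have e0E x : P x -> e0 <= E x by move=> Px; apply: ge_inf; [case: infE|exists x].
have l1G x : P x -> l1 <= G x + E x by move=> Px; apply: ge_inf; [case: infG|exists x].
exists (l1 - e0), e0; split.
- by apply: lb_le_inf; [case: infE|move=> _ [x Px <-]; exact: mE].
- move=> x Px; rewrite ler_norml; apply/andP; split.
    by have := l1G _ Px; lra.
  have : G x - E x + 2 * e0 <= l1.
    apply: lb_le_inf; first by case: infG.
    move=> _ [y Py <-]; have ey := e0E _ Py; have ex := e0E _ Px.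
    have [xy|/ltW yx] := leP x y; first by have := incD _ _ Py xy; lra.
    by have := incB _ _ Px yx; lra.
  by lra.
- move=> eps eps0; have [_ [x Px <-] h] := inf_adherent eps0 infE.
  by exists x => //; exact: ltW.
Qed.

End Improper.

Section L2.
Context {R : realType}.
Implicit Types (f g F G E e : R -> R) (a b x y z : R).

(** The L^2 norm of [f] is at most [A]. With primitives instead of integrals, an inequality between
L^2 norms follows from a pointwise inequality by monotonicity. *)
Definition L2le f A := [/\ 0 < A, continuous f &
  exists2 F, dv F (fun x => f x ^+ 2) & forall x y, F y - F x <= A ^+ 2].

Lemma L2le_prim f A F : L2le f A -> dv F (fun x => f x ^+ 2) ->
  forall x y, F y - F x <= A ^+ 2.
Proof. by move=> [_ _ [G dG h]] dF x y; rewrite (dv_diff dF dG). Qed.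

Lemma L2leP f A : 0 < A -> continuous f ->
  (forall F, dv F (fun x => f x ^+ 2) -> forall x y, x <= y -> F y - F x <= A ^+ 2) ->
  L2le f A.
Proof.
move=> A0 cf h; split=> //.
have [F dF] : exists F, dv F (fun x => f x ^+ 2).
  by apply: primitive => x; apply: cvgM; exact: cf.
exists F => // x y; have [xy|/ltW yx] := leP x y; first exact: h.
apply: le_trans (sqr_ge0 _); rewrite subr_le0.
by apply: (dv_incr dF _ yx) => z; exact: sqr_ge0.
Qed.

Lemma L2le_mono f A B : A <= B -> L2le f A -> L2le f B.
Proof.
move=> AB [A0 cf [F dF h]]; split=> //; first exact: lt_le_trans AB.
exists F => // x y; apply: le_trans (h x y) _; rewrite ler_sqr ?nnegrE; lra.
Qed.

Lemma L2le_dom f g A c : 0 < c -> continuous g ->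
  (forall x, `|g x| <= c * `|f x|) -> L2le f A -> L2le g (c * A).
Proof.
move=> c0 cg gf [A0 cf [F dF hF]]; apply: L2leP => //; first exact: mulr_gt0.
move=> G dG x y xy; have := dv_incr (dvB (dvM (dv_cst (c ^+ 2)) dF) dG) _ xy.
have pos z : 0 <= 0 * F z + c ^+ 2 * (f z ^+ 2) - g z ^+ 2.
  have : g z ^+ 2 <= (c * `|f z|) ^+ 2.
    by rewrite -[g z ^+ 2]real_normK ?num_real// ler_sqr ?nnegrE// mulr_ge0// ltW.
  rewrite exprMn real_normK ?num_real//; lra.
move=> /(_ pos); have := hF x y; rewrite exprMn.
have : 0 < c ^+ 2 by rewrite exprn_gt0.
nra.
Qed.

(** Minkowski's inequality; the weights [1 + B / A] and [1 + A / B] are those for which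
[(f + g)^2 <= (1 + B / A) f^2 + (1 + A / B) g^2] adds up to [(A + B)^2]. *)
Lemma L2leD f g A B : L2le f A -> L2le g B -> L2le (fun x => f x + g x) (A + B).
Proof.
move=> [A0 cf [F dF hF]] [B0 cg [G dG hG]]; apply: L2leP; first exact: addr_gt0.
  by move=> x; apply: cvgD; [exact: cf|exact: cg].
move=> H dH x y xy.
have := dv_incr (dvB (dvD (dvM (dv_cst (1 + B / A)) dF) (dvM (dv_cst (1 + A / B)) dG)) dH) _ xy.
have pos z : 0 <= 0 * F z + (1 + B / A) * f z ^+ 2 + (0 * G z + (1 + A / B) * g z ^+ 2) - (f z + g z) ^+ 2.
  have -> : 0 * F z + (1 + B / A) * f z ^+ 2 + (0 * G z + (1 + A / B) * g z ^+ 2) - (f z + g z) ^+ 2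
    = (A * B)^-1 * (B * f z - A * g z) ^+ 2 by field; lra.
  by rewrite mulr_ge0 ?sqr_ge0// invr_ge0 mulr_ge0// ltW.
move=> /(_ pos); set u := 1 + B / A; set v := 1 + A / B.
have u0 : 0 < u by rewrite addr_gt0// divr_gt0.
have v0 : 0 < v by rewrite addr_gt0// divr_gt0.
have -> : (A + B) ^+ 2 = u * A ^+ 2 + v * B ^+ 2 by rewrite /u /v; field; lra.
have := ler_wpM2l (ltW u0) (hF x y); have := ler_wpM2l (ltW v0) (hG x y); lra.
Qed.

Lemma L2le_reflect f A : L2le f A -> L2le (fun x => f (- x)) A.
Proof.
move=> [A0 cf [F dF hF]]; split => //.
  move=> x; apply: (@continuous_comp _ _ _ (fun y : R => - y) f); last exact: cf.
  exact: opp_continuous.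
exists (fun x => - F (- x)); last by move=> x y; rewrite opprK addrC; exact: hF.
by apply: (dv_eq (dvN (dv_comp dF (dvN dv_id)))) => x; rewrite mulrN1 opprK.
Qed.

End L2.

(** * First-order linear equations *)

Section Solve.
Context {R : realType}.
Implicit Types (f g F G : R -> R) (a b x y z : R).

Lemma dv_expl a : dv (fun x => expR (a * x)) (fun x => a * expR (a * x)).
Proof.
by apply: (dv_eq (dv_exp (dvM (dv_cst a) dv_id))) => x; rewrite mul0r add0r mulr1 mulrC.
Qed.

(** Large enough for both the uniform and the L^2 bound in [solve_decay]. *)
Definition decay_const a : R := a^-1 + (1 / (4 * a) + 1 / 2) + (1 / (4 * a) + 1 / 2) / a.

Lemma decay_const_gt0 a : 0 < a -> 0 < decay_const a.
Proof.
by move=> a0; rewrite /decay_const !addr_gt0// ?invr_gt0// ?divr_gt0// ?mulr_gt0// !addr_gt0// divr_gt0// mulr_gt0.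
Qed.

(** The solution is [\int_(t <= x) exp (a (t - x)) f t]. The integrand is dominated through
[|e f| <= lam / 2 e^2 + f^2 / (2 lam)] with [e = exp (a t)], whose right-hand side has the primitive
[E lam]. The L^2 bound is the energy estimate: [a u^2 + (u^2)' <= f^2 / a]. *)
Lemma solve_decay a f A : 0 < a -> L2le f A ->
  exists u, [/\ dv u (fun x => f x - a * u x),
    (forall x, `|u x| <= decay_const a * A) & L2le u (decay_const a * A)].
Proof.
move=> a0 fA; have [A0 cf [F dF hF]] := fA.
have [G dG] : exists G, dv G (fun x => expR (a * x) * f x).
  by apply: primitive => x; apply: cvgM; [exact: (dv_continuous (dv_expl a))|exact: cf].
have sqE x : expR (2 * a * x) = expR (a * x) ^+ 2.
  by rewrite -expRM_natl; congr expR; ring.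
pose E lam x := lam / (4 * a) * expR (2 * a * x) + (2 * lam)^-1 * F x.
have dE lam : dv (E lam) (fun x => lam / 2 * expR (a * x) ^+ 2 + (2 * lam)^-1 * f x ^+ 2).
  apply: (dv_eq (dvD (dvM (dv_cst _) (dv_expl (2 * a))) (dvM (dv_cst _) dF))) => x.
  rewrite sqE; have [->|l0] := eqVneq lam 0; first by rewrite !(mulr0, mul0r, invr0, add0r).
  by field; lra.
have gE lam x : 0 < lam -> `|expR (a * x) * f x| <=
    lam / 2 * expR (a * x) ^+ 2 + (2 * lam)^-1 * f x ^+ 2.
  move=> l0; set w := expR _.
  have h1 : 0 <= (2 * lam)^-1 * (lam * w - f x) ^+ 2.
    by rewrite mulr_ge0 ?sqr_ge0// invr_ge0 mulr_ge0// ltW.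
  have h2 : 0 <= (2 * lam)^-1 * (lam * w + f x) ^+ 2.
    by rewrite mulr_ge0 ?sqr_ge0// invr_ge0 mulr_ge0// ltW.
  have e1 : (2 * lam)^-1 * (lam * w - f x) ^+ 2 =
    lam / 2 * w ^+ 2 + (2 * lam)^-1 * f x ^+ 2 - w * f x by field; lra.
  have e2 : (2 * lam)^-1 * (lam * w + f x) ^+ 2 =
    lam / 2 * w ^+ 2 + (2 * lam)^-1 * f x ^+ 2 + w * f x by field; lra.
  by rewrite ler_norml; apply/andP; split; lra.
have [||l [m0 [_ hl hm]]] := @improper_Ny R _ _ _ _ ((2 * 1)^-1 * (F 0 - A ^+ 2))
    (fun=> True) 0 (fun _ _ _ _ => I) I dG (dE 1).
- by move=> x _; exact: gE.
- move=> x _; rewrite /E.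
  have : 0 < 1 / (4 * a) * expR (2 * a * x) by rewrite mulr_gt0 ?expR_gt0// divr_gt0// mulr_gt0.
  have : 0 < ((2 * 1)^-1 : R) by rewrite invr_gt0; lra.
  have := hF x 0; nra.
pose u x := expR (- a * x) * (G x - l).
have expN x : expR (- a * x) * expR (a * x) = 1.
  by rewrite -expRD mulNr addNr expR0.
have du : dv u (fun x => f x - a * u x).
  apply: (dv_eq (dvM (dv_expl (- a)) (dvB dG (dv_cst l)))) => x; rewrite /u.
  transitivity (expR (- a * x) * expR (a * x) * f x - a * (expR (- a * x) * (G x - l))); first ring.
  by rewrite expN mul1r.
pose s := 1 / (4 * a) + 1 / 2 : R.
have s0 : 0 < s by rewrite addr_gt0// divr_gt0// mulr_gt0.
have us x : `|u x| <= s * A.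
  suff : `|G x - l| <= expR (a * x) * (s * A).
    move=> h; rewrite normrM ger0_norm ?expR_ge0//.
    have := ler_wpM2l (ltW (expR_gt0 (- a * x))) h.
    by rewrite (mulrA (expR (- a * x))) expN mul1r.
  apply/ler_addgt0Pr => eps eps0.
  have [y0 _ Ey0] := hm _ eps0.
  pose y := Num.min x y0.
  have yx : y <= x by rewrite ge_min lexx.
  have yy0 : y <= y0 by rewrite ge_min lexx orbT.
  have pos lam z : 0 < lam -> 0 <= lam / 2 * expR (a * z) ^+ 2 + (2 * lam)^-1 * f z ^+ 2.
    by move=> l0; apply: le_trans (gE _ _ l0); exact: normr_ge0.
  have Ey : E 1 y <= E 1 y0 by apply: (dv_incr (dE 1) _ yy0) => z; apply: pos.
  have Gy : `|G y - l| <= eps by apply: le_trans (hl y I) _; lra.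
  (* With this [lam] both terms of [E lam] are of order [A exp (a x)] at [x]. *)
  pose lam := A * expR (- a * x).
  have lam0 : 0 < lam by rewrite mulr_gt0// expR_gt0.
  have GE : `|G x - G y| <= E lam x - E lam y.
    have b z : - (lam / 2 * expR (a * z) ^+ 2 + (2 * lam)^-1 * f z ^+ 2) <= expR (a * z) * f z
        <= lam / 2 * expR (a * z) ^+ 2 + (2 * lam)^-1 * f z ^+ 2.
      by rewrite -ler_norml gE.
    rewrite ler_norml; apply/andP; split.
      suff: E lam y + G y <= E lam x + G x by lra.
      by apply: (dv_incr (dvD (dE lam) dG) _ yx) => z; have := b z; lra.
    suff: E lam y - G y <= E lam x - G x by lra.
    by apply: (dv_incr (dvB (dE lam) dG) _ yx) => z; have := b z; lra.
  have Ex : E lam x - E lam y <= expR (a * x) * (s * A).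
    rewrite /E sqE.
    have h1 : 0 <= lam / (4 * a) * expR (2 * a * y).
      by rewrite mulr_ge0 ?expR_ge0// divr_ge0 ?ltW// mulr_gt0.
    have h2 : (2 * lam)^-1 * (F x - F y) <= (2 * lam)^-1 * A ^+ 2.
      by rewrite ler_wpM2l// invr_ge0 mulr_ge0// ltW.
    have e1 : lam / (4 * a) * expR (a * x) ^+ 2 = expR (a * x) * (1 / (4 * a) * A).
      rewrite /lam; transitivity (A / (4 * a) * expR (a * x) * (expR (- a * x) * expR (a * x))); first ring.
      by rewrite expN; ring.
    have e2 : (2 * lam)^-1 * A ^+ 2 = expR (a * x) * (1 / 2 * A).
      have -> : expR (a * x) = (expR (- a * x))^-1 by rewrite -expRN; congr expR; ring.
      rewrite /lam; have := expR_gt0 (- a * x); set w := expR _ => w0; field; lra.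
    have -> : expR (a * x) * (s * A) = expR (a * x) * (1 / (4 * a) * A) + expR (a * x) * (1 / 2 * A).
      by rewrite /s; ring.
    by rewrite -e1 -e2; lra.
  have := ler_normD (G x - G y) (G y - l).
  have -> : G x - G y + (G y - l) = G x - l by ring.
  lra.
exists u; split => //.
- move=> x; apply: le_trans (us x) _; rewrite ler_pM2r// /decay_const -/s.
  have : 0 < s / a by rewrite divr_gt0.
  have : 0 < a^-1 by rewrite invr_gt0.
  lra.
- apply: L2leP; first by rewrite mulr_gt0// decay_const_gt0.
    exact: (dv_continuous du).
  move=> U dU x y xy.
  have dd := dvB (dvM (dv_cst a^-1) dF) (dvD (dvM (dv_cst a) dU) (dvX 1 du)).
  have pos z : 0 <= 0 * F z + a^-1 * f z ^+ 2 - (0 * U z + a * u z ^+ 2 + 2%:R * u z ^+ 1 * (f z - a * u z)).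
    have -> : 0 * F z + a^-1 * f z ^+ 2 - (0 * U z + a * u z ^+ 2 + 2%:R * u z ^+ 1 * (f z - a * u z))
      = a^-1 * (f z - a * u z) ^+ 2 by field; lra.
    by rewrite mulr_ge0 ?sqr_ge0// invr_ge0 ltW.
  have := dv_incr dd pos xy => h.
  have h1 : a * (U y - U x) <= a^-1 * (F y - F x) + u x ^+ 2 by have := sqr_ge0 (u y); lra.
  have h2 : u x ^+ 2 <= (s * A) ^+ 2.
    rewrite -[u x ^+ 2]real_normK ?num_real// ler_sqr ?nnegrE//.
    by rewrite mulr_ge0// ltW.
  have h3 : a^-1 * (F y - F x) <= a^-1 * A ^+ 2 by rewrite ler_wpM2l// invr_ge0 ltW.
  have h4 : a * (U y - U x) <= a * ((a^-1) ^+ 2 + s ^+ 2 / a) * A ^+ 2.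
    have -> : a * ((a^-1) ^+ 2 + s ^+ 2 / a) * A ^+ 2 = a^-1 * A ^+ 2 + (s * A) ^+ 2 by field; lra.
    lra.
  rewrite -mulrA ler_pM2l// in h4; apply: le_trans h4 _.
  rewrite exprMn ler_pM2r ?exprn_gt0// /decay_const -/s.
  set i := a^-1; have i0 : 0 < i by rewrite invr_gt0.
  have := mulr_gt0 s0 i0; nra.
Qed.

(** Solutions are multiples of [exp (a x)], unbounded on one side. *)
Lemma bounded_exponential0 a u : a != 0 -> dv u (fun x => a * u x) ->
  (exists B, forall x, `|u x| <= B) -> forall x, u x = 0.
Proof.
move=> a0 du [B uB].
pose z x := expR (- a * x) * u x.
have dz : dv z (fun=> 0).
  by apply: (dv_eq (dvM (dv_expl (- a)) du)) => x; ring.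
have zc x : u x = expR (a * x) * z 0.
  rewrite (dv0_cst dz (fun=> erefl) 0 x) /z mulrA -expRD mulNr addrN expR0 mul1r//.
suff z0 : z 0 = 0 by move=> x; rewrite zc z0 mulr0.
apply/eqP; rewrite -normr_le0; apply/ler_addgt0Pr => e e0; rewrite add0r.
(* At this point exp (a x) is at least B / e. *)
pose x := B / e / a.
have ax : a * x = B / e by rewrite /x mulrC divfK.
have := uB x; rewrite zc normrM ger0_norm ?expR_ge0// ax.
have B0 : 0 <= B by apply: le_trans (uB 0); exact: normr_ge0.
have : 1 + B / e <= expR (B / e) by exact: expR_ge1Dx.
have Be : 0 <= B / e by rewrite divr_ge0// ltW.
move=> h1 h2; have h3 : (1 + B / e) * `|z 0| <= B.
  by apply: le_trans h2; rewrite ler_wpM2r.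
have h4 : (e + B) * `|z 0| <= e * B.
  by have := ler_wpM2l (ltW e0) h3; rewrite mulrA mulrDr mulr1 [e * (_ / _)]mulrC divfK// gt_eqF.
have := normr_ge0 (z 0); nra.
Qed.

End Solve.

(** * The resolvent of the fourth-order operator *)

Section Chain.
Context {R : realType}.
Implicit Types (f g u v : R -> R) (us vs : nat -> R -> R) (A B x y z : R).

Definition chain us := forall k, (k < 4)%N -> dv (us k) (us k.+1).

(** The fourth derivative is not bounded for a general square-integrable source. *)
Definition bounded4 us A := forall k x, (k < 4)%N -> `|us k x| <= A.

Definition H4le us A :=
  [/\ chain us, bounded4 us A & forall k, (k < 5)%N -> L2le (us k) A].

Lemma chain_lin c us vs : chain us -> chain vs ->
  chain (fun k x => c * us k x + vs k x).
Proof.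
move=> cu cv k k4; apply: (dv_eq (dvD (dvM (dv_cst c) (cu k k4)) (cv k k4))) => x; ring.
Qed.

Lemma bounded4_lin c us vs A B : bounded4 us A -> bounded4 vs B ->
  bounded4 (fun k x => c * us k x + vs k x) (`|c| * A + B).
Proof.
move=> uA vB k x k4; apply: le_trans (ler_normD _ _) _.
by rewrite lerD// ?vB// normrM ler_wpM2l// uA.
Qed.

Lemma L2leZ f A c d : `|c| <= d -> 0 < d -> L2le f A -> L2le (fun x => c * f x) (d * A).
Proof.
move=> cd d0 h; apply: (L2le_dom d0 _ _ h).
  by case: h => _ cf _ x; apply: cvgM; [exact: cvg_cst|exact: cf].
by move=> x; rewrite normrM ler_wpM2r.
Qed.

Lemma H4leD us vs A B : H4le us A -> H4le vs B -> H4le (fun k x => us k x + vs k x) (A + B).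
Proof.
move=> [cu uA uL] [cv vB vL]; split.
- by move=> k k4; exact: dvD (cu k k4) (cv k k4).
- by move=> k x k4; apply: le_trans (ler_normD _ _) _; rewrite lerD ?uA ?vB.
- by move=> k k5; apply: L2leD; [exact: uL|exact: vL].
Qed.

Lemma H4leZ us A c d : `|c| <= d -> 0 < d -> H4le us A -> H4le (fun k x => c * us k x) (d * A).
Proof.
move=> cd d0 [cu uA uL]; split.
- by move=> k k4; apply: (dv_eq (dvM (dv_cst c) (cu k k4))) => x; rewrite mul0r add0r.
- move=> k x k4; rewrite normrM; apply: ler_pM => //; exact: uA.
- by move=> k k5; apply: L2leZ => //; exact: uL.
Qed.

Lemma H4le_mono us A B : A <= B -> H4le us A -> H4le us B.
Proof.
move=> AB [cu uA uL]; split=> //.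
- by move=> k x k4; apply: le_trans AB; exact: uA.
- by move=> k k5; apply: L2le_mono AB _; exact: uL.
Qed.

End Chain.

Section Resolvent.
Context {R : realType} (a b : R).
Hypotheses (a0 : 0 < a) (b0 : 0 < b).
Implicit Types (f g u v : R -> R) (us vs : nat -> R -> R) (A B x y z : R).

(** The bounded solution of [(d^2 - a^2) (d^2 - b^2) u = f], together with its derivatives. *)
Definition Msol f us := [/\ chain us, exists A, bounded4 us A &
  forall x, us 4%N x - (a ^+ 2 + b ^+ 2) * us 2%N x + a ^+ 2 * b ^+ 2 * us 0%N x = f x].

Lemma Msol_lin c f g us vs : Msol f us -> Msol g vs ->
  Msol (fun x => c * f x + g x) (fun k x => c * us k x + vs k x).
Proof.
move=> [cu [A uA] eu] [cv [B vB] ev]; split; first exact: chain_lin.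
  by exists (`|c| * A + B); exact: bounded4_lin.
by move=> x; rewrite -eu -ev; ring.
Qed.

(** The four first-order factors are removed one at a time; at each stage a bounded combination of
the derivatives solves [y' = k y] with [k <> 0]. *)
Lemma Msol0 us : Msol (fun=> 0) us -> forall x, us 0%N x = 0.
Proof.
move=> [cu [A uA] eu].
have d0 := cu 0%N isT; have d1 := cu 1%N isT; have d2 := cu 2%N isT; have d3 := cu 3%N isT.
have bnd c0 c1 c2 c3 : exists B, forall x,
    `|c3 * us 3%N x + c2 * us 2%N x + c1 * us 1%N x + c0 * us 0%N x| <= B.
  exists (`|c3| * A + `|c2| * A + `|c1| * A + `|c0| * A) => x.
  apply: le_trans (ler_normD _ _) _; apply: lerD; last by rewrite normrM ler_wpM2l// uA.
  apply: le_trans (ler_normD _ _) _; apply: lerD; last by rewrite normrM ler_wpM2l// uA.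
  apply: le_trans (ler_normD _ _) _; apply: lerD; last by rewrite normrM ler_wpM2l// uA.
  by rewrite normrM ler_wpM2l// uA.
have a1 : a != 0 by rewrite gt_eqF.
have b1 : b != 0 by rewrite gt_eqF.
have Na1 : - a != 0 by rewrite oppr_eq0.
have Nb1 : - b != 0 by rewrite oppr_eq0.
have e4 x : us 4%N x = (a ^+ 2 + b ^+ 2) * us 2%N x - a ^+ 2 * b ^+ 2 * us 0%N x.
  by have := eu x; lra.
pose comb c0 c1 c2 c3 x := c3 * us 3%N x + c2 * us 2%N x + c1 * us 1%N x + c0 * us 0%N x.
have dcomb c0 c1 c2 c3 : dv (comb c0 c1 c2 c3) (fun x =>
    c3 * us 4%N x + c2 * us 3%N x + c1 * us 2%N x + c0 * us 1%N x).
  apply: (dv_eq (dvD (dvD (dvD (dvM (dv_cst c3) d3) (dvM (dv_cst c2) d2)) (dvM (dv_cst c1) d1)) (dvM (dv_cst c0) d0))).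
  by move=> x; ring.
have y0 : forall x, comb (- a * b ^+ 2) (- b ^+ 2) a 1 x = 0.
  apply: (bounded_exponential0 a1); last exact: bnd.
  by apply: (dv_eq (dcomb _ _ _ _)) => x; rewrite e4 /comb; ring.
have z0 : forall x, comb (- b ^+ 2) 0 1 0 x = 0.
  apply: (bounded_exponential0 Na1); last exact: bnd.
  by apply: (dv_eq (dcomb _ _ _ _)) => x; have := y0 x; rewrite /comb; lra.
have q0 : forall x, comb b 1 0 0 x = 0.
  apply: (bounded_exponential0 b1); last exact: bnd.
  by apply: (dv_eq (dcomb _ _ _ _)) => x; have := z0 x; rewrite /comb; lra.
have r0 : forall x, comb 1 0 0 0 x = 0.
  apply: (bounded_exponential0 Nb1); last exact: bnd.
  by apply: (dv_eq (dcomb _ _ _ _)) => x; have := q0 x; rewrite /comb; lra.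
by move=> x; have := r0 x; rewrite /comb; lra.
Qed.

Lemma chain_determined us vs : chain us -> chain vs -> us 0%N =1 vs 0%N ->
  forall k, (k < 5)%N -> us k =1 vs k.
Proof.
move=> cu cv e; elim=> // k IH k5.
apply: dv_uniq (cu k k5) _; have -> : us k = vs k by apply/funext/IH/ltnW.
exact: cv.
Qed.

Lemma Msol_uniq f us vs : Msol f us -> Msol f vs -> forall k, (k < 5)%N -> us k =1 vs k.
Proof.
move=> su sv; apply: chain_determined; [by case: su|by case: sv|] => x.
have s := Msol_lin (-1) su sv.
have e0 : (fun x => -1 * f x + f x) = (fun=> 0) by apply/funext => y; ring.
rewrite e0 in s; have := Msol0 s x; lra.
Qed.

Lemma Msol_reflect f us : Msol f us ->
  Msol (fun x => f (- x)) (fun k x => (-1) ^+ k * us k (- x)).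
Proof.
move=> [cu [A uA] eu]; split.
- move=> k k4; apply: (dv_eq (dvM (dv_cst _) (dv_comp (cu k k4) (dvN dv_id)))) => x.
  by rewrite exprS; ring.
- by exists A => k x k4; rewrite normrM normrX normrN1 expr1n mul1r uA.
- by move=> x; rewrite -eu; ring.
Qed.

Lemma Msol_even f us : (forall x, f (- x) = f x) -> Msol f us ->
  forall k x, (k < 5)%N -> us k (- x) = (-1) ^+ k * us k x.
Proof.
move=> ef su k x k5.
have := Msol_reflect su; have -> : (fun x => f (- x)) = f by apply/funext.
move=> /(Msol_uniq su)/(_ k k5 x) ->.
by rewrite mulrA -exprMn mulrNN mulr1 expr1n mul1r.
Qed.

(** The reflection of [solve_decay]. *)
Lemma solve_grow c f A : 0 < c -> L2le f A ->
  exists u, [/\ dv u (fun x => f x + c * u x),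
    (forall x, `|u x| <= decay_const c * A) & L2le u (decay_const c * A)].
Proof.
move=> c0 /L2le_reflect/(solve_decay c0)[v [dvv vb vL]].
exists (fun x => - v (- x)); split.
- by apply: (dv_eq (dvN (dv_comp dvv (dvN dv_id)))) => x; rewrite opprK; ring.
- by move=> x; rewrite normrN.
- have := L2leZ (_ : `|-1| <= 1) ltr01 (L2le_reflect vL).
  rewrite normrN1 lexx mul1r => /(_ isT).
  by have -> : (fun x => -1 * v (- x)) = (fun x => - v (- x)) by apply/funext => x; rewrite mulN1r.
Qed.

Definition resolvent_const : R :=
  let K := (1 + decay_const a) ^+ 2 * (1 + decay_const b) ^+ 2 in
  K * (1 + (1 + b) + (1 + b ^+ 2) + (1 + a + b ^+ 2 * (1 + b)) +
       (1 + a ^+ 2 + b ^+ 2 * (1 + b ^+ 2))).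

Lemma resolvent_const_gt0 : 0 < resolvent_const.
Proof.
have da := decay_const_gt0 a0; have db := decay_const_gt0 b0.
have a2 : 0 < a ^+ 2 by rewrite exprn_gt0.
have b2 : 0 < b ^+ 2 by rewrite exprn_gt0.
apply: mulr_gt0; first by rewrite mulr_gt0// exprn_gt0// addr_gt0.
by do ?[apply: addr_gt0|apply: mulr_gt0].
Qed.

(** Four first-order equations are solved in succession, with [k = a, - a, b, - b]; the derivatives
of the last solution are combinations of the intermediate ones. *)
Lemma Msol_exists f A : L2le f A ->
  exists us, Msol f us /\ H4le us (resolvent_const * A).
Proof.
move=> fL; have [A0 cf _] := fL.
have da := decay_const_gt0 a0; have db := decay_const_gt0 b0.
have [w1 [dw1 bw1 Lw1]] := solve_decay a0 fL.
have [v [dvv bv Lv]] := solve_grow a0 Lw1.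
have [w2 [dw2 bw2 Lw2]] := solve_decay b0 Lv.
have [U [dU bU LU]] := solve_grow b0 Lw2.
set p := decay_const a in da bw1 Lw1 bv Lv bw2 Lw2 bU LU.
set q := decay_const b in db bw2 Lw2 bU LU.
pose K := (1 + p) ^+ 2 * (1 + q) ^+ 2 * A.
pose P := [/\ p * A <= K, p * (p * A) <= K, q * (p * (p * A)) <= K, q * (q * (p * (p * A))) <= K & A <= K].
have PP : P.
  have pp : 0 < p * p by exact: mulr_gt0.
  have qq : 0 < q * q by exact: mulr_gt0.
  have pq : 0 < p * q by exact: mulr_gt0.
  have ppq : 0 < p * p * q by exact: mulr_gt0.
  have pqq : 0 < p * q * q by exact: mulr_gt0.
  have ppqq : 0 < p * p * q * q by rewrite !mulr_gt0.
  have le c : c <= (1 + p) ^+ 2 * (1 + q) ^+ 2 -> c * A <= K by move=> h; rewrite ler_pM2r.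
  have le1 : 1 <= (1 + p) ^+ 2 * (1 + q) ^+ 2 by nra.
  split.
  - by apply: le; nra.
  - by rewrite mulrA; apply: le; nra.
  - by rewrite !mulrA; apply: le; nra.
  - by rewrite !mulrA; apply: le; nra.
  - by rewrite -[leLHS]mul1r; exact: le.
have [k1 k2 k3 k4 k5] := PP.
have K0 : 0 < K by exact: lt_le_trans A0 k5.
have {}bw1 x : `|w1 x| <= K by apply: le_trans k1.
have {}bv x : `|v x| <= K by apply: le_trans k2.
have {}bw2 x : `|w2 x| <= K by apply: le_trans k3.
have {}bU x : `|U x| <= K by apply: le_trans k4.
have {}Lw1 := L2le_mono k1 Lw1; have {}Lv := L2le_mono k2 Lv.
have {}Lw2 := L2le_mono k3 Lw2; have {}LU := L2le_mono k4 LU.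
have {}fL := L2le_mono k5 fL.
pose U1 x := w2 x + b * U x.
pose U2 x := v x + b ^+ 2 * U x.
pose U3 x := w1 x + a * v x + b ^+ 2 * U1 x.
pose U4 x := f x + a ^+ 2 * v x + b ^+ 2 * U2 x.
have nc (c : R) : 0 < c -> `|c| <= c by move=> /ltW c0; rewrite ger0_norm.
have LU1 : L2le U1 (K + b * K) by apply: L2leD => //; apply: L2leZ => //; exact: nc.
have b2 : 0 < b ^+ 2 by rewrite exprn_gt0.
have a2 : 0 < a ^+ 2 by rewrite exprn_gt0.
have LU2 : L2le U2 (K + b ^+ 2 * K) by apply: L2leD => //; apply: L2leZ => //; exact: nc.
have LU3 : L2le U3 (K + a * K + b ^+ 2 * (K + b * K)).
  apply: L2leD; last by apply: L2leZ => //; exact: nc.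
  by apply: L2leD => //; apply: L2leZ => //; exact: nc.
have LU4 : L2le U4 (K + a ^+ 2 * K + b ^+ 2 * (K + b ^+ 2 * K)).
  apply: L2leD; last by apply: L2leZ => //; exact: nc.
  by apply: L2leD => //; apply: L2leZ => //; exact: nc.
have bs (s t : R) c S T : 0 < c -> `|s| <= S -> `|t| <= T -> `|s + c * t| <= S + c * T.
  by move=> c0 sS tT; apply: le_trans (ler_normD _ _) _; rewrite normrM (ger0_norm (ltW c0)) lerD// ler_pM2l.
have bU1 x : `|U1 x| <= K + b * K by exact: bs.
have bU2 x : `|U2 x| <= K + b ^+ 2 * K by exact: bs.
have bU3 x : `|U3 x| <= K + a * K + b ^+ 2 * (K + b * K).
  by apply: (bs) => //; exact: bs.
have d1 : dv U U1 by apply: (dv_eq dU).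
have d2 : dv U1 U2.
  by apply: (dv_eq (dvD dw2 (dvM (dv_cst b) d1))) => x; rewrite /U1 /U2; ring.
have d3 : dv U2 U3.
  by apply: (dv_eq (dvD dvv (dvM (dv_cst (b ^+ 2)) d1))) => x; rewrite /U3; ring.
have d4 : dv U3 U4.
  apply: (dv_eq (dvD (dvD dw1 (dvM (dv_cst a) dvv)) (dvM (dv_cst (b ^+ 2)) d2))) => x.
  by rewrite /U4; ring.
pose us k : R -> R := nth U4 [:: U; U1; U2; U3] k.
have cu : chain us by do 4?[case=> //].
have constE : resolvent_const * A = K + (K + b * K) + (K + b ^+ 2 * K) +
   (K + a * K + b ^+ 2 * (K + b * K)) + (K + a ^+ 2 * K + b ^+ 2 * (K + b ^+ 2 * K)).
  by rewrite /resolvent_const -/p -/q /K; ring.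
have t1 : 0 < b * K by exact: mulr_gt0.
have t2 : 0 < b ^+ 2 * K by exact: mulr_gt0.
have t3 : 0 < b ^+ 2 * (b * K) by rewrite mulr_gt0.
have t4 : 0 < b ^+ 2 * (b ^+ 2 * K) by rewrite mulr_gt0.
have t5 : 0 < a * K by exact: mulr_gt0.
have t6 : 0 < a ^+ 2 * K by exact: mulr_gt0.
have bb : bounded4 us (resolvent_const * A).
  rewrite constE; case=> [x _|]; first by apply: le_trans (bU x) _; lra.
  case=> [x _|]; first by apply: le_trans (bU1 x) _; lra.
  case=> [x _|]; first by apply: le_trans (bU2 x) _; lra.
  by case=> [x _|//]; apply: le_trans (bU3 x) _; lra.
exists us; split.
  split => //; first by exists (resolvent_const * A).
  by move=> x; rewrite /us /= /U4 /U2; ring.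
split => //; rewrite constE; case=> [_|]; first by apply: L2le_mono LU; lra.
case=> [_|]; first by apply: L2le_mono LU1; lra.
case=> [_|]; first by apply: L2le_mono LU2; lra.
case=> [_|]; first by apply: L2le_mono LU3; lra.
by case=> [_|//]; apply: L2le_mono LU4; lra.
Qed.

End Resolvent.

(** * Powers of the hyperbolic secant *)

Section Sech.
Context {R : realType} (beta r : R).
Hypotheses (beta0 : 0 < beta) (r0 : 0 < r).
Implicit Types (x y z : R).

Definition sechs x : R := sech (beta * x).
Definition tanhs x : R :=
  (expR (beta * x) - expR (- (beta * x))) / (expR (beta * x) + expR (- (beta * x))).
Definition ground x : R := sechs x `^ r.

Let den_gt0 x : 0 < expR (beta * x) + expR (- (beta * x)).
Proof. by rewrite addr_gt0// expR_gt0. Qed.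

Let den_neq0 x : expR (beta * x) + expR (- (beta * x)) != 0.
Proof. by rewrite gt_eqF. Qed.

Let exp_prod x : expR (beta * x) * expR (- (beta * x)) = 1.
Proof. by rewrite -expRD addrN expR0. Qed.

Lemma sechs_gt0 x : 0 < sechs x.
Proof. by rewrite divr_gt0. Qed.

Lemma sechsE x : sechs x ^+ 2 = 1 - tanhs x ^+ 2.
Proof.
rewrite /sechs /sech /tanhs; have := den_neq0 x; have := exp_prod x.
set p := expR (beta * x); set q := expR _ => pq pq0.
apply/eqP; rewrite -subr_eq0; apply/eqP.
transitivity (4 * (1 - p * q) / (p + q) ^+ 2); first by field.
by rewrite pq subrr mulr0 mul0r.
Qed.

Let dE1 : dv (fun x => expR (beta * x)) (fun x => beta * expR (beta * x)).
Proof. exact: dv_expl. Qed.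

Let dE2 : dv (fun x => expR (- (beta * x))) (fun x => - beta * expR (- (beta * x))).
Proof.
apply: (dv_eq (dv_exp (dvN (dvM (dv_cst beta) dv_id)))) => x; ring.
Qed.

Lemma dv_sechs : dv sechs (fun x => - (beta * tanhs x * sechs x)).
Proof.
have -> : sechs = fun x => 2 * (expR (beta * x) + expR (- (beta * x)))^-1 by [].
apply: (dv_eq (dvM (dv_cst 2) (dv_inv den_neq0 (dvD dE1 dE2)))) => x.
rewrite /tanhs; have := den_neq0 x.
by set p := expR (beta * x); set q := expR _ => pq; field.
Qed.

Lemma dv_tanhs : dv tanhs (fun x => beta * sechs x ^+ 2).
Proof.
apply: (dv_eq (dvM (dvB dE1 dE2) (dv_inv den_neq0 (dvD dE1 dE2)))) => x.
rewrite /sechs /sech; have := den_neq0 x; have := exp_prod x.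
set p := expR (beta * x); set q := expR _ => pq pq0.
transitivity (beta * (4 * (p * q)) / (p + q) ^+ 2); first by field.
by rewrite pq; field.
Qed.

Lemma tanhs0 : tanhs 0 = 0.
Proof. by rewrite /tanhs mulr0 oppr0 subrr mul0r. Qed.

Lemma sechs_even x : sechs (- x) = sechs x.
Proof. by rewrite /sechs /sech mulrN opprK addrC. Qed.

Lemma tanhs_ge0 x : 0 <= x -> 0 <= tanhs x.
Proof.
move=> x0; have := dv_incr dv_tanhs _ x0; rewrite tanhs0; apply => z.
by rewrite mulr_ge0 ?sqr_ge0// ltW.
Qed.

Lemma sechs_le1 x : sechs x <= 1.
Proof.
have := sechsE x; have := sqr_ge0 (tanhs x); have := sechs_gt0 x; nra.
Qed.

Lemma tanhs_sqr_le1 x : tanhs x ^+ 2 <= 1.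
Proof. have := sechsE x; have := sqr_ge0 (sechs x); lra. Qed.

Lemma tanhs_le1 x : `|tanhs x| <= 1.
Proof.
have := tanhs_sqr_le1 x; rewrite -[tanhs x ^+ 2]real_normK ?num_real// -[X in _ <= X -> _](expr1n _ 2).
by rewrite ler_sqr ?nnegrE.
Qed.

Lemma sechs_small e : 0 < e -> exists N, forall x, N <= x -> sechs x <= e.
Proof.
move=> e0; exists (2 / e / beta) => x Nx.
have h : 2 / e <= beta * x by rewrite [beta * x]mulrC -ler_pdivrMr.
rewrite /sechs /sech ler_pdivrMr//.
have : 1 + beta * x <= expR (beta * x) by exact: expR_ge1Dx.
have := expR_gt0 (- (beta * x)).
have : e * (2 / e) = 2 by field; lra.
nra.
Qed.

Lemma ground_gt0 x : 0 < ground x.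
Proof. exact: powR_gt0 (sechs_gt0 x). Qed.

Lemma ground_le1 x : ground x <= 1.
Proof.
have e1 : (1 : R) `^ r = 1 by rewrite powR1.
rewrite /ground -[leRHS]e1; apply: ge0_ler_powR; rewrite ?nnegrE ?ler01 ?sechs_le1 ?(ltW r0)//.
exact/ltW/sechs_gt0.
Qed.

Lemma ground_even x : ground (- x) = ground x.
Proof. by rewrite /ground sechs_even. Qed.

Lemma dv_ground : dv ground (fun x => - (r * beta * tanhs x) * ground x).
Proof.
move=> x; have d1 := is_derive1_powR r (sechs_gt0 x); have d2 := dv_sechs x.
apply: (is_derive_eq (@is_derive1_comp _ (fun y => y `^ r) sechs x _ _ d1 d2)).
rewrite /ground -(mulr_powRB1 (ltW (sechs_gt0 x)) r0); ring.
Qed.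

Lemma ground_small e : 0 < e -> exists N, forall x, N <= x -> ground x <= e.
Proof.
move=> e0; have [N hN] := sechs_small (powR_gt0 r^-1 e0).
exists N => x /hN h; rewrite /ground.
have -> : e = (e `^ r^-1) `^ r by rewrite -powRrM mulVf ?powRr1 ?gt_eqF// ltW.
by apply: ge0_ler_powR => //; rewrite ?nnegrE ?powR_ge0//; apply: ltW => //; exact: sechs_gt0.
Qed.

Lemma ground_expn n x : r * n%:R = 4 -> ground x ^+ n = sechs x ^+ 4.
Proof.
move=> rn; rewrite /ground -powR_mulrn ?powR_ge0// -powRrM rn.
by rewrite powR_mulrn// ltW// sechs_gt0.
Qed.

End Sech.

Lemma groundE (R : realType) (beta r x : R) : ground beta r x = sech (beta * x) `^ r.
Proof. by []. Qed.

Global Opaque sechs tanhs ground.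

(** * Even functions and moments against the ground state *)

Section Cts.
Context {R : realType}.
Implicit Types (f g : R -> R).

Lemma ctsM f g : continuous f -> continuous g -> continuous (fun x => f x * g x).
Proof. by move=> cf cg x; exact: cvgM (cf x) (cg x). Qed.

Lemma ctsD f g : continuous f -> continuous g -> continuous (fun x => f x + g x).
Proof. by move=> cf cg x; exact: cvgD (cf x) (cg x). Qed.

Lemma ctsX f n : continuous f -> continuous (fun x => f x ^+ n).
Proof.
move=> cf; elim: n => [|n IH]; first by move=> x; exact: cvg_cst.
have -> : (fun x => f x ^+ n.+1) = (fun x => f x * f x ^+ n).
  by apply/funext => x; rewrite exprS.
exact: ctsM.
Qed.

Lemma cts_cst (a : R) : continuous (fun _ : R => a).
Proof. by move=> x; exact: cvg_cst. Qed.
End Cts.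

Section EvenL2.
Context {R : realType}.
Implicit Types (f g F G : R -> R) (A B x y z : R).

Lemma prim_even f F : (forall x, f (- x) = f x) -> dv F f ->
  forall x, F (- x) - F 0 = - (F x - F 0).
Proof.
move=> ef dF x.
have d : dv (fun x => F x + F (- x)) (fun=> 0).
  apply: (dv_eq (dvD dF (dv_comp dF (dvN dv_id)))) => z; rewrite ef; ring.
have := dv0_cst d (fun=> erefl) x 0; rewrite oppr0; lra.
Qed.

Lemma L2le_half f A : (forall x, f (- x) = f x) -> L2le f A ->
  forall F, dv F (fun x => f x ^+ 2) -> forall x, F x - F 0 <= A ^+ 2 / 2.
Proof.
move=> ef fA F dF x; have := L2le_prim fA dF (- x) x.
have := prim_even (_ : forall x, f (- x) ^+ 2 = f x ^+ 2) dF x.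
by move=> /(_ (fun x => congr1 (fun z => z ^+ 2) (ef x))); lra.
Qed.

Lemma L2le_of_half f A : 0 < A -> continuous f -> (forall x, f (- x) = f x) ->
  (forall F, dv F (fun x => f x ^+ 2) -> forall x, 0 <= x -> F x - F 0 <= A ^+ 2 / 2) ->
  L2le f A.
Proof.
move=> A0 cf ef h; apply: L2leP => // F dF x y _.
have e := prim_even (_ : forall x, f (- x) ^+ 2 = f x ^+ 2) dF.
have {}e := e (fun x => congr1 (fun z => z ^+ 2) (ef x)).
have b z : - (A ^+ 2 / 2) <= F z - F 0 <= A ^+ 2 / 2.
  have mon u v : u <= v -> F u <= F v by apply: (dv_incr dF) => w; exact: sqr_ge0.
  have A2 : 0 < A ^+ 2 by rewrite exprn_gt0.
  have [z0|/ltW z0] := leP 0 z.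
    by have := h F dF z z0; have := mon _ _ z0; lra.
  have z1 : 0 <= - z by rewrite oppr_ge0.
  by have := h F dF (- z) z1; have := mon _ _ z0; have := e (- z); rewrite opprK; lra.
by have := b x; have := b y; lra.
Qed.

(** Otherwise [f] would exceed [e] beyond [N] and its primitive would be unbounded. *)
Lemma small_far F f B N e : dv F f -> (forall x, 0 <= x -> F x <= B) -> 0 < e -> 0 <= N ->
  exists2 y, N <= y & f y <= e.
Proof.
move=> dF FB e0 N0; pose L := `|B - F N| / e + 1.
have L0 : 0 < L by rewrite /L ltr_wpDl// divr_ge0// ltW.
have NL : N < N + L by rewrite ltrDl.
have [||c + E] := @MVT _ F f N (N + L) NL.
- by move=> x _; exact: dF.
- by apply: continuous_subspaceT; exact: (dv_continuous dF).
rewrite in_itv/= => /andP[Nc _].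
exists c; first exact: ltW.
have FB' : F (N + L) <= B by apply: FB; rewrite addr_ge0// ltW.
have E' : f c * L <= `|B - F N|.
  by apply: le_trans (ler_norm _); rewrite -[leLHS]subr0; move: E; rewrite addrAC subrr add0r; lra.
rewrite leNgt; apply/negP => ec.
have : e * L <= f c * L by rewrite ler_pM2r// ltW.
have -> : e * L = `|B - F N| + e by rewrite /L; field; lra.
lra.
Qed.
End EvenL2.

Section Moment.
Context {R : realType} (beta r : R).
Hypotheses (beta0 : 0 < beta) (r0 : 0 < r).
Implicit Types (f g h u : R -> R) (A B x y z l : R).
Local Notation S := (sechs beta).
Local Notation T := (tanhs beta).
Local Notation phi := (ground beta r).

(** [l] is the integral of [S^4 phi h] over the positive half-line. The rate of convergence is part of
the definition because [spectral_gap] divides the tail by [phi S^2] and still needs it to vanish. *)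
Definition moment h l := exists Q, [/\ dv Q (fun x => S x ^+ 4 * phi x * h x), Q 0 = 0 &
  exists D, forall x, 0 <= x -> `|Q x - l| <= D * (phi x * S x ^+ 3)].

Let cphi : continuous phi. Proof. exact: (dv_continuous (dv_ground beta r0)). Qed.
Let cS : continuous S. Proof. exact: (dv_continuous (dv_sechs beta)). Qed.

Lemma tail_le D e x : phi x <= e -> D * (phi x * S x ^+ 3) <= `|D| * e.
Proof.
move=> pe; have p0 := ground_gt0 beta r x.
have s30 : 0 < S x ^+ 3 by rewrite exprn_gt0// sechs_gt0.
have s3 : S x ^+ 3 <= 1 by rewrite expr_le1// ?sechs_le1// ltW// sechs_gt0.
apply: (@le_trans _ _ (`|D| * (phi x * S x ^+ 3))).
  by apply: ler_wpM2r; [exact: mulr_ge0 (ltW p0) (ltW s30)|exact: ler_norm].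
by rewrite ler_wpM2l//; nra.
Qed.

(** The tail is dominated by [E = A / beta phi S^3 (2 - T)]. The derivative of [phi S^3] alone vanishes
at 0; the factor [2 - T] makes [- E'] dominate [S^4 phi |h|] up to 0. *)
Lemma moment_exists h A : continuous h -> (forall x, `|h x| <= A) -> exists2 l, moment h l & `|l| <= 2 / beta * A.
Proof.
move=> ch hA.
have [Q0 dQ0] : exists Q, dv Q (fun x => S x ^+ 4 * phi x * h x).
  by apply: primitive; apply: ctsM => //; apply: ctsM => //; exact: ctsX.
pose Q x := Q0 x - Q0 0.
have dQ : dv Q (fun x => S x ^+ 4 * phi x * h x).
  by apply: (dv_eq (dvB dQ0 (dv_cst _))) => x; rewrite subr0.
have dS := dv_sechs beta; have dT := dv_tanhs beta; have dphi := dv_ground beta r0.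
pose E x := A / beta * (phi x * S x ^+ 3 * (2 - T x)).
pose e x := A * (phi x * S x ^+ 3) * ((r + 3) * T x * (2 - T x) + S x ^+ 2).
have A0 : 0 <= A by apply: le_trans (hA 0); exact: normr_ge0.
have dE : dv E (fun x => - e x).
  apply: (dv_eq (dvM (dv_cst (A / beta)) (dvM (dvM dphi (dvX 2 dS)) (dvB (dv_cst 2) dT)))) => x.
  by rewrite /e; field; rewrite gt_eqF.
have [|||l [m0 [m00 hl _]]] := @improper_Ny R (fun x => Q (- x)) _ (fun x => E (- x)) _ 0 (fun x => x <= 0) 0
   _ (lexx _) (dv_comp dQ (dvN dv_id)) (dv_comp dE (dvN dv_id)).
- by move=> x y yx x0; exact: le_trans x0.
- move=> x x0; rewrite !mulrN1 normrN opprK.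
  have z0 : 0 <= - x by rewrite oppr_ge0.
  move: (- x) z0 => z z0.
  rewrite normrM ger0_norm; last by rewrite mulr_ge0 ?exprn_ge0// ltW// ?sechs_gt0// ground_gt0.
  rewrite /e.
  have T0 := tanhs_ge0 beta0 z0; have T1 := tanhs_le1 beta z; rewrite ger0_norm// in T1.
  have s0 := sechs_gt0 beta z; have s1 := sechs_le1 beta z; have p0 := ground_gt0 beta r z.
  have k : S z <= (r + 3) * T z * (2 - T z) + S z ^+ 2.
    rewrite sechsE//; have : 0 <= r * T z * (2 - T z).
      by apply: mulr_ge0; [apply: mulr_ge0 => //; exact: ltW|lra].
    nra.
  have w0 : 0 < phi z * S z ^+ 3 by rewrite mulr_gt0// exprn_gt0.
  have -> : S z ^+ 4 * phi z * `|h z| = phi z * S z ^+ 3 * (S z * `|h z|) by ring.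
  rewrite [A * _]mulrC -[leRHS]mulrA ler_pM2l// mulrC.
  by apply: ler_pM => //; exact: ltW.
- move=> x x0; have z0 : 0 <= - x by rewrite oppr_ge0.
  move: (- x) z0 => z z0; rewrite /E.
  have T1 := tanhs_le1 beta z; rewrite ger0_norm ?tanhs_ge0// in T1.
  have p0 := ltW (ground_gt0 beta r z); have s0 := ltW (sechs_gt0 beta z).
  apply: mulr_ge0; first by rewrite divr_ge0// ltW.
  by apply: mulr_ge0; [apply: mulr_ge0 => //; exact: exprn_ge0|lra].
have hE x : 0 <= x -> `|Q x - l| <= 2 * A / beta * (phi x * S x ^+ 3).
  move=> x0; have := hl (- x).
  rewrite opprK oppr_le0 => /(_ x0) h1; apply: le_trans h1 _.
  apply: (@le_trans _ _ (E x)); first lra.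
  have T0 := tanhs_ge0 beta0 x0.
  have p0 := ltW (ground_gt0 beta r x); have s0 := ltW (sechs_gt0 beta x).
  rewrite /E -subr_ge0.
  have -> : 2 * A / beta * (phi x * S x ^+ 3) - A / beta * (phi x * S x ^+ 3 * (2 - T x))
    = A / beta * (phi x * S x ^+ 3) * T x by ring.
  apply: mulr_ge0 => //; apply: mulr_ge0; first by rewrite divr_ge0// ltW.
  by apply: mulr_ge0 => //; exact: exprn_ge0.
have Q00 : Q 0 = 0 by rewrite /Q subrr.
exists l; first by exists Q; split => //; exists (2 * A / beta).
have := hE 0 (lexx _); rewrite Q00 sub0r normrN => h1; apply: le_trans h1 _.
have -> : 2 / beta * A = 2 * A / beta * 1 by ring.
apply: ler_wpM2l; first by rewrite divr_ge0 ?mulr_ge0// ltW.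
have s3 : S 0 ^+ 3 <= 1 by rewrite expr_le1// ?sechs_le1// ltW// sechs_gt0.
have s30 : 0 < S 0 ^+ 3 by rewrite exprn_gt0// sechs_gt0.
have := ground_le1 beta r0 0; have := ground_gt0 beta r 0; nra.
Qed.

Lemma moment_uniq_lim h l l' Q C : moment h l ->
  dv Q (fun x => S x ^+ 4 * phi x * h x) -> Q 0 = 0 ->
  0 <= C -> (forall e, 0 < e -> exists N, forall x, 0 <= x -> N <= x -> `|Q x - l'| <= C * e) -> l = l'.
Proof.
move=> [P [dP P0 [D hD]]] dQ Q0 C0 hQ.
have PQ x : P x = Q x by have := dv_diff dP dQ 0 x; rewrite P0 Q0; lra.
apply/eqP; rewrite -subr_eq0 -normr_le0; apply/ler_addgt0Pr => e e0; rewrite add0r.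
pose d := e / (C + `|D| + 1).
have K0 : 0 < C + `|D| + 1 by have := normr_ge0 D; lra.
have d0 : 0 < d by rewrite divr_gt0.
have [N hN] := hQ _ d0; have [M hM] := ground_small beta0 r0 d0.
pose x := Num.max 0 (Num.max N M).
have x0 : 0 <= x by rewrite le_max lexx.
have Nx : N <= x by rewrite !le_max lexx orbT.
have Mx : M <= x by rewrite !le_max lexx !orbT.
have h1 := hN x x0 Nx; have h2 := hD x x0; have h3 := hM x Mx.
rewrite PQ in h2.
have -> : l - l' = (Q x - l') - (Q x - l) by ring.
apply: le_trans (ler_normB _ _) _.
have h4 := tail_le D h3.
have -> : e = (C + `|D| + 1) * d by rewrite /d; field; lra.
rewrite !mulrDl; lra.
Qed.

Lemma moment_uniq h l l' : moment h l -> moment h l' -> l = l'.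
Proof.
move=> hl [Q [dQ Q0 [D hD]]].
apply: (moment_uniq_lim hl dQ Q0 (normr_ge0 D)) => e e0.
have [N hN] := ground_small beta0 r0 e0; exists N => x x0 /hN h3.
apply: le_trans (hD x x0) _; exact: tail_le.
Qed.

Lemma moment_lin c h h' l l' : moment h l -> moment h' l' ->
  moment (fun x => c * h x + h' x) (c * l + l').
Proof.
move=> [Q [dQ Q0 [D hD]]] [Q' [dQ' Q0' [D' hD']]].
exists (fun x => c * Q x + Q' x); split; last 1 first.
- exists (`|c| * D + D') => x x0.
  have -> : c * Q x + Q' x - (c * l + l') = c * (Q x - l) + (Q' x - l') by ring.
  apply: le_trans (ler_normD _ _) _; rewrite mulrDl lerD ?hD'//.
  by rewrite normrM -mulrA ler_wpM2l// hD.
- by apply: (dv_eq (dvD (dvM (dv_cst c) dQ) dQ')) => x; ring.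
- by rewrite Q0 Q0' mulr0 addr0.
Qed.

End Moment.

(** * The ground state as a generalized eigenfunction *)

Section Spectral.
Context {R : realType} (beta r : R).
Hypotheses (beta0 : 0 < beta) (r0 : 0 < r).
Implicit Types (f g h u : R -> R) (A B x y z l : R).
Local Notation S := (sechs beta).
Local Notation T := (tanhs beta).
Local Notation phi := (ground beta r).
Local Notation Msol := (Msol (beta * r) (beta * (r + 2))).

(** [(d^2 - a^2) (d^2 - b^2) phi = beta^4 lam0 S^4 phi]. *)
Definition lam0 : R := r * (r + 1) * (r + 2) * (r + 3).
(** When [r p = 4] this is [(p + 1) lam0], so that [beta^4 lam1 S^4] is the potential of the
linearized equation. *)
Definition lam1 : R := (r + 1) * (r + 2) * (r + 3) * (r + 4).
(** Replacing [2 r + 4 + 1 / 8] by [2 r + 4] would give [lam1]: the gap is due to the term [1 / 8]. *)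
Definition gap_const : R := lam0 + 2 * (r + 1) * (r + 3) * (2 * r + 4 + 1 / 8).

Lemma lam1_lt_gap_const : lam1 < gap_const.
Proof.
have e : gap_const - lam1 = 2 * (r + 1) * (r + 3) / 8 by rewrite /gap_const /lam1 /lam0; ring.
by rewrite -subr_gt0 e divr_gt0// !mulr_gt0// addr_gt0.
Qed.

Lemma lam0_gt0 : 0 < lam0.
Proof. by rewrite !mulr_gt0// addr_gt0. Qed.

Lemma lam1_gt0 : 0 < lam1.
Proof. by rewrite !mulr_gt0// addr_gt0. Qed.

Let p1 x := - (r * beta * T x).
Let p2 x := - r * beta ^+ 2 * S x ^+ 2 + r ^+ 2 * beta ^+ 2 * T x ^+ 2.
Let p3 x := 2 * r * (r + 1) * beta ^+ 3 * T x * S x ^+ 2 + p1 x * p2 x.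

Let dS := dv_sechs beta.
Let dT := dv_tanhs beta.
Let dphi := dv_ground beta r0.

Let dphi1 : dv (fun x => p1 x * phi x) (fun x => p2 x * phi x).
Proof.
apply: (dv_eq (dvM (dvN (dvM (dv_cst (r * beta)) dT)) dphi)) => x.
by rewrite /p2 /p1; ring.
Qed.

Let dphi2 : dv (fun x => p2 x * phi x) (fun x => p3 x * phi x).
Proof.
apply: (dv_eq (dvM (dvD (dvM (dv_cst (- r * beta ^+ 2)) (dvX 1 dS)) (dvM (dv_cst (r ^+ 2 * beta ^+ 2)) (dvX 1 dT))) dphi)) => x.
by rewrite /p3 /p2 /p1; ring.
Qed.

(** The fourth derivative of [phi], in the form in which the equation for [phi] can be read off. *)
Definition ground4 x : R := (beta ^+ 2 * (r ^+ 2 + (r + 2) ^+ 2)) * (p2 x * phi x)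
    - beta ^+ 4 * r ^+ 2 * (r + 2) ^+ 2 * phi x + beta ^+ 4 * lam0 * S x ^+ 4 * phi x.

Let dphi3 : dv (fun x => p3 x * phi x) ground4.
Proof.
apply: (dv_eq (dvM (dvD (dvM (dvM (dv_cst (2 * r * (r + 1) * beta ^+ 3)) dT) (dvX 1 dS)) (dvM (dvN (dvM (dv_cst (r * beta)) dT)) (dvD (dvM (dv_cst (- r * beta ^+ 2)) (dvX 1 dS)) (dvM (dv_cst (r ^+ 2 * beta ^+ 2)) (dvX 1 dT))))) dphi)) => x.
have e4 : S x ^+ 4 = S x ^+ 2 * S x ^+ 2 by ring.
rewrite /ground4 e4 /p3 /p2 /p1 /lam0 expr1.
have -> : 2%:R * S x * - (beta * T x * S x) = - (2 * beta * T x * S x ^+ 2) by ring.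
by rewrite !sechsE; ring.
Qed.

Definition ground_chain (k : nat) : R -> R :=
  nth ground4 [:: phi; (fun x => p1 x * phi x); (fun x => p2 x * phi x); (fun x => p3 x * phi x)] k.

Lemma chain_ground : chain ground_chain.
Proof.
case=> [_|]; first by apply: (dv_eq dphi).
by do 3?[case=> //].
Qed.

Let coef_bounded : exists2 P, 0 <= P &
  forall x, [/\ `|p1 x| <= P, `|p2 x| <= P & `|p3 x| <= P].
Proof.
pose P1 := r * beta; pose P2 := r * beta ^+ 2 + r ^+ 2 * beta ^+ 2.
pose c3 := 2 * r * (r + 1) * beta ^+ 3; pose P3 := c3 + P1 * P2.
have P10 : 0 <= P1 by apply: mulr_ge0; exact: ltW.
have q1 : 0 <= r * beta ^+ 2 by rewrite mulr_ge0 ?exprn_ge0// ltW.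
have q2 : 0 <= r ^+ 2 * beta ^+ 2 by rewrite mulr_ge0 ?exprn_ge0// ltW.
have q3 : 0 <= c3.
  apply: mulr_ge0; last by rewrite exprn_ge0// ltW.
  by apply: mulr_ge0; [exact: mulr_ge0 (ler0n _ 2) (ltW r0)|exact: addr_ge0 (ltW r0) ler01].
have P20 : 0 <= P2 by exact: addr_ge0.
have P30 : 0 <= P3 by apply: addr_ge0 => //; exact: mulr_ge0.
exists (P1 + P2 + P3); first by apply: addr_ge0 => //; exact: addr_ge0.
move=> x.
have t1 := tanhs_le1 beta x.
have s1 : `|S x ^+ 2| <= 1.
  rewrite normrX expr_le1// ger0_norm ?sechs_le1//; exact/ltW/sechs_gt0.
have t2 : `|T x ^+ 2| <= 1 by rewrite normrX expr_le1.
have bd (c s : R) : 0 <= c -> `|s| <= 1 -> `|c * s| <= c.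
  by move=> c0 s1'; rewrite normrM (ger0_norm c0) ler_piMr.
have h1 : `|p1 x| <= P1 by rewrite normrN; exact: bd.
have h2 : `|p2 x| <= P2.
  apply: le_trans (ler_normD _ _) _; apply: lerD; last exact: bd.
  by rewrite !mulNr normrN; exact: bd.
have h3 : `|p3 x| <= P3.
  apply: le_trans (ler_normD _ _) _; apply: lerD; last by rewrite normrM ler_pM.
  rewrite -mulrA; apply: bd => //; rewrite normrM; apply: mulr_ile1 => //.
by split; lra.
Qed.

Lemma bounded_ground : exists A, bounded4 ground_chain A.
Proof.
have [P P0 hP] := coef_bounded; exists (1 + P) => k x.
have f0 := ground_gt0 beta r x; have f1 := ground_le1 beta r0 x.
have [h1 h2 h3] := hP x.
have nf : `|phi x| <= 1 by rewrite ger0_norm// ltW.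
have mb p : `|p| <= P -> `|p * phi x| <= 1 + P.
  move=> pP; rewrite normrM; apply: (@le_trans _ _ (P * 1)); first by rewrite ler_pM.
  by rewrite mulr1; lra.
case: k => [_|]; first by apply: le_trans nf _; lra.
by case=> [_|]; [exact: mb|]; case=> [_|]; [exact: mb|]; case=> [_|//]; exact: mb.
Qed.

Lemma ground_Msol : Msol (fun x => beta ^+ 4 * lam0 * S x ^+ 4 * phi x) ground_chain.
Proof.
split; [exact: chain_ground|exact: bounded_ground|].
by move=> x; rewrite /ground_chain /= /ground4; ring.
Qed.

(** Green's formula: the Wronskian [W] of [us 0] and [phi] vanishes at 0, because the odd derivatives
of even functions do, and at infinity, because [phi] decays; its derivative is
[beta^4 (lam1 S^4 phi g - lam0 S^4 phi u)]. *)
Lemma moment_resolvent g us l l' : (forall x, g (- x) = g x) ->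
  Msol (fun x => beta ^+ 4 * lam1 * S x ^+ 4 * g x) us ->
  moment beta r g l -> moment beta r (us 0%N) l' -> lam0 * l' = lam1 * l.
Proof.
move=> ge su [Q [dQ Q0 [D hD]]] ml'.
have [cu [A uA] eu] := su.
have d0 := cu 0%N isT; have d1 := cu 1%N isT; have d2 := cu 2%N isT; have d3 := cu 3%N isT.
have fe x : beta ^+ 4 * lam1 * S (- x) ^+ 4 * g (- x) = beta ^+ 4 * lam1 * S x ^+ 4 * g x.
  by rewrite sechs_even ge.
have ue := Msol_even (mulr_gt0 beta0 r0) (mulr_gt0 beta0 (addr_gt0 r0 (ltr0Sn R 1))) fe su.
have u10 : us 1%N 0 = 0 by have := ue 1%N 0 isT; rewrite oppr0; lra.
have u30 : us 3%N 0 = 0 by have := ue 3%N 0 isT; rewrite oppr0; lra.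
pose al := beta ^+ 2 * (r ^+ 2 + (r + 2) ^+ 2).
pose W x := phi x * us 3%N x - p1 x * phi x * us 2%N x + p2 x * phi x * us 1%N x - p3 x * phi x * us 0%N x
   - al * (phi x * us 1%N x - p1 x * phi x * us 0%N x).
have dW : dv W (fun x => beta ^+ 4 * (lam1 * (S x ^+ 4 * phi x * g x) - lam0 * (S x ^+ 4 * phi x * us 0%N x))).
  have dd := dvB (dvB (dvD (dvB (dvM dphi d3) (dvM dphi1 d2)) (dvM dphi2 d1)) (dvM dphi3 d0))
    (dvM (dv_cst al) (dvB (dvM dphi d1) (dvM dphi1 d0))).
  apply: (dv_eq dd) => x; rewrite /ground4 /al.
  have := eu x; set F := beta ^+ 4 * lam1 * _ * _ => e.
  have -> : us 4%N x = F + al * us 2%N x - beta ^+ 4 * r ^+ 2 * (r + 2) ^+ 2 * us 0%N x.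
    by rewrite -e /al; ring.
  by rewrite /F /al /p1; ring.
have W0 : W 0 = 0.
  by rewrite /W u10 u30 /p3 /p1 tanhs0; ring.
have b4 : 0 < beta ^+ 4 by rewrite exprn_gt0.
have lm := lam0_gt0.
pose P x := lam0^-1 * (lam1 * Q x - (beta ^+ 4)^-1 * W x).
have dP : dv P (fun x => S x ^+ 4 * phi x * us 0%N x).
  apply: (dv_eq (dvM (dv_cst lam0^-1) (dvB (dvM (dv_cst lam1) dQ) (dvM (dv_cst (beta ^+ 4)^-1) dW)))) => x.
  by field; rewrite !gt_eqF.
have P0 : P 0 = 0 by rewrite /P Q0 W0; ring.
have [B hB] := bounded_ground.
have B0 : 0 <= B by apply: le_trans (hB 0%N 0 isT).
have A0 : 0 <= A by apply: le_trans (uA 0%N 0 isT).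
suff -> : l' = lam0^-1 * (lam1 * l) by rewrite mulrA divff ?mul1r// gt_eqF.
have [K K0 hK] : exists2 K, 0 <= K & forall x, `|W x| <= K * phi x.
  have [c c0 hc] := coef_bounded.
  exists (A + c * A + c * A + c * A + `|al| * (A + c * A)).
    by rewrite !addr_ge0 ?mulr_ge0// addr_ge0// mulr_ge0.
  move=> x; have [h1 h2 h3] := hc x.
  have f0 := ground_gt0 beta r x.
  have -> : W x = (us 3%N x - p1 x * us 2%N x + p2 x * us 1%N x - p3 x * us 0%N x
    - al * (us 1%N x - p1 x * us 0%N x)) * phi x by rewrite /W; ring.
  rewrite normrM (ger0_norm (ltW f0)) ler_pM2r//.
  have pm p k : (k < 4)%N -> `|p| <= c -> `|p * us k x| <= c * A.
    by move=> k4 pc; rewrite normrM ler_pM// uA.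
  apply: le_trans (ler_normB _ _) _; apply: lerD; last first.
    rewrite normrM ler_wpM2l//; apply: le_trans (ler_normB _ _) _; apply: lerD; [exact: uA|exact: pm].
  apply: le_trans (ler_normB _ _) _; apply: lerD; last exact: pm.
  apply: le_trans (ler_normD _ _) _; apply: lerD; last exact: pm.
  by apply: le_trans (ler_normB _ _) _; apply: lerD; [exact: uA|exact: pm].
pose C := lam0^-1 * (lam1 * `|D| + (beta ^+ 4)^-1 * K).
have l1 := lam1_gt0.
have i4 : 0 <= (beta ^+ 4)^-1 by rewrite invr_ge0 ltW.
have i0 : 0 <= lam0^-1 by rewrite invr_ge0 ltW.
have C0 : 0 <= C by rewrite mulr_ge0// addr_ge0// mulr_ge0// ltW.
apply: (moment_uniq_lim beta0 r0 ml' dP P0 C0) => e e0.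
have [N hN] := ground_small beta0 r0 e0; exists N => x x0 /hN fe1.
have -> : P x - lam0^-1 * (lam1 * l) = lam0^-1 * (lam1 * (Q x - l) - (beta ^+ 4)^-1 * W x).
  by rewrite /P; ring.
rewrite normrM (ger0_norm i0) /C -[leRHS]mulrA; apply: ler_wpM2l => //.
apply: le_trans (ler_normB _ _) _; rewrite mulrDl; apply: lerD.
  rewrite normrM (ger0_norm (ltW l1)) -[leRHS]mulrA ler_pM2l//.
  apply: le_trans (hD x x0) _; exact: tail_le.
rewrite normrM (ger0_norm i4) -[leRHS]mulrA ler_wpM2l//; apply: le_trans (hK x) _.
by rewrite ler_wpM2l.
Qed.

End Spectral.

(** * The spectral gap *)

Section Gap.
Context {R : realType} (beta r : R).
Hypotheses (beta0 : 0 < beta) (r0 : 0 < r).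
Implicit Types (f g h u : R -> R) (A B x y z l : R).
Local Notation S := (sechs beta).
Local Notation T := (tanhs beta).
Local Notation phi := (ground beta r).
Local Notation Msol := (Msol (beta * r) (beta * (r + 2))).
Local Notation lam0 := (lam0 r).
Local Notation lam1 := (lam1 r).
Local Notation gap_const := (gap_const r).

Let dS := dv_sechs beta.
Let dT := dv_tanhs beta.
Let dphi := dv_ground beta r0.

Let X : R := 2 * r + 4 + 1 / 8.
Let Y : R := X * beta ^+ 2.
Let a0 : R := 2 * (r + 1) * (r + 3).
(** A solution of the Riccati inequality [riccati]. The function [- beta (2 r + 4) T] would satisfy it with
the constant [2 r + 4] in [X]; the correction in [S^2] gains [1 / 8]. *)
Let tau x := beta * (- (2 * r + 4) * T x + S x ^+ 2 * (1 / 2 - 3 / 8 * T x)).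
(** [u'' + P u' + Qc u] is the second-order expression whose square is split off from [u f]. *)
Let P x := (2 * r + 2) * beta * T x.
Let Qc x := beta ^+ 2 * (r * S x ^+ 2 + r * (r + 2) * T x ^+ 2).
Let al : R := beta ^+ 2 * (r ^+ 2 + (r + 2) ^+ 2).
Let c3 x := 2 * r * (r + 1) * beta ^+ 3 * T x * S x ^+ 2 - P x * Qc x - a0 * beta ^+ 3 * r * T x * S x ^+ 2.

(** By [dPsi], [u f] minus [beta^4 gap_const S^4 u^2] minus the derivative of [Psi] is a sum of squares. In
[spectral_gap], [J = - Q / (phi S^2)] with [Q] the primitive of [S^4 phi u]. *)
Let Psi u u1 u2 u3 (J : R -> R) x := u x * u3 x - u1 x * u2 x - P x * u1 x ^+ 2
  + (- al - 2 * Qc x) * (u x * u1 x) + c3 x * u x ^+ 2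
  + a0 * beta ^+ 2 * Y * (2 * (u x * S x ^+ 2 * J x) + tau x * J x ^+ 2).

Let dtau : dv tau (fun x => beta ^+ 2 * (- (2 * r + 4) * S x ^+ 2
   - 2 * T x * S x ^+ 2 * (1 / 2 - 3 / 8 * T x) - 3 / 8 * S x ^+ 4)).
Proof.
apply: (dv_eq (dvM (dv_cst beta) (dvD (dvM (dv_cst (- (2 * r + 4))) dT) (dvM (dvX 1 dS) (dvB (dv_cst (1 / 2)) (dvM (dv_cst (3 / 8)) dT)))))) => x.
by rewrite expr1; field.
Qed.

(** Makes the coefficient of [J^2] in [dPsi] nonnegative; the left-hand side is
[tau' + 2 (r + 2) beta T tau + tau^2]. *)
Let riccati x : 0 <= x ->
  beta ^+ 2 * (- (2 * r + 4) * S x ^+ 2 - 2 * T x * S x ^+ 2 * (1 / 2 - 3 / 8 * T x) - 3 / 8 * S x ^+ 4)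
  + 2 * (r + 2) * beta * T x * tau x + tau x ^+ 2 <= - Y * S x ^+ 2.
Proof.
move=> x0; have T0 := tanhs_ge0 beta0 x0; have T1 := tanhs_le1 beta x.
rewrite ger0_norm// in T1.
have s2 := sechsE beta x.
have s0 : 0 < S x ^+ 2 by rewrite exprn_gt0// sechs_gt0.
rewrite -subr_ge0.
set t := T x in T0 T1 s2 *.
have -> : - Y * S x ^+ 2 - (beta ^+ 2 * (- (2 * r + 4) * S x ^+ 2 - 2 * t * S x ^+ 2 * (1 / 2 - 3 / 8 * t) - 3 / 8 * S x ^+ 4)
  + 2 * (r + 2) * beta * t * tau x + tau x ^+ 2)
  = beta ^+ 2 * S x ^+ 2 * ((2 * r + 4) * t * (1 / 2 - 3 / 8 * t) + 2 * t * (1 / 2 - 3 / 8 * t) + 3 / 8 * S x ^+ 2 - 1 / 8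
     - S x ^+ 2 * (1 / 2 - 3 / 8 * t) ^+ 2).
  rewrite /Y /X /tau -/t.
  have -> : S x ^+ 4 = S x ^+ 2 * S x ^+ 2 by ring.
  by rewrite !s2; field.
apply: mulr_ge0; first by rewrite mulr_ge0 ?sqr_ge0.
have g0 : 1 / 8 <= 1 / 2 - 3 / 8 * t by lra.
have g1 : 1 / 2 - 3 / 8 * t <= 1 / 2 by lra.
set g := 1 / 2 - 3 / 8 * t in g0 g1 *.
have gg : g ^+ 2 <= 1 / 4 by nra.
have h1 : S x ^+ 2 * g ^+ 2 <= S x ^+ 2 * (1 / 4) by rewrite ler_pM2l.
have h2 : 0 <= t * g by rewrite mulr_ge0//; lra.
have h3 : 0 <= r * (t * g) by rewrite mulr_ge0// ltW.
have h4 : t * (1 / 8) <= t * g by rewrite ler_wpM2l.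
nra.
Qed.

Let bracket x := beta ^+ 2 * (- (2 * r + 4) * S x ^+ 2 - 2 * T x * S x ^+ 2 * (1 / 2 - 3 / 8 * T x) - 3 / 8 * S x ^+ 4)
  + 2 * (r + 2) * beta * T x * tau x + tau x ^+ 2.

(** The term with the factor [a0] is [S^2 (v^2 - Y S^2 u^2)] up to a derivative, with
[v = u' + r beta T u = phi (u / phi)'] and the squares completed by means of [J]: it expresses the Poincare inequality
[\int S^2 v^2 >= Y \int S^4 u^2] for functions of zero moment. *)
Let dPsi u u1 u2 u3 u4 J : dv u u1 -> dv u1 u2 -> dv u2 u3 -> dv u3 u4 ->
  dv J (fun x => (r + 2) * beta * T x * J x - S x ^+ 2 * u x) ->
  dv (Psi u u1 u2 u3 J) (fun x =>
    u x * (u4 x - al * u2 x + beta ^+ 4 * r ^+ 2 * (r + 2) ^+ 2 * u x)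
    - beta ^+ 4 * gap_const * S x ^+ 4 * u x ^+ 2
    - (u2 x + P x * u1 x + Qc x * u x) ^+ 2
    - a0 * beta ^+ 2 * (S x ^+ 2 * (u1 x + r * beta * T x * u x - Y * J x) ^+ 2
      + Y * ((S x ^+ 2 * u x + tau x * J x) ^+ 2 - (bracket x + Y * S x ^+ 2) * J x ^+ 2))).
Proof.
move=> d0 d1 d2 d3 dJ.
have dS2 : dv (fun x => S x ^+ 2) (fun x => - 2 * beta * T x * S x ^+ 2).
  by apply: (dv_eq (dvX 1 dS)) => x; ring.
have dT2 : dv (fun x => T x ^+ 2) (fun x => 2 * beta * T x * S x ^+ 2).
  by apply: (dv_eq (dvX 1 dT)) => x; ring.
have dP : dv P (fun x => (2 * r + 2) * beta * (beta * S x ^+ 2)).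
  by apply: (dv_eq (dvM (dv_cst ((2 * r + 2) * beta)) dT)) => x; ring.
have dQ : dv Qc (fun x => 2 * r * (r + 1) * beta ^+ 3 * T x * S x ^+ 2).
  by apply: (dv_eq (dvM (dv_cst (beta ^+ 2)) (dvD (dvM (dv_cst r) dS2) (dvM (dv_cst (r * (r + 2))) dT2)))) => x; ring.
have dTS : dv (fun x => T x * S x ^+ 2) (fun x => beta * S x ^+ 2 * S x ^+ 2 - 2 * beta * T x ^+ 2 * S x ^+ 2).
  by apply: (dv_eq (dvM dT dS2)) => x; ring.
have dc3 : dv c3 (fun x => (2 * r * (r + 1) * beta ^+ 3 - a0 * beta ^+ 3 * r) * (beta * S x ^+ 2 * S x ^+ 2 - 2 * beta * T x ^+ 2 * S x ^+ 2)
   - ((2 * r + 2) * beta * (beta * S x ^+ 2) * Qc x + P x * (2 * r * (r + 1) * beta ^+ 3 * T x * S x ^+ 2))).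
  have -> : c3 = fun x => (2 * r * (r + 1) * beta ^+ 3 - a0 * beta ^+ 3 * r) * (T x * S x ^+ 2) - P x * Qc x.
    by apply/funext => x; rewrite /c3; ring.
  by apply: (dv_eq (dvB (dvM (dv_cst _) dTS) (dvM dP dQ))) => x; ring.
have dd := dvD (dvD (dvD (dvB (dvB (dvM d0 d3) (dvM d1 d2)) (dvM dP (dvX 1 d1)))
   (dvM (dvB (dv_cst (- al)) (dvM (dv_cst 2) dQ)) (dvM d0 d1))) (dvM dc3 (dvX 1 d0)))
   (dvM (dv_cst (a0 * beta ^+ 2 * Y)) (dvD (dvM (dv_cst 2) (dvM (dvM d0 dS2) dJ)) (dvM dtau (dvX 1 dJ)))).
apply: (dv_eq dd) => x.
rewrite /bracket; set t1 := tau x.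
have e4 : S x ^+ 4 = S x ^+ 2 * S x ^+ 2 by ring.
rewrite /c3 /Y /Qc /P /al /gap_const /lam0 /a0 /X !expr1 e4 !sechsE.
by field.
Qed.

Let bdd (f : R -> R) := exists2 c, 0 <= c & forall x, `|f x| <= c.

Let bddM f g : bdd f -> bdd g -> bdd (fun x => f x * g x).
Proof.
move=> [c c0 hc] [d d0 hd]; exists (c * d); first exact: mulr_ge0.
by move=> x; rewrite normrM ler_pM.
Qed.

Let bddD f g : bdd f -> bdd g -> bdd (fun x => f x + g x).
Proof.
move=> [c c0 hc] [d d0 hd]; exists (c + d); first exact: addr_ge0.
by move=> x; apply: le_trans (ler_normD _ _) _; exact: lerD.
Qed.

Let bddN f : bdd f -> bdd (fun x => - f x).
Proof. by move=> [c c0 hc]; exists c => // x; rewrite normrN. Qed.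

Let bddc a : bdd (fun=> a).
Proof. by exists `|a|. Qed.

Let bddT : bdd T.
Proof. by exists 1 => // x; exact: tanhs_le1. Qed.

Let bddS : bdd S.
Proof.
by exists 1 => // x; rewrite ger0_norm ?sechs_le1//; exact/ltW/sechs_gt0.
Qed.

Let bddX f n : bdd f -> bdd (fun x => f x ^+ n).
Proof.
move=> bf; elim: n => [|n IH]; first exact: bddc.
have -> : (fun x => f x ^+ n.+1) = fun x => f x * f x ^+ n.
  by apply/funext => x; rewrite exprS.
exact: bddM.
Qed.

Let Psi_le : exists2 C, 0 <= C & forall u u1 u2 u3 J x,
  `|Psi u u1 u2 u3 J x| <= C * (u x ^+ 2 + u1 x ^+ 2 + u2 x ^+ 2 + u3 x ^+ 2 + J x ^+ 2).
Proof.
have bP : bdd P by apply: bddM; [exact: bddc|exact: bddT].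
have bQ : bdd Qc.
  apply: bddM; first exact: bddc.
  by apply: bddD; apply: bddM; [exact: bddc|exact: bddX|exact: bddc|exact: bddX].
have b2 : bdd (fun x => - al - 2 * Qc x).
  by apply: bddD; [exact: bddc|apply: bddN; apply: bddM => //; exact: bddc].
have b3 : bdd c3.
  apply: bddD; last apply: bddN.
    apply: bddD; last by apply: bddN; exact: bddM.
    by apply: bddM; [apply: bddM => //; exact: bddc|exact: bddX].
  by apply: bddM; [apply: bddM => //; exact: bddc|exact: bddX].
have bt : bdd tau.
  apply: bddM; first exact: bddc.
  apply: bddD; first by apply: bddM => //; exact: bddc.
  apply: bddM; first exact: bddX.
  by apply: bddD; [exact: bddc|apply: bddN; apply: bddM => //; exact: bddc].
have [p p0 hp] := bP; have [c c0 hc] := b2; have [d d0 hd] := b3; have [t t0 ht] := bt.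
pose m := `|a0 * beta ^+ 2 * Y|.
have m0 : 0 <= m by exact: normr_ge0.
exists (1 + 1 + p + c + d + m * (2 + t)).
  by do ?[apply: addr_ge0 => //|apply: mulr_ge0 => //].
move=> u u1 u2 u3 J x.
have xy (a b : R) : `|a * b| <= a ^+ 2 + b ^+ 2.
  have := sqr_ge0 (a - b); have := sqr_ge0 (a + b); have := sqr_ge0 a; have := sqr_ge0 b.
  by rewrite ler_norml => *; apply/andP; split; nra.
set q := _ + J x ^+ 2.
have [k0 k1 k2 k3 k4] : [/\ 0 <= u x ^+ 2, 0 <= u1 x ^+ 2, 0 <= u2 x ^+ 2, 0 <= u3 x ^+ 2 & 0 <= J x ^+ 2].
  by split; exact: sqr_ge0.
have bm (a b e f : R) : 0 <= e -> `|a| <= e -> `|b| <= f -> `|a * b| <= e * f.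
  by move=> e0 ae bf; rewrite normrM ler_pM.
rewrite /Psi.
apply: le_trans (ler_normD _ _) _; rewrite [leRHS]mulrDl; apply: lerD; last first.
  rewrite -[leRHS]mulrA; apply: (bm) => //; apply: le_trans (ler_normD _ _) _; rewrite [leRHS]mulrDl; apply: lerD.
    apply: (bm) => //; first by rewrite ger0_norm.
    have s1 : `|S x ^+ 2| <= 1.
      rewrite normrX expr_le1// ger0_norm ?sechs_le1//; exact/ltW/sechs_gt0.
    have -> : u x * S x ^+ 2 * J x = S x ^+ 2 * (u x * J x) by ring.
    rewrite -[q]mul1r; apply: (bm) => //; apply: le_trans (xy _ _) _; rewrite /q; lra.
  apply: (bm) => //; rewrite ger0_norm// /q; lra.
apply: le_trans (ler_normD _ _) _; rewrite [leRHS]mulrDl; apply: lerD; last first.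
  apply: (bm) => //; rewrite ger0_norm// /q; lra.
apply: le_trans (ler_normD _ _) _; rewrite [leRHS]mulrDl; apply: lerD; last first.
  apply: (bm) => //; apply: le_trans (xy _ _) _; rewrite /q; lra.
apply: le_trans (ler_normB _ _) _; rewrite [leRHS]mulrDl; apply: lerD; last first.
  apply: (bm) => //; rewrite ger0_norm// /q; lra.
apply: le_trans (ler_normB _ _) _; rewrite [leRHS]mulrDl !mul1r; apply: lerD.
  by apply: le_trans (xy _ _) _; rewrite /q; lra.
by apply: le_trans (xy _ _) _; rewrite /q; lra.
Qed.

(** Let [u = us 0] and [f] its source. Integrating [dPsi] gives [\int f u >= beta^4 gap_const \int S^4 u^2], where
[f u = beta^4 lam1 S^4 g u], and the Cauchy-Schwarz inequality concludes. The boundary terms vanish at 0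
by parity and at infinity because [J] tends to 0 there, which is the hypothesis of zero moment. *)
Lemma spectral_gap g us A A' : (forall x, g (- x) = g x) ->
  Msol (fun x => beta ^+ 4 * lam1 * S x ^+ 4 * g x) us -> H4le us A' ->
  moment beta r (us 0%N) 0 -> L2le (fun x => S x ^+ 2 * g x) A ->
  L2le (fun x => S x ^+ 2 * us 0%N x) (lam1 / gap_const * A).
Proof.
move=> ge su [cu bu Lu] [Q [dQ Q0 [D hD]]] Lg.
have [_ _ eu] := su.
have d0 := cu 0%N isT; have d1 := cu 1%N isT; have d2 := cu 2%N isT; have d3 := cu 3%N isT.
have fe x : beta ^+ 4 * lam1 * S (- x) ^+ 4 * g (- x) = beta ^+ 4 * lam1 * S x ^+ 4 * g x.
  by rewrite sechs_even ge.
have ue := Msol_even (mulr_gt0 beta0 r0) (mulr_gt0 beta0 (addr_gt0 r0 (ltr0Sn R 1))) fe su.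
have u10 : us 1%N 0 = 0 by have := ue 1%N 0 isT; rewrite oppr0; lra.
have u30 : us 3%N 0 = 0 by have := ue 3%N 0 isT; rewrite oppr0; lra.
have ue0 x : us 0%N (- x) = us 0%N x by rewrite ue// expr0 mul1r.
have k0 : 0 < gap_const by exact: lt_trans (lam1_gt0 r0) (lam1_lt_gap_const r0).
have l0 := lam1_gt0 r0.
have [A0 cg _] := Lg.
have fS x : phi x * S x ^+ 2 != 0.
  by rewrite gt_eqF// mulr_gt0 ?exprn_gt0 ?ground_gt0 ?sechs_gt0.
pose J x := - Q x * (phi x * S x ^+ 2)^-1.
have dJ : dv J (fun x => (r + 2) * beta * T x * J x - S x ^+ 2 * us 0%N x).
  apply: (dv_eq (dvM (dvN dQ) (dv_inv fS (dvM dphi (dvX 1 dS))))) => x.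
  have p0 := ground_gt0 beta r x; have s0 := sechs_gt0 beta x.
  by rewrite /J expr1; field; rewrite !gt_eqF.
have JS x : 0 <= x -> J x ^+ 2 <= (D ^+ 2) * S x ^+ 2.
  move=> x0; have p0 := ground_gt0 beta r x; have s0 := sechs_gt0 beta x.
  have ps : 0 < phi x * S x ^+ 2 by rewrite mulr_gt0// exprn_gt0.
  have := hD x x0; rewrite subr0 => h.
  have : `|J x| <= D * S x.
    rewrite /J normrM normrN normfV (ger0_norm (ltW ps)) ler_pdivrMr//.
    have -> : D * S x * (phi x * S x ^+ 2) = D * (phi x * S x ^+ 3) by ring.
    exact: h.
  rewrite -exprMn -[J x ^+ 2]real_normK ?num_real// => h'.
  by rewrite ler_sqr ?nnegrE//; exact: le_trans h'.
have J0 : J 0 = 0 by rewrite /J Q0 oppr0 mul0r.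
have [C C0 hC] := Psi_le.
pose Ps := Psi (us 0%N) (us 1%N) (us 2%N) (us 3%N) J.
have Ps0 : Ps 0 = 0.
  by rewrite /Ps /Psi u10 u30 J0 /c3 /P tanhs0; ring.
apply: L2le_of_half.
- by rewrite mulr_gt0// divr_gt0.
- by apply: (dv_continuous (dvM (dvX 1 dS) d0)).
- by move=> x; rewrite sechs_even ue0.
move=> V dV x x0.
have [H dH] : exists H, dv H (fun x => (S x ^+ 2 * g x) ^+ 2).
  by apply: primitive; apply: ctsX.
have Hx := L2le_half (_ : forall x, S (- x) ^+ 2 * g (- x) = S x ^+ 2 * g x) Lg dH.
have {}Hx y : H y - H 0 <= A ^+ 2 / 2 by apply: Hx => z; rewrite sechs_even ge.
have b4 : 0 < beta ^+ 4 by rewrite exprn_gt0.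
(* Young's inequality for [lam1 S^4 g u], with the weight that uses up half of [gap_const S^4 u^2]. *)
pose W x := (lam1 ^+ 2 / (2 * gap_const)) * H x - (beta ^+ 4)^-1 * Ps x - gap_const / 2 * V x.
have monW y z : 0 <= y -> y <= z -> W y <= W z.
  have dd := dvB (dvB (dvM (dv_cst (lam1 ^+ 2 / (2 * gap_const))) dH)
    (dvM (dv_cst (beta ^+ 4)^-1) (dPsi d0 d1 d2 d3 dJ))) (dvM (dv_cst (gap_const / 2)) dV).
  apply: (dv_incr0 dd) => w w0; rewrite !mul0r !add0r.
  have eF : us 4%N w - al * us 2%N w + beta ^+ 4 * r ^+ 2 * (r + 2) ^+ 2 * us 0%N w
     = beta ^+ 4 * lam1 * S w ^+ 4 * g w by rewrite -eu /al; ring.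
  rewrite eF.
  set B1 := (us 2%N w + _ + _) ^+ 2; set B2 := a0 * _ * _.
  have B10 : 0 <= B1 by exact: sqr_ge0.
  have B20 : 0 <= B2.
    have a00 : 0 <= a0 by rewrite /a0 !mulr_ge0 ?addr_ge0// ltW.
    have Y0 : 0 <= Y by rewrite /Y /X mulr_ge0 ?sqr_ge0// !addr_ge0// mulr_ge0// ltW.
    apply: mulr_ge0; first by rewrite mulr_ge0 ?sqr_ge0.
    apply: addr_ge0; first by rewrite mulr_ge0 ?sqr_ge0.
    apply: mulr_ge0 => //; rewrite subr_ge0; apply: (@le_trans _ _ 0); last exact: sqr_ge0.
    rewrite mulr_le0_ge0 ?sqr_ge0//; have := riccati w0; rewrite /bracket; lra.
  set u := us 0%N w; set s := S w; set G := g w.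
  have -> : lam1 ^+ 2 / (2 * gap_const) * (s ^+ 2 * G) ^+ 2 - (beta ^+ 4)^-1 *
     (u * (beta ^+ 4 * lam1 * s ^+ 4 * G) - beta ^+ 4 * gap_const * s ^+ 4 * u ^+ 2 - B1 - B2) - gap_const / 2 * (s ^+ 2 * u) ^+ 2
   = (2 * gap_const)^-1 * s ^+ 4 * (lam1 * G - gap_const * u) ^+ 2 + (beta ^+ 4)^-1 * (B1 + B2).
    by field; rewrite !gt_eqF.
  have s4 : 0 <= s ^+ 4 by rewrite exprn_ge0// ltW// sechs_gt0.
  apply: addr_ge0; last by rewrite mulr_ge0 ?addr_ge0// invr_ge0 ltW.
  apply: mulr_ge0; last exact: sqr_ge0.
  by apply: mulr_ge0 => //; rewrite invr_ge0 mulr_ge0// ltW.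
suff key : V x - V 0 <= (lam1 / gap_const) ^+ 2 * (A ^+ 2 / 2).
  have -> : (lam1 / gap_const * A) ^+ 2 / 2 = (lam1 / gap_const) ^+ 2 * (A ^+ 2 / 2) by ring.
  exact: key.
apply/ler_addgt0Pr => e e0.
(* The boundary term is small only along a sequence: four square-integrable derivatives are
   simultaneously small somewhere beyond any point, and V is monotone. *)
have [e' e'0 he'] : exists2 e', 0 < e' & 2 / gap_const * ((beta ^+ 4)^-1 * (C * (e' + D ^+ 2 * e'))) <= e.
  pose K := 2 / gap_const * ((beta ^+ 4)^-1 * (C * (1 + D ^+ 2))).
  have K0 : 0 <= K.
    apply: mulr_ge0; first by rewrite divr_ge0// ltW.
    apply: mulr_ge0; first by rewrite invr_ge0 ltW.
    by apply: mulr_ge0 => //; exact: addr_ge0 ler01 (sqr_ge0 _).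
  exists (e / (K + 1)); first by rewrite divr_gt0// ltr_wpDl.
  have -> : 2 / gap_const * ((beta ^+ 4)^-1 * (C * (e / (K + 1) + D ^+ 2 * (e / (K + 1))))) = K * (e / (K + 1)).
    by rewrite /K; ring.
  by rewrite mulrA ler_pdivrMr ?ltr_wpDl// [K * e]mulrC ler_pM2l// lerDl.
have [N hN] := sechs_small beta0 e'0.
have [_ _ [F0 dF0 hF0]] := Lu 0%N isT; have [_ _ [F1 dF1 hF1]] := Lu 1%N isT.
have [_ _ [F2 dF2 hF2]] := Lu 2%N isT; have [_ _ [F3 dF3 hF3]] := Lu 3%N isT.
have FB z : 0 <= z -> F0 z + F1 z + F2 z + F3 z <= F0 0 + F1 0 + F2 0 + F3 0 + 4 * A' ^+ 2.
  by move=> _; have := hF0 0 z; have := hF1 0 z; have := hF2 0 z; have := hF3 0 z; lra.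
have M0 : 0 <= Num.max x (Num.max N 0) by rewrite le_max x0.
have [y Ny hy] := small_far (dvD (dvD (dvD dF0 dF1) dF2) dF3) FB e'0 M0.
have xy : x <= y by apply: le_trans Ny; rewrite le_max lexx.
have y0 : 0 <= y by exact: le_trans xy.
have {}Ny : N <= y by apply: le_trans Ny; rewrite !le_max lexx orbT.
have Psy : `|Ps y| <= C * (e' + D ^+ 2 * e').
  apply: le_trans (hC _ _ _ _ _ _) _; apply: ler_wpM2l => //; apply: lerD; first exact: hy.
  apply: le_trans (JS y y0) _; apply: ler_wpM2l; first exact: sqr_ge0.
  have := hN y Ny; have := sechs_gt0 beta y; have := sechs_le1 beta y; nra.
have W0y := monW 0 y (lexx _) y0.
have Vxy : V x <= V y by apply: (dv_incr dV _ xy) => z; exact: sqr_ge0.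
have h1 : gap_const / 2 * (V y - V 0) <= lam1 ^+ 2 / (2 * gap_const) * (A ^+ 2 / 2) + (beta ^+ 4)^-1 * (C * (e' + D ^+ 2 * e')).
  have c1 : 0 <= lam1 ^+ 2 / (2 * gap_const) by rewrite divr_ge0 ?sqr_ge0// mulr_ge0// ltW.
  have c2 : 0 <= (beta ^+ 4)^-1 by rewrite invr_ge0 ltW.
  have := ler_wpM2l c1 (Hx y); have := ler_wpM2l c2 Psy; have := ler_wpM2l c2 (ler_norm (- Ps y)).
  rewrite normrN; move: W0y; rewrite /W Ps0; lra.
have h2 : V y - V 0 <= 2 / gap_const * (lam1 ^+ 2 / (2 * gap_const) * (A ^+ 2 / 2)) + 2 / gap_const * ((beta ^+ 4)^-1 * (C * (e' + D ^+ 2 * e'))).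
  rewrite -mulrDr; have := ler_wpM2l (_ : 0 <= 2 / gap_const) h1.
  have -> : 2 / gap_const * (gap_const / 2 * (V y - V 0)) = V y - V 0 by field; rewrite gt_eqF.
  by apply; rewrite divr_ge0// ltW.
have e1 : 2 / gap_const * (lam1 ^+ 2 / (2 * gap_const) * (A ^+ 2 / 2)) = (lam1 / gap_const) ^+ 2 * (A ^+ 2 / 2).
  by field; rewrite gt_eqF.
lra.
Qed.

End Gap.

(** * Fixed points in a weighted space of even functions *)

Section Geometric.
Context {R : realType}.
Implicit Types (A B x y z e : R).

Lemma expr_small rho A e : 0 <= rho -> rho < 1 -> 0 < e -> exists n, rho ^+ n * A <= e.
Proof.
move=> r0 r1 e0.
have /cvgrPdist_lt /(_ _ e0) [n _ hn] : (fun n => `|A| * rho ^+ n) @ \oo --> (0 : R).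
  by apply: cvg_geometric; rewrite ger0_norm.
exists n; have := hn n (leqnn n); rewrite /= sub0r normrN ger0_norm ?mulr_ge0 ?exprn_ge0//.
move=> /ltW; apply: le_trans; by rewrite mulrC ler_wpM2r ?exprn_ge0// ler_norm.
Qed.

Lemma geometric_limit (a : nat -> R) rho c : 0 <= rho -> rho < 1 ->
  (forall n, `|a n.+1 - a n| <= c * rho ^+ n) ->
  exists l, forall n, `|l - a n| <= c * rho ^+ n / (1 - rho).
Proof.
move=> r0 r1 ha; pose w n := c * rho ^+ n / (1 - rho).
have r10 : 0 < 1 - rho by rewrite subr_gt0.
have wS n : w n - w n.+1 = c * rho ^+ n.
  by rewrite /w exprS; field; rewrite gt_eqF.
have hb n : - (w n - w n.+1) <= a n.+1 - a n <= w n - w n.+1.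
  by rewrite wS -ler_norml.
have binc m n : (m <= n)%N -> a m - w m <= a n - w n.
  elim: n => [|n IH]; first by rewrite leqn0 => /eqP ->.
  rewrite leq_eqVlt => /orP[/eqP->//|/IH h]; apply: le_trans h _.
  by have := hb n; lra.
have cdec m n : (m <= n)%N -> a n + w n <= a m + w m.
  elim: n => [|n IH]; first by rewrite leqn0 => /eqP ->.
  rewrite leq_eqVlt => /orP[/eqP->//|/IH h]; apply: le_trans h.
  by have := hb n; lra.
have w0 n : 0 <= w n.
  rewrite /w divr_ge0 ?(ltW r10)//; apply: le_trans (ha n); exact: normr_ge0.
have bc m n : a m - w m <= a n + w n.
  have h1 := binc _ _ (leq_maxl m n); have h2 := cdec _ _ (leq_maxr m n).
  by have := w0 (maxn m n); lra.
pose E := range (fun n => a n - w n).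
have supE : has_sup E.
  by split; [exists (a 0%N - w 0%N), 0%N|exists (a 0%N + w 0%N) => _ [n _ <-]; exact: bc].
exists (sup E) => n; rewrite -/(w n) ler_norml.
have h1 : a n - w n <= sup E by apply: ub_le_sup; [case: supE|exists n].
have h2 : sup E <= a n + w n.
  by apply: ge_sup; [case: supE|move=> _ [m _ <-]; exact: bc].
by apply/andP; split; lra.
Qed.

Lemma uniform_continuous_limit (f : R -> R) :
  (forall e, 0 < e -> exists2 g : R -> R, continuous g & forall x, `|f x - g x| <= e) ->
  continuous f.
Proof.
move=> h x; apply/cvgrPdist_le => e e0.
have e3 : 0 < e / 3 by rewrite divr_gt0.
have [g cg fg] := h _ e3.
have := cg x => /cvgrPdist_le /(_ _ e3); apply: filterS => y gxy.
have -> : f x - f y = (f x - g x) + (g x - g y) - (f y - g y) by ring.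
apply: le_trans (ler_normB _ _) _; have := ler_normD (f x - g x) (g x - g y).
have := fg x; have := fg y; lra.
Qed.

(** [f^2 <= (1 + t) g^2 + (1 + 1 / t) (f - g)^2] on a bounded interval, with [t] small and then [g] close to [f]. *)
Lemma L2le_lim (f : R -> R) A : 0 < A ->
  (forall e, 0 < e -> exists2 g, L2le g A & forall x, `|f x - g x| <= e) -> L2le f A.
Proof.
move=> A0 h.
have cf : continuous f.
  by apply: uniform_continuous_limit => e /h [g [_ cg _] fg]; exists g.
apply: L2leP => // F dF x y xy; apply/ler_addgt0Pr => e e0.
pose t := e / (2 * A ^+ 2).
have A2 : 0 < A ^+ 2 by rewrite exprn_gt0.
have t0 : 0 < t by rewrite divr_gt0// mulr_gt0.
pose K := (1 + t^-1) * (y - x) + 1.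
have K0 : 0 < K by rewrite /K ltr_wpDl// mulr_ge0 ?subr_ge0// addr_ge0// invr_ge0 ltW.
pose d := Num.min 1 (e / 2 / K).
have d0 : 0 < d by rewrite /d lt_min ltr01 !divr_gt0.
have [g [_ cg [G dG hG]] fg] := h d d0.
have dd := dvB (dvD (dvM (dv_cst (1 + t)) dG) (dvM (dv_cst ((1 + t^-1) * d ^+ 2)) dv_id)) dF.
have pos z : 0 <= 0 * G z + (1 + t) * g z ^+ 2 + (0 * z + (1 + t^-1) * d ^+ 2 * 1) - f z ^+ 2.
  have fg2 : (f z - g z) ^+ 2 <= d ^+ 2.
    by rewrite -[X in X <= _]real_normK ?num_real// ler_sqr ?nnegrE ?fg// ltW.
  have h1 : (1 + t^-1) * (f z - g z) ^+ 2 <= (1 + t^-1) * d ^+ 2.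
    by rewrite ler_wpM2l// addr_ge0// invr_ge0 ltW.
  have h2 : 0 <= t * (g z - t^-1 * (f z - g z)) ^+ 2 by rewrite mulr_ge0 ?sqr_ge0// ltW.
  have e1 : t * (g z - t^-1 * (f z - g z)) ^+ 2 = (1 + t) * g z ^+ 2 + (1 + t^-1) * (f z - g z) ^+ 2 - f z ^+ 2.
    by field; rewrite gt_eqF.
  lra.
have h1 := dv_incr dd pos xy.
have h2 := ler_wpM2l (_ : 0 <= 1 + t) (hG x y).
have {}h2 := h2 (addr_ge0 ler01 (ltW t0)).
have d1 : d ^+ 2 <= e / 2 / K.
  have dd1 : d <= 1 by rewrite /d ge_min lexx.
  have dd2 : d <= e / 2 / K by rewrite /d ge_min lexx orbT.
  by apply: le_trans dd2; rewrite expr2 ler_piMr// ltW.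
have h3 : (1 + t^-1) * d ^+ 2 * (y - x) <= e / 2.
  apply: (@le_trans _ _ (K * d ^+ 2)).
    rewrite mulrAC ler_wpM2r ?sqr_ge0// /K; lra.
  by rewrite mulrC -ler_pdivlMr.
have h4 : (1 + t) * A ^+ 2 = A ^+ 2 + e / 2.
  by rewrite /t; field; rewrite gt_eqF.
lra.
Qed.

End Geometric.

Section Bnd.
Context {R : realType} (beta eps : R).
Hypotheses (eps0 : 0 < eps).
Implicit Types (f g h k u : R -> R) (A B C x y z e : R).
Local Notation S := (sechs beta).

(** The ball of radius [A] for a norm that adds to the uniform and L^2 norms the L^2 norm of [S^2 f],
weighted by [1 / eps]. The linearized operator contracts the last one; a small [eps] makes it control
the two others. *)
Definition bnd f A := [/\ forall x, f (- x) = f x, forall x, `|f x| <= A,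
  L2le f A & L2le (fun x => S x ^+ 2 * f x) (eps * A)].

Let S2le x : 0 <= S x ^+ 2 <= 1.
Proof.
by rewrite sqr_ge0 expr_le1 ?sechs_le1//; exact/ltW/sechs_gt0.
Qed.

Lemma bnd_gt0 f A : bnd f A -> 0 < A.
Proof. by case=> _ _ []. Qed.

Lemma bnd_cont f A : bnd f A -> continuous f.
Proof. by case=> _ _ []. Qed.

Lemma bnd0 A : 0 < A -> bnd (fun=> 0) A.
Proof.
move=> A0.
have z B : 0 < B -> L2le (fun _ : R => (0 : R)) B.
  move=> B0; split => //; first exact: cts_cst.
  exists (fun=> 0); first by apply: (dv_eq (dv_cst 0)) => x; rewrite expr0n.
  by move=> x y; rewrite subrr sqr_ge0.
split=> //; first by move=> x; rewrite normr0 ltW.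
  exact: z.
have -> : (fun x : R => S x ^+ 2 * 0) = fun=> 0 by apply/funext => x; rewrite mulr0.
by apply: z; rewrite mulr_gt0.
Qed.

Lemma bnd_mono f A B : A <= B -> bnd f A -> bnd f B.
Proof.
move=> AB [ef fA Lf Sf]; split=> //.
- by move=> x; exact: le_trans AB.
- exact: L2le_mono Lf.
- by apply: L2le_mono Sf; rewrite ler_pM2l.
Qed.

Lemma bndD f g A B : bnd f A -> bnd g B -> bnd (fun x => f x + g x) (A + B).
Proof.
move=> [ef fA Lf Sf] [eg gB Lg Sg]; split.
- by move=> x; rewrite ef eg.
- by move=> x; apply: le_trans (ler_normD _ _) _; exact: lerD.
- exact: L2leD.
- rewrite mulrDr.
  have -> : (fun x => S x ^+ 2 * (f x + g x)) = fun x => S x ^+ 2 * f x + S x ^+ 2 * g x.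
    by apply/funext => x; rewrite mulrDr.
  exact: L2leD.
Qed.

Lemma bndZ f A c d : `|c| <= d -> 0 < d -> bnd f A -> bnd (fun x => c * f x) (d * A).
Proof.
move=> cd d0 [ef fA Lf Sf]; split.
- by move=> x; rewrite ef.
- by move=> x; rewrite normrM ler_pM.
- exact: L2leZ.
- have -> : eps * (d * A) = d * (eps * A) by ring.
  have -> : (fun x => S x ^+ 2 * (c * f x)) = fun x => c * (S x ^+ 2 * f x).
    by apply/funext => x; ring.
  exact: L2leZ.
Qed.

Lemma bndN f A : bnd f A -> bnd (fun x => - f x) A.
Proof.
move=> fA; have := @bndZ _ _ (-1) 1 _ ltr01 fA; rewrite normrN1 mul1r => /(_ (lexx _)).
by congr bnd; apply/funext => x; rewrite mulN1r.
Qed.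

Lemma bndB f g A B : bnd f A -> bnd g B -> bnd (fun x => f x - g x) (A + B).
Proof. by move=> fA /bndN gB; exact: bndD. Qed.

Lemma bnd_small f : (forall e, 0 < e -> exists2 A, A <= e & bnd f A) -> forall x, f x = 0.
Proof.
move=> h x; apply/eqP; rewrite -normr_le0; apply/ler_addgt0Pr => e /h [A Ae [_ fA _ _]].
by rewrite add0r; exact: le_trans (fA x) Ae.
Qed.

Lemma bnd_lim f A : 0 < A -> (forall e, 0 < e -> exists2 g, bnd g A & forall x, `|f x - g x| <= e) ->
  bnd f A.
Proof.
move=> A0 h; split.
- move=> x; apply/eqP; rewrite -subr_eq0 -normr_le0; apply/ler_addgt0Pr => e e0; rewrite add0r.
  have [g [eg _ _ _] fg] := h (e / 2) (divr_gt0 e0 (ltr0Sn _ 1)).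
  have -> : f (- x) - f x = (f (- x) - g (- x)) - (f x - g x) by rewrite eg; ring.
  by apply: le_trans (ler_normB _ _) _; have := fg x; have := fg (- x); lra.
- move=> x; apply/ler_addgt0Pr => e e0; have [g [_ gA _ _] fg] := h e e0.
  have -> : f x = g x + (f x - g x) by ring.
  by apply: le_trans (ler_normD _ _) _; exact: lerD.
- by apply: L2le_lim => // e /h [g [_ _ Lg _] fg]; exists g.
- apply: L2le_lim; first exact: mulr_gt0.
  move=> e /h [g [_ _ _ Sg] fg]; exists (fun x => S x ^+ 2 * g x) => // x.
  rewrite -mulrBr normrM; have /andP[s0 s1] := S2le x; rewrite ger0_norm//.
  by apply: le_trans (fg x); rewrite ler_piMl.
Qed.

Lemma bnd_complete (u : nat -> R -> R) rho c : 0 < rho -> rho < 1 -> 0 < c ->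
  (forall n, bnd (fun x => u n.+1 x - u n x) (c * rho ^+ n)) ->
  exists v, forall n, bnd (fun x => v x - u n x) (c * rho ^+ n / (1 - rho)).
Proof.
move=> r0 r1 c0 hu; have r10 : 0 < 1 - rho by rewrite subr_gt0.
have hx x : exists l, forall n, `|l - u n x| <= c * rho ^+ n / (1 - rho).
  by apply: geometric_limit => //; [exact: ltW|move=> n; case: (hu n)].
pose v x := projT1 (cid (hx x)).
have hv x n : `|v x - u n x| <= c * rho ^+ n / (1 - rho) by rewrite /v; case: cid.
exists v => n; apply: bnd_lim; first by rewrite divr_gt0// mulr_gt0// exprn_gt0.
move=> e e0.
have [m hm] := expr_small (c / (1 - rho)) (ltW r0) r1 e0.
have key j : bnd (fun x => u (n + j.+1)%N x - u n x) (c * rho ^+ n * (1 - rho ^+ j.+1) / (1 - rho)).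
  elim: j => [|j IH].
    rewrite addn1 expr1 mulfK ?gt_eqF//.
  have := bndD (hu (n + j.+1)%N) IH.
  have -> : c * rho ^+ (n + j.+1) + c * rho ^+ n * (1 - rho ^+ j.+1) / (1 - rho) =
    c * rho ^+ n * (1 - rho ^+ j.+2) / (1 - rho).
    by rewrite exprD [rho ^+ j.+2]exprS; field; rewrite gt_eqF.
  by congr bnd; apply/funext => x; rewrite [(n + j.+2)%N]addnS; ring.
exists (fun x => u (n + m.+1)%N x - u n x).
  apply: bnd_mono (key m); rewrite ler_pM2r ?invr_gt0// ler_piMr//.
    by rewrite mulr_ge0 ?exprn_ge0// ltW.
  by rewrite lerBlDr lerDl exprn_ge0// ltW.
move=> x; have -> : v x - u n x - (u (n + m.+1)%N x - u n x) = v x - u (n + m.+1)%N x by ring.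
apply: le_trans (hv _ _) _; apply: le_trans hm; rewrite mulrAC mulrC ler_wpM2r//.
  by rewrite divr_ge0// ltW.
by apply: ler_wiXn2l; rewrite ?ltW//; rewrite addnS ltnW// ltnS leq_addl.
Qed.

(** The contraction principle for Picard iterates started at 0, which stay in the ball of radius [radius]. *)
Lemma bnd_fixpoint (P : (R -> R) -> R -> R) rho radius : 0 < rho -> rho < 1 -> 0 < radius ->
  (forall h k A, bnd h radius -> bnd k radius -> bnd (fun x => h x - k x) A ->
     bnd (fun x => P h x - P k x) (rho * A)) ->
  bnd (P (fun=> 0)) ((1 - rho) * radius) ->
  exists2 h, bnd h radius & P h = h.
Proof.
move=> r0 r1 e0 lip hP0; have r10 : 0 < 1 - rho by rewrite subr_gt0.
pose u n := iter n P (fun=> 0).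
have key n : [/\ bnd (u n) radius, bnd (u n.+1) ((1 - rho ^+ n.+1) * radius) &
    bnd (fun x => u n.+1 x - u n x) ((1 - rho) * radius * rho ^+ n)].
  elim: n => [|n [h1 h2 h3]].
    rewrite expr1 expr0 mulr1; split => //; first exact: bnd0.
    by have -> : (fun x => u 1%N x - u 0%N x) = u 1%N by apply/funext => x; rewrite subr0.
  have h4 : bnd (u n.+1) radius.
    by apply: bnd_mono h2; rewrite ler_piMl ?(ltW e0)// gerBl exprn_ge0// ltW.
  have h5 : bnd (fun x => u n.+2 x - u n.+1 x) ((1 - rho) * radius * rho ^+ n.+1).
    have := lip _ _ _ h4 h1 h3.
    by have -> : rho * ((1 - rho) * radius * rho ^+ n) = (1 - rho) * radius * rho ^+ n.+1 by rewrite exprS; ring.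
  split => //; have := bndD h5 h2.
  have -> : (1 - rho) * radius * rho ^+ n.+1 + (1 - rho ^+ n.+1) * radius = (1 - rho ^+ n.+2) * radius.
    by rewrite [rho ^+ n.+2]exprS; ring.
  by congr bnd; apply/funext => x; ring.
have [v hv] := bnd_complete r0 r1 (mulr_gt0 r10 e0) (fun n => let: And3 _ _ h := key n in h).
have {}hv n : bnd (fun x => v x - u n x) (rho ^+ n * radius).
  have := hv n; have -> : (1 - rho) * radius * rho ^+ n / (1 - rho) = rho ^+ n * radius.
    by field; rewrite gt_eqF.
  by [].
have vb : bnd v radius.
  have [_ k1 _] := key 0%N; have := bndD (hv 1%N) k1.
  have -> : rho ^+ 1 * radius + (1 - rho ^+ 1) * radius = radius by ring.
  by congr bnd; apply/funext => x; ring.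
exists v => //; apply/funext => x; apply/eqP; rewrite -subr_eq0; apply/eqP; move: x.
apply: (@bnd_small (fun x => P v x - v x)) => e e1.
have [n hn] := expr_small (2 * rho * radius) (ltW r0) r1 e1.
exists (rho ^+ n * (2 * rho * radius)) => //.
have [k0 k1 k2] := key n.
have := bndB (lip _ _ _ vb k0 (hv n)) (hv n.+1).
have -> : rho * (rho ^+ n * radius) + rho ^+ n.+1 * radius = rho ^+ n * (2 * rho * radius).
  by rewrite exprS; ring.
by congr bnd; apply/funext => x /=; rewrite /u /=; ring.
Qed.

(** Iterating an a priori estimate [A |-> rho A + C] from any finite bound. *)
Lemma bnd_absorb d rho C A0 : 0 <= rho -> rho < 1 -> 0 < C -> bnd d A0 ->
  (forall A, bnd d A -> bnd d (rho * A + C)) -> bnd d (2 * C / (1 - rho)).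
Proof.
move=> r0 r1 C0 dA0 h; have r10 : 0 < 1 - rho by rewrite subr_gt0.
have A00 := bnd_gt0 dA0.
have w0 : 0 < C / (1 - rho) by rewrite divr_gt0.
have key n : bnd d (rho ^+ n * A0 + (1 - rho ^+ n) * (C / (1 - rho))).
  elim: n => [|n IH]; first by rewrite expr0 mul1r subrr mul0r addr0.
  have -> : rho ^+ n.+1 * A0 + (1 - rho ^+ n.+1) * (C / (1 - rho)) =
     rho * (rho ^+ n * A0 + (1 - rho ^+ n) * (C / (1 - rho))) + C.
    by rewrite exprS; field; rewrite gt_eqF.
  exact: h.
have [n hn] := expr_small A0 r0 r1 w0.
apply: bnd_mono (key n).
have -> : 2 * C / (1 - rho) = C / (1 - rho) + C / (1 - rho) by ring.
by apply: lerD => //; rewrite ler_piMl ?(ltW w0)// gerBl exprn_ge0.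
Qed.

End Bnd.

(** * The linearized operator and the branch of fixed points *)

Section Oper.
Context {R : realType} (beta r mu amp : R) (p : nat).
Hypotheses (beta0 : 0 < beta) (r0 : 0 < r) (mu0 : 0 < mu) (amp0 : 0 < amp).
Hypotheses (p1 : (1 <= p)%N) (rp : r * p%:R = 4).
Hypothesis (Hamp : amp ^+ p = (p%:R + 1) * (mu * beta ^+ 4 * lam0 r)).
Implicit Types (f g h q u : R -> R) (A B C x y z e : R).
Local Notation S := (sechs beta).
Local Notation phi := (ground beta r).
Local Notation a := (beta * r).
Local Notation b := (beta * (r + 2)).
Local Notation Msol := (Msol a b).

Let a0 : 0 < a. Proof. exact: mulr_gt0. Qed.
Let b0 : 0 < b. Proof. exact: mulr_gt0 beta0 (addr_gt0 r0 (ltr0Sn R 1)). Qed.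
Let pp : 0 < p%:R :> R. Proof. by rewrite ltr0n. Qed.

Let lam01 : lam1 r = (p%:R + 1) * lam0 r.
Proof.
have -> : (p%:R + 1) * lam0 r = (r * p%:R + r) * ((r + 1) * (r + 2) * (r + 3)).
  by rewrite /lam0; ring.
by rewrite rp /lam1; ring.
Qed.

(** The solution of [mu (d^2 - a^2) (d^2 - b^2) u = f] and its derivatives, the zero function if there is none. *)
Definition resolvent f : nat -> R -> R :=
  if pselect (exists us, Msol (fun x => f x / mu) us) is left h then projT1 (cid h)
  else fun _ _ => 0.

Definition resolvent_norm : R := resolvent_const a b / mu.

Lemma resolvent_norm_gt0 : 0 < resolvent_norm.
Proof. by rewrite divr_gt0// resolvent_const_gt0. Qed.

Lemma resolvent_eq f us : Msol (fun x => f x / mu) us ->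
  Msol (fun x => f x / mu) (resolvent f) /\ forall k, (k < 5)%N -> resolvent f k = us k.
Proof.
move=> su; have rs : Msol (fun x => f x / mu) (resolvent f).
  by rewrite /resolvent; case: pselect => [h|[]]; [case: cid|exists us].
by split=> // k k5; apply/funext; exact: (Msol_uniq a0 b0 rs su).
Qed.

Lemma resolventP f A : L2le f A ->
  Msol (fun x => f x / mu) (resolvent f) /\ H4le (resolvent f) (resolvent_norm * A).
Proof.
move=> Lf; have im : 0 < mu^-1 by rewrite invr_gt0.
have Lf' : L2le (fun x => f x / mu) (mu^-1 * A).
  have nm : `|mu^-1| <= mu^-1 by rewrite ger0_norm// ltW.
  have := L2leZ nm im Lf.
  by congr L2le; apply/funext => x; rewrite mulrC.
have [us [su [cu bu Lu]]] := Msol_exists a0 b0 Lf'.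
have [rs e] := resolvent_eq su; split => //.
have ec : resolvent_const a b * (mu^-1 * A) = resolvent_norm * A by rewrite mulrA.
rewrite ec in bu Lu; split.
- by case: rs.
- by move=> k x k4; rewrite e ?bu// ltnW.
- by move=> k k5; rewrite e//; exact: Lu.
Qed.

Lemma resolvent_lin c f g A B : L2le f A -> L2le g B -> forall k, (k < 5)%N ->
  resolvent (fun x => c * f x + g x) k = fun x => c * resolvent f k x + resolvent g k x.
Proof.
move=> /resolventP[sf _] /resolventP[sg _] k k5.
have s := Msol_lin c sf sg.
have e : (fun x => c * (f x / mu) + g x / mu) = fun x => (c * f x + g x) / mu.
  by apply/funext => x; ring.
by rewrite e in s; have [_ ->] := resolvent_eq s.
Qed.

Lemma resolvent_even f A : L2le f A -> (forall x, f (- x) = f x) -> forall x, resolvent f 0%N (- x) = resolvent f 0%N x.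
Proof.
move=> /resolventP[sf _] ef x.
by rewrite (Msol_even a0 b0 _ sf)// ?expr0 ?mul1r// => z; rewrite ef.
Qed.

Definition mom h : R := if pselect (exists l, moment beta r h l) is left e then projT1 (cid e) else 0.

Lemma momP h A : continuous h -> (forall x, `|h x| <= A) ->
  moment beta r h (mom h) /\ `|mom h| <= 2 / beta * A.
Proof.
move=> ch hA; have [l ml lA] := moment_exists beta0 r0 ch hA.
have mm : moment beta r h (mom h).
  by rewrite /mom; case: pselect => [e|[]]; [case: cid|exists l].
by split => //; rewrite (moment_uniq beta0 r0 mm ml).
Qed.

Lemma mom_eq h l : moment beta r h l -> mom h = l.
Proof.
move=> ml; have mm : moment beta r h (mom h).
  by rewrite /mom; case: pselect => [e|[]]; [case: cid|exists l].
exact: (moment_uniq beta0 r0 mm ml).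
Qed.

Let cphi : continuous phi. Proof. exact: (dv_continuous (dv_ground beta r0)). Qed.
Let cS : continuous S. Proof. exact: (dv_continuous (dv_sechs beta)). Qed.
Let phi1 x : `|phi x| <= 1.
Proof. by rewrite ger0_norm ?ground_le1// ltW// ground_gt0. Qed.

(** The primitive of the positive function [S^4 phi^2] is increasing, so its limit exceeds its value at 1. *)
Lemma mom_ground_gt0 : 0 < mom phi.
Proof.
have [[Q [dQ Q0 [D hD]]] _] := momP cphi phi1.
have dpos z : 0 < S z ^+ 4 * phi z * phi z.
  apply: mulr_gt0; last exact: ground_gt0.
  by apply: mulr_gt0; [exact/exprn_gt0/sechs_gt0|exact: ground_gt0].
have Q1 : 0 < Q 1.
  have [|c _ E] := @MVT _ Q _ 0 1 ltr01 (fun x _ => dQ x).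
    by apply: continuous_subspaceT; exact: (dv_continuous dQ).
  have -> : Q 1 = Q 1 - Q 0 by rewrite Q0 subr0.
  by rewrite E subr0 mulr1; exact: dpos.
rewrite ltNge; apply/negP => m0.
have e0 : 0 < Q 1 / 2 / (`|D| + 1).
  by rewrite divr_gt0// ?divr_gt0// ltr_wpDl.
have [N hN] := ground_small beta0 r0 e0.
pose x := Num.max 1 N.
have x1 : 1 <= x by rewrite le_max lexx.
have Nx : N <= x by rewrite le_max lexx orbT.
have x0 : 0 <= x by apply: le_trans x1.
have Qx : Q 1 <= Q x.
  by apply: (dv_incr dQ _ x1) => z; exact/ltW/dpos.
have := hD x x0.
have h1 : D * (phi x * S x ^+ 3) <= (`|D| + 1) * (Q 1 / 2 / (`|D| + 1)).
  apply: le_trans (tail_le D (hN x Nx)) _.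
  by rewrite ler_pM2r// lerDl.
have : (`|D| + 1) * (Q 1 / 2 / (`|D| + 1)) = Q 1 / 2.
  by field; rewrite gt_eqF// ltr_wpDl.
have := ler_norm (Q x - mom phi); lra.
Qed.

(** The coefficient of [h] along [phi] in the decomposition into a multiple of [phi] and a function of zero
moment. *)
Definition ell h : R := mom h / mom phi.

Lemma moment_proj h A : continuous h -> (forall x, `|h x| <= A) ->
  moment beta r (fun x => h x - ell h * phi x) 0.
Proof.
move=> ch hA; have [mh _] := momP ch hA; have [mp _] := momP cphi phi1.
have := moment_lin (- ell h) mp mh.
have -> : - ell h * mom phi + mom h = 0.
  by rewrite /ell; field; rewrite gt_eqF// mom_ground_gt0.
by congr moment; apply/funext => x; ring.
Qed.

Lemma ell_lin c f g A B : continuous f -> (forall x, `|f x| <= A) ->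
  continuous g -> (forall x, `|g x| <= B) ->
  ell (fun x => c * f x + g x) = c * ell f + ell g.
Proof.
move=> cf fA cg gB; have [mf _] := momP cf fA; have [mg _] := momP cg gB.
by rewrite /ell (mom_eq (moment_lin c mf mg)); ring.
Qed.

Lemma ell_ground : ell phi = 1.
Proof. by rewrite /ell divff// gt_eqF// mom_ground_gt0. Qed.

(** [h - ell h phi] is the orthogonal projection of [h] for the weight [S^4]; the cross term is
[2 ell h] times a primitive that tends to 0, by definition of [ell]. *)
Lemma L2le_proj h A B : (forall x, h (- x) = h x) -> continuous h -> (forall x, `|h x| <= A) ->
  L2le (fun x => S x ^+ 2 * h x) B ->
  L2le (fun x => S x ^+ 2 * (h x - ell h * phi x)) B.
Proof.
move=> eh ch hA Lh; have [B0 cSh _] := Lh; set c := ell h.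
have [Q [dQ Q0 [D hD]]] := moment_proj ch hA.
apply: L2le_of_half; first exact: B0.
- apply: ctsM; first exact: ctsX.
  by apply: ctsD => // x; apply: cvgN; apply: cvgM; [exact: cvg_cst|exact: cphi].
- by move=> x; rewrite sechs_even eh ground_even.
move=> F dF x x0.
have [H dH] : exists H, dv H (fun x => (S x ^+ 2 * h x) ^+ 2).
  by apply: primitive; apply: ctsX.
have Hx y : H y - H 0 <= B ^+ 2 / 2.
  by apply: (L2le_half _ Lh dH) => z; rewrite sechs_even eh.
have h1 y : 0 <= y -> F y - F 0 <= H y - H 0 - 2 * c * Q y.
  move=> y0.
  have dd := dvB (dvB dH (dvM (dv_cst (2 * c)) dQ)) dF.
  have pos z : 0 <= (S z ^+ 2 * h z) ^+ 2 - (0 * Q z + 2 * c * (S z ^+ 4 * phi z * (h z - ell h * phi z))) -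
      (S z ^+ 2 * (h z - ell h * phi z)) ^+ 2.
    have -> : (S z ^+ 2 * h z) ^+ 2 - (0 * Q z + 2 * c * (S z ^+ 4 * phi z * (h z - ell h * phi z))) -
      (S z ^+ 2 * (h z - ell h * phi z)) ^+ 2 = (c * S z ^+ 2 * phi z) ^+ 2 by rewrite -/c; ring.
    exact: sqr_ge0.
  by have := dv_incr dd pos y0; rewrite Q0; lra.
apply/ler_addgt0Pr => e e0.
pose K := 2 * `|c| * `|D| + 1.
have K0 : 0 < K by rewrite ltr_wpDl// !mulr_ge0.
have [N hN] := ground_small beta0 r0 (divr_gt0 e0 K0).
pose y := Num.max x N.
have xy : x <= y by rewrite le_max lexx.
have Ny : N <= y by rewrite le_max lexx orbT.
have y0 : 0 <= y by exact: le_trans xy.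
have Fxy : F x <= F y by apply: (dv_incr dF _ xy) => z; exact: sqr_ge0.
have := hD y y0; rewrite subr0 => Qy.
have Qy' : `|Q y| <= `|D| * (e / K) by apply: le_trans Qy _; exact: tail_le (hN y Ny).
have h2 : - (2 * c * Q y) <= e.
  apply: (@le_trans _ _ (2 * `|c| * `|Q y|)).
    apply: le_trans (ler_norm _) _; rewrite normrN !normrM (ger0_norm (ler0n _ 2)).
    exact: lexx.
  apply: (@le_trans _ _ (2 * `|c| * (`|D| * (e / K)))).
    by apply: ler_wpM2l => //; exact: mulr_ge0.
  have -> : 2 * `|c| * (`|D| * (e / K)) = (K - 1) * (e / K) by rewrite /K; ring.
  rewrite mulrA ler_pdivrMr// mulrC ler_pM2l//; lra.
by have := h1 y y0; have := Hx y; lra.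
Qed.

Let rho : R := lam1 r / gap_const r.
Let Pot x := amp ^+ p * S x ^+ 4.

Lemma rho_gt0 : 0 < rho.
Proof.
rewrite divr_gt0// ?lam1_gt0//; exact: lt_trans (lam1_gt0 r0) (lam1_lt_gap_const r0).
Qed.

Lemma rho_lt1 : rho < 1.
Proof.
have k0 : 0 < gap_const r by exact: lt_trans (lam1_gt0 r0) (lam1_lt_gap_const r0).
by rewrite ltr_pdivrMr// mul1r lam1_lt_gap_const.
Qed.

(** Chosen so that the H^4 bound of [gap_op_H4] comes with the same factor [rho] as the spectral gap. *)
Definition weight : R := rho / (resolvent_norm * amp ^+ p).

Let ampp : 0 < amp ^+ p. Proof. exact: exprn_gt0. Qed.

Lemma weight_gt0 : 0 < weight.
Proof. by rewrite divr_gt0 ?rho_gt0// mulr_gt0// resolvent_norm_gt0. Qed.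

Local Notation bnd := (bnd beta weight).

Let potE g : (fun x => Pot x * g x / mu) = fun x => beta ^+ 4 * lam1 r * S x ^+ 4 * g x.
Proof.
apply/funext => x; rewrite /Pot Hamp lam01; field; by rewrite gt_eqF.
Qed.

(** [T Pot] on the component of zero moment. *)
Definition gap_op h := resolvent (fun x => Pot x * (h x - ell h * phi x)) 0%N.

Let pot_L2 g B : L2le (fun x => S x ^+ 2 * g x) B -> continuous g ->
  L2le (fun x => Pot x * g x) (amp ^+ p * B).
Proof.
move=> Lg cg; apply: (L2le_dom ampp _ _ Lg).
  by apply: ctsM => //; apply: ctsM; [exact: cts_cst|exact: ctsX].
move=> x; have -> : Pot x * g x = amp ^+ p * (S x ^+ 2 * (S x ^+ 2 * g x)).
  by rewrite /Pot; ring.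
rewrite normrM (ger0_norm (ltW ampp)) ler_pM2l// normrM ler_piMl//.
rewrite normrX expr_le1// ger0_norm ?sechs_le1//; exact/ltW/sechs_gt0.
Qed.

Let proj_cts h : continuous h -> continuous (fun x => h x - ell h * phi x).
Proof.
move=> ch x; apply: cvgB; first exact: ch.
by apply: cvgM; [exact: cvg_cst|exact: cphi].
Qed.

Lemma gap_op_source h A : bnd h A -> L2le (fun x => Pot x * (h x - ell h * phi x)) (amp ^+ p * (weight * A)).
Proof.
move=> hA; have [eh bh Lh Sh] := hA; have ch := bnd_cont hA.
by apply: pot_L2; [exact: L2le_proj Sh|exact: proj_cts].
Qed.

Lemma gap_op_H4 h A : bnd h A -> exists2 us, us 0%N = gap_op h & H4le us (rho * A).
Proof.
move=> /gap_op_source/resolventP[_ H]; exists (resolvent (fun x => Pot x * (h x - ell h * phi x))) => //.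
have -> : rho * A = resolvent_norm * (amp ^+ p * (weight * A)).
  by rewrite /weight; field; rewrite !gt_eqF// resolvent_norm_gt0.
exact: H.
Qed.

Lemma mom_resolvent g us B : (forall x, g (- x) = g x) -> continuous g -> (forall x, `|g x| <= B) ->
  Msol (fun x => beta ^+ 4 * lam1 r * S x ^+ 4 * g x) us -> (exists A, H4le us A) ->
  moment beta r (us 0%N) ((p%:R + 1) * mom g).
Proof.
move=> eg cg gB su [A [cu bu Lu]].
have [mg _] := momP cg gB.
have cu0 : continuous (us 0%N) by apply: (dv_continuous (cu 0%N isT)).
have [mu' _] := momP cu0 (fun x => bu 0%N x isT).
have := moment_resolvent beta0 r0 eg su mg mu'; rewrite lam01 => e.
have l0 := lam0_gt0 r0.
suff -> : (p%:R + 1) * mom g = mom (us 0%N) by [].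
apply: (mulfI (_ : lam0 r != 0)); first by rewrite gt_eqF.
by rewrite e; ring.
Qed.

(** The zero moment of the projected function is transmitted to its image by [mom_resolvent], as the
spectral gap requires. *)
Lemma gap_op_bnd h A : bnd h A -> bnd (gap_op h) (rho * A).
Proof.
move=> hA; have [eh bh Lh Sh] := hA; have ch := bnd_cont hA.
have Ls := gap_op_source hA; have [su H] := resolventP Ls.
have eg x : h (- x) - ell h * phi (- x) = h x - ell h * phi x by rewrite eh ground_even.
have ec : resolvent_norm * (amp ^+ p * (weight * A)) = rho * A.
  by rewrite /weight; field; rewrite !gt_eqF// resolvent_norm_gt0.
have [cu bu Lu] := H; rewrite ec in bu Lu.
split.
- by apply: (resolvent_even Ls) => x; rewrite /Pot sechs_even eg.
- by move=> x; exact: bu.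
- exact: Lu.
- have -> : weight * (rho * A) = lam1 r / gap_const r * (weight * A) by rewrite /rho; ring.
  rewrite potE in su.
  apply: (spectral_gap beta0 r0 eg su H); last exact: L2le_proj Sh.
  have [mp m0] := momP cphi phi1.
  have := @mom_resolvent _ _ (A + `|ell h|) eg (proj_cts ch) _ su (ex_intro _ _ H).
  rewrite (mom_eq (moment_proj ch bh)) mulr0; apply => x.
  apply: le_trans (ler_normB _ _) _; apply: lerD => //.
  by rewrite normrM ler_piMr.
Qed.

Lemma gap_op_lin c h k A B : bnd h A -> bnd k B ->
  gap_op (fun x => c * h x + k x) = fun x => c * gap_op h x + gap_op k x.
Proof.
move=> hA kB; have [_ bh _ _] := hA; have [_ bk _ _] := kB.
rewrite /gap_op -(resolvent_lin c (gap_op_source hA) (gap_op_source kB) (isT : (0 < 5)%N)).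
congr (resolvent _ 0%N); apply/funext => x.
by rewrite (ell_lin c (bnd_cont hA) bh (bnd_cont kB) bk); ring.
Qed.

Lemma L2le_sech : exists A, L2le S A.
Proof.
have dP : dv (fun x => tanhs beta x / beta) (fun x => S x ^+ 2).
  apply: (dv_eq (dvM (dv_tanhs beta) (dv_cst beta^-1))) => x.
  by field; rewrite gt_eqF.
exists (1 + 2 / beta); have b2 : 0 < 2 / beta by rewrite divr_gt0.
split => //; first by rewrite addr_gt0.
exists (fun x => tanhs beta x / beta) => // x y.
have := tanhs_le1 beta x; have := tanhs_le1 beta y; rewrite !ler_norml => /andP[_ t1] /andP[t2 _].
have : (tanhs beta y - tanhs beta x) / beta <= 2 / beta.
  by rewrite ler_pM2r ?invr_gt0//; lra.
rewrite mulrBl => h; apply: le_trans h _; nra.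
Qed.

Lemma ground_src : exists A, L2le (fun x => beta ^+ 4 * lam0 r * S x ^+ 4 * phi x) A.
Proof.
have [A LS] := L2le_sech.
have l0 := lam0_gt0 r0; have b4 : 0 < beta ^+ 4 by rewrite exprn_gt0.
have c0 : 0 < beta ^+ 4 * lam0 r by exact: mulr_gt0.
exists (beta ^+ 4 * lam0 r * A); apply: (L2le_dom c0 _ _ LS).
  by apply: ctsM => //; apply: ctsM; [exact: cts_cst|exact: ctsX].
move=> x; have s0 := sechs_gt0 beta x; have s1 := sechs_le1 beta x.
have f0 := ground_gt0 beta r x; have f1 := ground_le1 beta r0 x.
have -> : beta ^+ 4 * lam0 r * S x ^+ 4 * phi x = beta ^+ 4 * lam0 r * (S x ^+ 3 * phi x * S x) by ring.
rewrite normrM (ger0_norm (ltW c0)) ler_pM2l// normrM ler_piMl//.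
have s3 : S x ^+ 3 <= 1 by rewrite expr_le1// ltW.
have s30 : 0 < S x ^+ 3 by rewrite exprn_gt0.
by rewrite (ger0_norm (mulr_ge0 (ltW s30) (ltW f0))); nra.
Qed.

Lemma ground_H4 : exists A, H4le (ground_chain beta r) A.
Proof.
have [A La] := ground_src.
have [us [su [cu bu Lu]]] := Msol_exists a0 b0 La.
have e := Msol_uniq a0 b0 (ground_Msol beta0 r0) su.
exists (resolvent_const a b * A); split.
- exact: chain_ground.
- by move=> k x k4; rewrite e ?bu// ltnW.
- move=> k k5; have -> : ground_chain beta r k = us k by apply/funext; exact: e.
  exact: Lu.
Qed.

Lemma bnd_of_H4 us A : (forall x, us 0%N (- x) = us 0%N x) -> H4le us A ->
  bnd (us 0%N) ((1 + weight^-1) * A).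
Proof.
move=> eu [cu bu Lu]; have L0 := Lu 0%N isT; have [A0 c0 _] := L0.
have e0 := weight_gt0.
have h : A <= (1 + weight^-1) * A.
  by rewrite ler_peMl ?(ltW A0)// lerDl invr_ge0 ltW.
split=> //.
- by move=> x; apply: le_trans h; exact: bu.
- exact: L2le_mono L0.
- apply: (@L2le_mono _ _ (1 * A)).
    have -> : weight * ((1 + weight^-1) * A) = weight * A + A by field; rewrite gt_eqF.
    by rewrite mul1r lerDr mulr_ge0// ltW.
  apply: (L2le_dom ltr01 _ _ L0); first by apply: ctsM => //; exact: ctsX.
  move=> x; rewrite mul1r normrM ler_piMl//.
  rewrite normrX expr_le1// ger0_norm ?sechs_le1//; exact/ltW/sechs_gt0.
Qed.

Lemma ground_bnd : exists A, bnd phi A.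
Proof.
have [A H] := ground_H4; exists ((1 + weight^-1) * A).
have eg x : ground_chain beta r 0%N (- x) = ground_chain beta r 0%N x := ground_even beta r x.
exact: (bnd_of_H4 eg H).
Qed.

(** The source term after elimination of the component along [phi]: by [resolvent_potential] and
[ell_resolvent], [h = T (Pot h + q)] implies [ell h = (p + 1) ell h + ell (T q)], that is
[ell h = - ell (T q) / p]. *)
Definition reduced_op q x := resolvent q 0%N x - (p%:R + 1) / p%:R * ell (resolvent q 0%N) * phi x.

Lemma ell_le h A : bnd h A -> `|ell h| <= 2 / beta / mom phi * A.
Proof.
move=> hA; have [_ bh _ _] := hA; have [_ m] := momP (bnd_cont hA) bh.
have m0 := mom_ground_gt0.
rewrite /ell normrM normfV (ger0_norm (ltW m0)).
have -> : 2 / beta / mom phi * A = 2 / beta * A / mom phi by ring.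
by rewrite ler_pM2r// invr_gt0.
Qed.

Lemma reduced_op_bnd : exists2 C, 0 < C & forall q A, L2le q A -> (forall x, q (- x) = q x) ->
  bnd (reduced_op q) (C * A) /\ exists2 us, us 0%N = reduced_op q & H4le us (C * A).
Proof.
have [G0 hG0] := ground_bnd; have [G1 hG1] := ground_H4.
have G00 := bnd_gt0 hG0; have [_ _ /(_ 0%N isT)[G10 _ _]] := hG1.
have e0 := weight_gt0; have rc := resolvent_norm_gt0.
have m0 := mom_ground_gt0.
pose D := (1 + weight^-1) * resolvent_norm.
pose E := (p%:R + 1) / p%:R * (2 / beta / mom phi * D).
have D0 : 0 < D by rewrite mulr_gt0// addr_gt0// invr_gt0.
have E0 : 0 < E.
  apply: mulr_gt0; first by rewrite divr_gt0// addr_gt0.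
  by apply: mulr_gt0 => //; rewrite !divr_gt0.
exists (D + E * G0 + (resolvent_norm + E * G1)).
  by rewrite !addr_gt0// mulr_gt0.
move=> q A Lq eq; have [A0 _ _] := Lq.
have [sq Hq] := resolventP Lq.
have bq : bnd (resolvent q 0%N) (D * A).
  by have := bnd_of_H4 (resolvent_even Lq eq) Hq; rewrite mulrA.
have le := ell_le bq.
have lE : `|- ((p%:R + 1) / p%:R * ell (resolvent q 0%N))| <= E * A.
  rewrite normrN normrM ger0_norm; last by rewrite divr_ge0 ?addr_ge0// ltW.
  have -> : E * A = (p%:R + 1) / p%:R * (2 / beta / mom phi * (D * A)) by rewrite /E; ring.
  by rewrite ler_pM2l// divr_gt0// addr_gt0.
have EA : 0 < E * A by exact: mulr_gt0.
split.
  have := bndD bq (bndZ lE EA hG0).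
  have e : (fun x => resolvent q 0%N x + - ((p%:R + 1) / p%:R * ell (resolvent q 0%N)) * phi x) = reduced_op q.
    by apply/funext => x; rewrite /reduced_op; ring.
  rewrite e; apply: (bnd_mono weight_gt0).
  have : 0 < (resolvent_norm + E * G1) * A by rewrite mulr_gt0// addr_gt0// mulr_gt0.
  lra.
exists (fun k x => resolvent q k x + - ((p%:R + 1) / p%:R * ell (resolvent q 0%N)) * ground_chain beta r k x).
  by apply/funext => x; rewrite /reduced_op /ground_chain /=; ring.
have := H4leD Hq (H4leZ lE EA hG1); apply: H4le_mono.
have : 0 < (D + E * G0) * A by rewrite mulr_gt0// addr_gt0// mulr_gt0.
lra.
Qed.

Lemma reduced_op_lin c f g A B : L2le f A -> L2le g B ->
  reduced_op (fun x => c * f x + g x) = fun x => c * reduced_op f x + reduced_op g x.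
Proof.
move=> Lf Lg; have [_ [cf bf _]] := resolventP Lf; have [_ [cg bg _]] := resolventP Lg.
rewrite /reduced_op (resolvent_lin c Lf Lg (isT : (0 < 5)%N)).
rewrite (@ell_lin c _ _ (resolvent_norm * A) (resolvent_norm * B)); first by apply/funext => x; ring.
- exact: (dv_continuous (cf 0%N isT)).
- by move=> x; exact: bf.
- exact: (dv_continuous (cg 0%N isT)).
- by move=> x; exact: bg.
Qed.

Lemma resolvent_potential h A : bnd h A ->
  L2le (fun x => Pot x * h x) (amp ^+ p * (weight * A)) /\
  resolvent (fun x => Pot x * h x) 0%N = fun x => gap_op h x + (p%:R + 1) * ell h * phi x.
Proof.
move=> hA; have [eh bh Lh Sh] := hA; have ch := bnd_cont hA.
have Lp : L2le (fun x => Pot x * h x) (amp ^+ p * (weight * A)) by exact: pot_L2.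
split => //.
have [su _] := resolventP (gap_op_source hA).
have [G hG] := ground_H4.
have sg : Msol (fun x => Pot x * phi x / mu) (fun k x => (p%:R + 1) * ground_chain beta r k x + 0 * ground_chain beta r k x).
  have := Msol_lin (p%:R + 1) (ground_Msol beta0 r0) (Msol_lin (-1) (ground_Msol beta0 r0) (ground_Msol beta0 r0)).
  have -> : (fun x => (p%:R + 1) * (beta ^+ 4 * lam0 r * S x ^+ 4 * phi x) + (-1 * (beta ^+ 4 * lam0 r * S x ^+ 4 * phi x) + beta ^+ 4 * lam0 r * S x ^+ 4 * phi x))
    = fun x => Pot x * phi x / mu.
    by rewrite potE lam01; apply/funext => x; ring.
  congr Msol; apply/funext => k; apply/funext => x; ring.
have := Msol_lin (ell h) sg su.
have -> : (fun x => ell h * (Pot x * phi x / mu) + Pot x * (h x - ell h * phi x) / mu) = fun x => Pot x * h x / mu.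
  by apply/funext => x; ring.
move=> /resolvent_eq[_ /(_ 0%N isT) ->]; apply/funext => x.
by rewrite /gap_op /ground_chain /=; ring.
Qed.

Lemma ell_resolvent h A : bnd h A -> ell (resolvent (fun x => Pot x * h x) 0%N) = (p%:R + 1) * ell h.
Proof.
move=> hA; have [eh bh Lh Sh] := hA; have ch := bnd_cont hA.
have [Lp _] := resolvent_potential hA; have [su H] := resolventP Lp.
rewrite potE in su.
have := mom_resolvent eh ch bh su (ex_intro _ _ H) => /mom_eq.
by rewrite /ell => ->; rewrite mulrA.
Qed.

(** Both forms of the equation are equivalent: see [reduced_op]. *)
Lemma reduced_of_resolvent h q A B : bnd h A -> L2le q B -> (forall x, q (- x) = q x) ->
  h = resolvent (fun x => Pot x * h x + q x) 0%N -> h = fun x => gap_op h x + reduced_op q x.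
Proof.
move=> hA Lq eq e.
have [Lp eK] := resolvent_potential hA.
have e1 : h = fun x => resolvent (fun x => Pot x * h x) 0%N x + resolvent q 0%N x.
  rewrite {1}e; have := resolvent_lin 1 Lp Lq (isT : (0 < 5)%N).
  have -> : (fun x => 1 * (Pot x * h x) + q x) = fun x => Pot x * h x + q x.
    by apply/funext => x; ring.
  by move=> ->; apply/funext => x; ring.
have [_ Hp] := resolventP Lp; have [_ Hq] := resolventP Lq.
have [cp bp _] := Hp; have [cq bq _] := Hq.
have el : ell h = (p%:R + 1) * ell h + ell (resolvent q 0%N).
  have := @ell_lin 1 _ _ _ _ (dv_continuous (cp 0%N isT)) (fun x => bp 0%N x isT)
     (dv_continuous (cq 0%N isT)) (fun x => bq 0%N x isT).
  have -> : (fun x => 1 * resolvent (fun x => Pot x * h x) 0%N x + resolvent q 0%N x) = h.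
    by rewrite [RHS]e1; apply/funext => x; ring.
  by rewrite (ell_resolvent hA) mul1r.
have {}el : ell (resolvent q 0%N) = - (p%:R * ell h) by lra.
rewrite {1}e1 eK; apply/funext => x; rewrite /reduced_op el.
by field; rewrite gt_eqF.
Qed.

(** The converse of [reduced_of_resolvent]: the component along [phi] is recovered by applying [ell] to
the reduced equation. *)
Lemma resolvent_of_reduced h q A B : bnd h A -> L2le q B -> (forall x, q (- x) = q x) ->
  h = (fun x => gap_op h x + reduced_op q x) -> h = resolvent (fun x => Pot x * h x + q x) 0%N.
Proof.
move=> hA Lq eq e.
have [Lp eK] := resolvent_potential hA; have [_ bh _ _] := hA.
have [_ [cq bq _]] := resolventP Lq.
have cq0 := dv_continuous (cq 0%N isT).
have bq0 x := bq 0%N x isT.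
have [_ [cp bp _]] := resolventP Lp.
pose U := resolvent (fun x => Pot x * h x) 0%N; pose V := resolvent q 0%N.
have [cU bU] : continuous U /\ forall x, `|U x| <= resolvent_norm * (amp ^+ p * (weight * A)).
  by split; [exact: (dv_continuous (cp 0%N isT))|move=> x; exact: bp].
pose c := - ((p%:R + 1) * ell h) - (p%:R + 1) / p%:R * ell V.
have e1 : h = fun x => c * phi x + (1 * U x + V x).
  rewrite {1}e; apply/funext => x; rewrite /reduced_op -/V.
  have := eK; rewrite -/U => ->; rewrite /c; ring.
have el : ell h = c + ((p%:R + 1) * ell h + ell V).
  rewrite {1}e1 (@ell_lin _ _ _ 1 (1 * (resolvent_norm * (amp ^+ p * (weight * A))) + resolvent_norm * B)).
  - by rewrite (ell_lin _ cU bU cq0 bq0) ell_ground (ell_resolvent hA) mulr1 mul1r.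
  - exact: cphi.
  - exact: phi1.
  - by apply: ctsD => //; apply: ctsM => //; exact: cts_cst.
  - move=> x; apply: le_trans (ler_normD _ _) _; rewrite !mul1r; apply: lerD; [exact: bU|exact: bq0].
have c0 : c = 0.
  have : ell h = - ell V / p%:R by rewrite el /c; field; rewrite gt_eqF.
  by rewrite /c => ->; field; rewrite gt_eqF.
have := resolvent_lin 1 Lp Lq (isT : (0 < 5)%N).
have -> : (fun x => 1 * (Pot x * h x) + q x) = fun x => Pot x * h x + q x.
  by apply/funext => x; ring.
move=> ->; rewrite {1}e1 c0; apply/funext => x; rewrite /U /V; ring.
Qed.


Lemma power_taylor n M : 0 <= M -> exists2 C, 0 <= C & forall y z : R, `|y| <= M -> `|z| <= M ->
  `|y ^+ n - z ^+ n| <= C * `|y - z| /\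
  `|y ^+ n.+1 - z ^+ n.+1 - n.+1%:R * z ^+ n * (y - z)| <= C * `|y - z| ^+ 2.
Proof.
move=> M0.
have lip m : exists2 C, 0 <= C & forall y z : R, `|y| <= M -> `|z| <= M -> `|y ^+ m - z ^+ m| <= C * `|y - z|.
  elim: m => [|m [C C0 IH]]; first by exists 0 => // y z _ _; rewrite subrr normr0 mul0r.
  exists (M * C + M ^+ m); first by rewrite addr_ge0 ?mulr_ge0 ?exprn_ge0.
  move=> y z yM zM.
  have -> : y ^+ m.+1 - z ^+ m.+1 = y * (y ^+ m - z ^+ m) + z ^+ m * (y - z) by rewrite !exprS; ring.
  apply: le_trans (ler_normD _ _) _; rewrite mulrDl !normrM; apply: lerD.
    by rewrite -mulrA; apply: ler_pM => //; exact: IH.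
  by rewrite ler_wpM2r// normrX lerXn2r ?nnegrE.
have tay m : exists2 C, 0 <= C & forall y z : R, `|y| <= M -> `|z| <= M ->
    `|y ^+ m.+1 - z ^+ m.+1 - m.+1%:R * z ^+ m * (y - z)| <= C * `|y - z| ^+ 2.
  elim: m => [|m [C C0 IH]].
    by exists 0 => // y z _ _; rewrite !expr1 expr0 !mul1r subrr normr0 mul0r.
  exists (M * C + m.+1%:R * M ^+ m); first by rewrite addr_ge0 ?mulr_ge0 ?exprn_ge0.
  move=> y z yM zM.
  have -> : y ^+ m.+2 - z ^+ m.+2 - m.+2%:R * z ^+ m.+1 * (y - z) =
     y * (y ^+ m.+1 - z ^+ m.+1 - m.+1%:R * z ^+ m * (y - z)) + m.+1%:R * z ^+ m * (y - z) ^+ 2.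
    by rewrite [m.+2%:R]mulrSr !exprS; ring.
  apply: le_trans (ler_normD _ _) _; rewrite mulrDl !normrM; apply: lerD.
    by rewrite -[leRHS]mulrA; apply: ler_pM => //; exact: IH.
  rewrite -expr2 ler_wpM2r ?sqr_ge0// ger0_norm// ler_wpM2l// normrX.
  by rewrite lerXn2r ?nnegrE.
have [C1 C10 h1] := lip n; have [C2 C20 h2] := tay n.
exists (C1 + C2); first exact: addr_ge0.
move=> y z yM zM; split.
  by apply: le_trans (h1 y z yM zM) _; rewrite ler_wpM2r// lerDl.
by apply: le_trans (h2 y z yM zM) _; rewrite ler_wpM2r ?sqr_ge0// lerDr.
Qed.

Definition Phi x := amp * phi x.

Lemma Phi_pow x : Phi x ^+ p = Pot x.
Proof. by rewrite /Phi exprMn (ground_expn _ _ rp). Qed.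

Lemma Phi_bnd : exists2 A, 0 < A & bnd Phi A.
Proof.
have [A hA] := ground_bnd; exists (amp * A); first by rewrite mulr_gt0// (bnd_gt0 hA).
by apply: bndZ => //; rewrite ger0_norm// ltW.
Qed.

Lemma gap_op0 : gap_op (fun=> 0) = fun=> 0.
Proof.
have z0 := @bnd0 R beta weight weight_gt0 1 ltr01.
have := gap_op_lin (-1) z0 z0.
have -> : (fun x : R => -1 * 0 + 0) = (fun=> 0 : R) by apply/funext => x; ring.
by move=> e; apply/funext => x; rewrite {1}e; ring.
Qed.

Definition reduced_eq u q := u = fun x => gap_op u x + reduced_op q x.

Lemma reduced_eq_lin c u u' q q' A A' B B' : bnd u A -> bnd u' A' -> L2le q B -> L2le q' B' ->
  reduced_eq u q -> reduced_eq u' q' ->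
  reduced_eq (fun x => c * u x + u' x) (fun x => c * q x + q' x).
Proof.
move=> bu bu' Lq Lq' e e'; rewrite /reduced_eq (gap_op_lin c bu bu') (reduced_op_lin c Lq Lq').
by rewrite {1}e {1}e'; apply/funext => x; ring.
Qed.

(** The remainder [F (c, h)] of the equation for [Phi + h] once [Pot h] is set apart. *)
Definition source c h x : R := (Phi x + h x) ^+ p.+1 / (p%:R + 1) - Phi x ^+ p.+1 / (p%:R + 1)
  - Pot x * h x - (c - 1) * (Phi x + h x).

Definition dsource c h x : R := (Phi x + h x) ^+ p - Pot x - (c - 1).

Let CBex : {C | 0 < C /\ forall q A, L2le q A -> (forall x, q (- x) = q x) ->
  bnd (reduced_op q) (C * A) /\ exists2 us, us 0%N = reduced_op q & H4le us (C * A)}.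
Proof. by apply: cid; have [C C0 h] := reduced_op_bnd; exists C. Qed.

Let CB : R := projT1 CBex.
Let CB0 : 0 < CB. Proof. by have [] := projT2 CBex. Qed.
Let CBP q A : L2le q A -> (forall x, q (- x) = q x) ->
  bnd (reduced_op q) (CB * A) /\ exists2 us, us 0%N = reduced_op q & H4le us (CB * A).
Proof. exact: (projT2 CBex).2. Qed.

Let AP : R := projT1 (cid2 Phi_bnd).
Let AP0 : 0 < AP. Proof. by rewrite /AP; case: cid2. Qed.
Let bPhi : bnd Phi AP. Proof. by rewrite /AP; case: cid2. Qed.

Let M : R := AP + 1.
Let M0 : 0 <= M. Proof. by rewrite addr_ge0// ltW. Qed.
Let C1 : R := projT1 (cid2 (power_taylor p M0)).
Let C10 : 0 <= C1. Proof. by rewrite /C1; case: cid2. Qed.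
Let C1P (y z : R) : `|y| <= M -> `|z| <= M -> `|y ^+ p - z ^+ p| <= C1 * `|y - z| /\
  `|y ^+ p.+1 - z ^+ p.+1 - p.+1%:R * z ^+ p * (y - z)| <= C1 * `|y - z| ^+ 2.
Proof. by rewrite /C1; case: cid2 => C /= _ h; exact: h. Qed.

Definition rho1 : R := (1 + rho) / 2.

Lemma rho1_gt0 : 0 < rho1.
Proof. by rewrite /rho1; have := rho_gt0; lra. Qed.

Lemma rho1_lt1 : rho1 < 1.
Proof. by rewrite /rho1; have := rho_lt1; lra. Qed.

(** Small enough for the Lipschitz constant [source_lip] of [source] to take up at most half of the room
left by the contraction factor [rho] of [gap_op]. *)
Definition radius : R := Num.min 1 ((1 - rho) / 2 / (CB * (3 * C1 + 1))).

Let K0 : 0 < CB * (3 * C1 + 1).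
Proof. by rewrite mulr_gt0// ltr_wpDl// mulr_ge0. Qed.

Lemma radius_gt0 : 0 < radius.
Proof.
rewrite /radius lt_min ltr01 divr_gt0// divr_gt0// subr_gt0; exact: rho_lt1.
Qed.

Lemma radius_le1 : radius <= 1.
Proof. by rewrite /radius ge_min lexx. Qed.

Definition source_lip : R := (3 * C1 + 1) * radius.

Let source_lip_gt0 : 0 < source_lip.
Proof. by rewrite mulr_gt0 ?radius_gt0// ltr_wpDl// mulr_ge0. Qed.

Let contraction_le : rho + CB * source_lip <= rho1.
Proof.
have : radius <= (1 - rho) / 2 / (CB * (3 * C1 + 1)) by rewrite /radius ge_min lexx orbT.
rewrite ler_pdivlMr// => h.
have -> : CB * source_lip = radius * (CB * (3 * C1 + 1)) by rewrite /source_lip; ring.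
rewrite /rho1; lra.
Qed.

Let step (e : R -> R) q A B : bnd e A -> L2le q B -> (forall x, q (- x) = q x) ->
  bnd (fun x => gap_op e x + reduced_op q x) (rho * A + CB * B) /\
  exists2 us, us 0%N = (fun x => gap_op e x + reduced_op q x) & H4le us (rho * A + CB * B).
Proof.
move=> eA Lq eq; have [bq [vs vE Hv]] := CBP Lq eq.
have [us uE Hu] := gap_op_H4 eA.
split; first exact: bndD (gap_op_bnd eA) bq.
by exists (fun k x => us k x + vs k x); [rewrite uE vE|exact: H4leD].
Qed.

(** Solutions of a reduced equation whose source is, up to a term of size [B], Lipschitz in the solution
itself, are of size [B] in H^4. *)
Let absorb (e : R -> R) q A0 B : bnd e A0 -> 0 < B -> reduced_eq e q -> (forall x, q (- x) = q x) ->
  (forall A, bnd e A -> L2le q (source_lip * A + B)) ->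
  bnd e (2 * (CB * B) / (1 - rho1)) /\
  exists2 us, us 0%N = e & H4le us (2 * (CB * B) / (1 - rho1)).
Proof.
move=> eA0 B0 fe eq hq.
have r10 : 0 < 1 - rho1 by rewrite subr_gt0 rho1_lt1.
have CBB : 0 < CB * B by exact: mulr_gt0.
have key A : 0 < A -> rho * A + CB * (source_lip * A + B) <= rho1 * A + CB * B.
  move=> A0'; have := ler_wpM2r (ltW A0') contraction_le; lra.
have be : bnd e (2 * (CB * B) / (1 - rho1)).
  apply: (bnd_absorb weight_gt0 (ltW rho1_gt0) rho1_lt1 CBB eA0) => A eA.
  have [h _] := step eA (hq A eA) eq; rewrite -fe in h.
  by apply: (bnd_mono weight_gt0 _ h); apply: key; exact: bnd_gt0 eA.
split=> //.
have [_ [us uE Hu]] := step be (hq _ be) eq; exists us; first by rewrite uE -fe.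
apply: H4le_mono Hu; set A := 2 * (CB * B) / (1 - rho1).
have A0' : 0 < A by rewrite /A divr_gt0// mulr_gt0.
apply: le_trans (key A A0') _.
have -> : CB * B = (1 - rho1) * A / 2 by rewrite /A; field; rewrite gt_eqF.
by have := mulr_gt0 r10 A0'; lra.
Qed.

Let small c h := `|c - 1| <= radius /\ bnd h radius.

Let sM c h x : small c h -> `|Phi x + h x| <= M.
Proof.
move=> [_ [_ bh _ _]]; have [_ bP _ _] := bPhi.
by apply: le_trans (ler_normD _ _) _; apply: lerD => //; apply: le_trans (bh x) radius_le1.
Qed.

Let PM x : `|Phi x| <= M.
Proof. by have [_ bP _ _] := bPhi; apply: le_trans (bP x) _; rewrite lerDl. Qed.

Let p1n : p.+1%:R = p%:R + 1 :> R. Proof. by rewrite -natr1. Qed.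
Let p1ge : 1 <= p%:R + 1 :> R. Proof. by rewrite lerDr ltW. Qed.

Let F_taylor c h h' x : small c h -> small c h' ->
  `|source c h' x - source c h x - dsource c h x * (h' x - h x)| <= C1 * `|h' x - h x| ^+ 2.
Proof.
move=> sh sh'; have [_ t] := C1P (sM x sh') (sM x sh).
have e : source c h' x - source c h x - dsource c h x * (h' x - h x) =
  ((Phi x + h' x) ^+ p.+1 - (Phi x + h x) ^+ p.+1 - p.+1%:R * (Phi x + h x) ^+ p * (Phi x + h' x - (Phi x + h x))) / (p%:R + 1).
  by rewrite /source /dsource p1n; field.
have e' : Phi x + h' x - (Phi x + h x) = h' x - h x by ring.
rewrite e e' in t *; rewrite normrM normfV (ger0_norm (le_trans ler01 p1ge)).
rewrite ler_pdivrMr ?(lt_le_trans ltr01 p1ge)//; apply: le_trans t _.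
by rewrite ler_peMr// mulr_ge0 ?sqr_ge0.
Qed.

Let dF_le c h x : small c h -> `|dsource c h x| <= C1 * `|h x| + `|c - 1|.
Proof.
move=> sh; have [t _] := C1P (sM x sh) (PM x).
rewrite /dsource -Phi_pow; apply: le_trans (ler_normB _ _) _; apply: lerD => //.
by apply: le_trans t _; have -> : Phi x + h x - Phi x = h x by ring.
Qed.

Let dF_le' c h x : small c h -> `|dsource c h x| <= source_lip.
Proof.
move=> sh; apply: le_trans (dF_le x sh) _; have [ce [_ bh _ _]] := sh.
have := ler_wpM2l C10 (bh x); rewrite /source_lip.
have := mulr_ge0 C10 (ltW radius_gt0); lra.
Qed.

Let F_lip c h h' x : small c h -> small c h' ->
  `|source c h' x - source c h x| <= source_lip * `|h' x - h x|.
Proof.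
move=> sh sh'.
have -> : source c h' x - source c h x = (source c h' x - source c h x - dsource c h x * (h' x - h x))
   + dsource c h x * (h' x - h x) by ring.
apply: le_trans (ler_normD _ _) _; have h1 := F_taylor x sh sh'.
have h2 := dF_le x sh; have [ce [_ bh _ _]] := sh; have [_ [_ bh' _ _]] := sh'.
set d := h' x - h x in h1 *.
have dn : `|d| <= 2 * radius.
  by apply: le_trans (ler_normB _ _) _; have := bh x; have := bh' x; lra.
have h3 : `|dsource c h x * d| <= (C1 * radius + radius) * `|d|.
  rewrite normrM ler_wpM2r//; apply: le_trans h2 _; apply: lerD => //.
  by rewrite ler_wpM2l.
have h4 : C1 * `|d| ^+ 2 <= C1 * (2 * radius) * `|d|.
  by rewrite expr2 [leLHS]mulrA ler_wpM2r// ler_wpM2l.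
rewrite /source_lip; lra.
Qed.

Let F_c c c' h x : source c' h x = source c h x - (c' - c) * (Phi x + h x).
Proof. by rewrite /source; ring. Qed.

Let cPhi : continuous Phi. Proof. exact: bnd_cont bPhi. Qed.
Let cPot : continuous Pot. Proof. by apply: ctsM; [exact: cts_cst|exact: ctsX]. Qed.
Let PotE x : Pot (- x) = Pot x. Proof. by rewrite /Pot sechs_even. Qed.
Let PhiE x : Phi (- x) = Phi x. Proof. by rewrite /Phi ground_even. Qed.

Let ctsN f : continuous f -> continuous (fun x => - f x).
Proof. by move=> cf x; apply: cvgN; exact: cf. Qed.

Let cF c h : continuous h -> continuous (source c h).
Proof.
move=> ch; apply: ctsD; last by apply: ctsN; apply: ctsM; [exact: cts_cst|exact: ctsD].
apply: ctsD; last by apply: ctsN; exact: ctsM.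
apply: ctsD; first by apply: ctsM; [apply: ctsX; exact: ctsD|exact: cts_cst].
by apply: ctsN; apply: ctsM; [exact: ctsX|exact: cts_cst].
Qed.

Let cdF c h : continuous h -> continuous (dsource c h).
Proof.
move=> ch; apply: ctsD; last by apply: ctsN; exact: cts_cst.
by apply: ctsD; [apply: ctsX; exact: ctsD|exact: ctsN].
Qed.

Let FE c h : (forall x, h (- x) = h x) -> forall x, source c h (- x) = source c h x.
Proof. by move=> eh x; rewrite /source PhiE PotE eh. Qed.

Let dFE c h : (forall x, h (- x) = h x) -> forall x, dsource c h (- x) = dsource c h x.
Proof. by move=> eh x; rewrite /dsource PhiE PotE eh. Qed.

Let ctsB f g : continuous f -> continuous g -> continuous (fun x => f x - g x).
Proof. by move=> cf cg; apply: ctsD => //; exact: ctsN. Qed.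

Let F_L2 c h h' A : small c h -> small c h' -> bnd (fun x => h' x - h x) A ->
  L2le (fun x => source c h' x - source c h x) (source_lip * A).
Proof.
move=> sh sh' [_ _ Ld _]; have [_ bh] := sh; have [_ bh'] := sh'.
apply: (L2le_dom source_lip_gt0 _ _ Ld); last by move=> x; exact: F_lip.
by apply: ctsB; apply: cF; [exact: bnd_cont bh'|exact: bnd_cont bh].
Qed.

Let s0 c : `|c - 1| <= radius -> small c (fun=> 0).
Proof. by move=> ce; split => //; exact: bnd0 weight_gt0 _ radius_gt0. Qed.

Let F0_L2 c d : `|c - 1| <= d -> 0 < d -> L2le (source c (fun=> 0)) (d * AP).
Proof.
move=> cd d0; have [_ _ LP _] := bPhi.
have := L2leZ (_ : `|- (c - 1)| <= d) d0 LP; rewrite normrN => /(_ cd).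
by congr L2le; apply/funext => x; rewrite /source addr0; ring.
Qed.

Let F_all_L2 c h A d : small c h -> bnd h A -> `|c - 1| <= d -> 0 < d ->
  L2le (source c h) (source_lip * A + d * AP).
Proof.
move=> sh hA cd d0; have [ce _] := sh.
have hA' : bnd (fun x => h x - 0) A by move: hA; congr bnd; apply/funext => x; rewrite subr0.
have := L2leD (F_L2 (s0 ce) sh hA') (F0_L2 cd d0).
by congr L2le; apply/funext => x; ring.
Qed.

(** The contraction principle in the ball of radius [radius']; the source at [h = 0] is [(1 - c) Phi], which is
small with [c - 1]. *)
Lemma small_solution radius' : 0 < radius' -> radius' <= radius ->
  exists2 d, 0 < d & forall c, `|c - 1| < d -> exists2 h, bnd h radius' &
    reduced_eq h (source c h) /\ exists2 us, us 0%N = h & H4le us (2 * radius').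
Proof.
move=> e0 ee; have r10 : 0 < 1 - rho1 by rewrite subr_gt0 rho1_lt1.
pose d := Num.min radius ((1 - rho1) * radius' / 2 / (CB * AP)).
have d0 : 0 < d by rewrite /d lt_min radius_gt0 !divr_gt0// mulr_gt0.
have de : d <= radius by rewrite /d ge_min lexx.
have dd : CB * (d * AP) <= (1 - rho1) * radius' / 2.
  have : d <= (1 - rho1) * radius' / 2 / (CB * AP) by rewrite /d ge_min lexx orbT.
  by rewrite ler_pdivlMr ?mulr_gt0// => h; apply: le_trans h; rewrite [leRHS]mulrCA.
exists d => // c /ltW cd; have ce := le_trans cd de.
have sm h : bnd h radius' -> small c h by move=> bh; split => //; exact: (bnd_mono weight_gt0 ee).
pose P h x := gap_op h x + reduced_op (source c h) x.
have [||h bh Ph] := @bnd_fixpoint R beta weight weight_gt0 P rho1 radius' rho1_gt0 rho1_lt1 e0.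
- move=> h k A bh bk hk.
  have [eh _ _ _] := bh; have [ek _ _ _] := bk.
  have Lh := F_all_L2 (sm h bh) bh cd d0; have Lk := F_all_L2 (sm k bk) bk cd d0.
  have LF := F_L2 (sm k bk) (sm h bh) hk.
  have eF x : source c h (- x) - source c k (- x) = source c h x - source c k x by rewrite !FE.
  have [hs _] := step hk LF eF.
  have e1 : (fun x => gap_op (fun x => h x - k x) x + reduced_op (fun x => source c h x - source c k x) x)
     = fun x => P h x - P k x.
    have -> : (fun x => h x - k x) = fun x => -1 * k x + h x by apply/funext => x; ring.
    have -> : (fun x => source c h x - source c k x) = fun x => -1 * source c k x + source c h x.
      by apply/funext => x; ring.
    by rewrite (gap_op_lin _ bk bh) (reduced_op_lin _ Lk Lh) /P; apply/funext => x; ring.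
  rewrite e1 in hs; apply: (bnd_mono weight_gt0 _ hs).
  by have := ler_wpM2r (ltW (bnd_gt0 hk)) contraction_le; lra.
- have b0' := @bnd0 R beta weight weight_gt0 _ e0.
  have F0E x : source c (fun=> 0) (- x) = source c (fun=> 0) x by apply: FE.
  have [hs _] := CBP (F0_L2 cd d0) F0E.
  have -> : P (fun=> 0) = reduced_op (source c (fun=> 0)).
    by rewrite /P gap_op0; apply/funext => x; rewrite add0r.
  apply: (bnd_mono weight_gt0 _ hs); apply: le_trans dd _.
  by have := mulr_gt0 r10 e0; lra.
exists h => //; split; first by rewrite /reduced_eq -{1}Ph.
have [eh _ _ _] := bh.
have [_ [us uE Hu]] := step bh (F_all_L2 (sm h bh) bh cd d0) (FE c eh).
exists us; first by rewrite uE; exact: Ph.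
apply: H4le_mono Hu.
have := ler_wpM2r (ltW e0) contraction_le; have := mulr_gt0 r10 e0.
have := rho1_lt1; have := rho1_gt0; nra.
Qed.

(** [h - k] solves a reduced equation with a source that is Lipschitz in [h - k]: its size is arbitrarily
small by [absorb]. *)
Lemma solution_uniq c h k : small c h -> small c k ->
  reduced_eq h (source c h) -> reduced_eq k (source c k) -> h = k.
Proof.
move=> sh sk fh fk; have [ce bh] := sh; have [_ bk] := sk.
have [eh _ _ _] := bh; have [ek _ _ _] := bk.
have Lh := F_all_L2 sh bh ce radius_gt0; have Lk := F_all_L2 sk bk ce radius_gt0.
have bd := bndB bh bk.
have fd : reduced_eq (fun x => h x - k x) (fun x => source c h x - source c k x).
  have := reduced_eq_lin (-1) bk bh Lk Lh fk fh.
  have -> : (fun x => -1 * k x + h x) = fun x => h x - k x by apply/funext => x; ring.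
  by have -> : (fun x => -1 * source c k x + source c h x) = (fun x => source c h x - source c k x)
    by apply/funext => x; ring.
have r10 : 0 < 1 - rho1 by rewrite subr_gt0 rho1_lt1.
apply/funext => x; apply/eqP; rewrite -subr_eq0; apply/eqP; move: x.
apply: (@bnd_small R beta weight (fun x => h x - k x)) => e e0.
pose B := e * (1 - rho1) / 2 / CB.
have B0 : 0 < B by rewrite !divr_gt0// mulr_gt0.
exists e => //; have -> : e = 2 * (CB * B) / (1 - rho1).
  by rewrite /B; field; rewrite !gt_eqF.
have [|A hA|//] := absorb bd B0 fd.
  by move=> x; rewrite !FE.
by apply: L2le_mono (F_L2 sk sh hA); rewrite lerDl ltW.
Qed.

(** The equation obtained by differentiating the reduced equation with respect to [c]; it is linear in
[k], so that the bound [Ck] does not depend on [c] and [h]. *)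
Lemma tangent_exists : exists2 Ck, 0 < Ck & forall c h, small c h -> exists2 k, bnd k Ck &
   reduced_eq k (fun x => dsource c h x * k x - (Phi x + h x)).
Proof.
have r10 : 0 < 1 - rho1 by rewrite subr_gt0 rho1_lt1.
pose Ck := CB * (AP + radius) / (1 - rho1).
have Ck0 : 0 < Ck by rewrite divr_gt0// mulr_gt0// addr_gt0// radius_gt0.
exists Ck => // c h sh; have [ce bh] := sh; have [eh _ _ _] := bh.
pose P k x := gap_op k x + reduced_op (fun x => dsource c h x * k x - (Phi x + h x)) x.
have bPh := bndD bPhi bh; have [_ _ LPh _] := bPh.
have LPhN : L2le (fun x => - (Phi x + h x)) (AP + radius).
  by have [_ _ L _] := bndN bPh.
have mL k A : bnd k A -> L2le (fun x => dsource c h x * k x) (source_lip * A).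
  move=> bk; have [_ _ Lk _] := bk; apply: (L2le_dom source_lip_gt0 _ _ Lk).
    by apply: ctsM; [apply: cdF; exact: bnd_cont bh|exact: bnd_cont bk].
  by move=> x; rewrite normrM ler_wpM2r// dF_le'.
have [||k bk Pk] := @bnd_fixpoint R beta weight weight_gt0 P rho1 Ck rho1_gt0 rho1_lt1 Ck0.
- move=> k k' A bk bk' kk.
  have [ek _ _ _] := bk; have [ek' _ _ _] := bk'.
  have L1 := L2leD (mL k _ bk) LPhN; have L2 := L2leD (mL k' _ bk') LPhN.
  have [|hs _] := step kk (mL _ _ kk); first by move=> x; rewrite dFE// ek ek'.
  have e1 : (fun x => gap_op (fun x => k x - k' x) x + reduced_op (fun x => dsource c h x * (k x - k' x)) x)
     = fun x => P k x - P k' x.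
    have -> : (fun x => k x - k' x) = fun x => -1 * k' x + k x by apply/funext => x; ring.
    have -> : (fun x => dsource c h x * (k x - k' x)) = fun x => -1 * (dsource c h x * k' x - (Phi x + h x))
       + (dsource c h x * k x - (Phi x + h x)) by apply/funext => x; ring.
    by rewrite (gap_op_lin _ bk' bk) (reduced_op_lin _ L2 L1) /P; apply/funext => x; ring.
  rewrite e1 in hs; apply: (bnd_mono weight_gt0 _ hs).
  by have := ler_wpM2r (ltW (bnd_gt0 kk)) contraction_le; lra.
- have [|hs _] := CBP LPhN; first by move=> x; rewrite PhiE eh.
  have -> : P (fun=> 0) = reduced_op (fun x => - (Phi x + h x)).
    rewrite /P gap_op0; apply/funext => x; rewrite add0r; congr (reduced_op _ x); apply/funext => y; ring.
  have -> : (1 - rho1) * Ck = CB * (AP + radius) by rewrite /Ck; field; rewrite gt_eqF.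
  exact: hs.
by exists k => //; rewrite /reduced_eq -{1}Pk.
Qed.

(** [D c h] is the solution of the linearized equation. The three differences [h' - h], [h' - h - (c' - c) D] and
[D c' h' - D c h] each solve a reduced equation to which [absorb] applies, with a source of size
[|c' - c|], [|c' - c|^2] (Taylor) and [|c' - c|] respectively. *)
Lemma branch_C1 : exists2 C, 0 < C & exists D : R -> (R -> R) -> R -> R,
  forall c h, small c h -> reduced_eq h (source c h) ->
  (exists us A, us 0%N = D c h /\ H4le us A) /\
  forall c' h', small c' h' -> reduced_eq h' (source c' h') -> c' != c ->
  (exists2 us, us 0%N = (fun x => h' x - h x - (c' - c) * D c h x) & H4le us (C * (c' - c) ^+ 2)) /\
  (exists2 us, us 0%N = (fun x => D c' h' x - D c h x) & H4le us (C * `|c' - c|)).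
Proof.
have r10 : 0 < 1 - rho1 by rewrite subr_gt0 rho1_lt1.
have [Ck Ck0 hk] := tangent_exists.
pose D c h : R -> R := if pselect (small c h) is left s then projT1 (cid2 (hk c h s)) else fun=> 0.
have DP c h : small c h -> bnd (D c h) Ck /\ reduced_eq (D c h) (fun x => dsource c h x * D c h x - (Phi x + h x)).
  by move=> s; rewrite /D; case: pselect => // s'; case: cid2.
pose W B := 2 * (CB * B) / (1 - rho1).
have W0 B : 0 < B -> 0 < W B by move=> B0; rewrite divr_gt0// !mulr_gt0.
have WM B s : W (B * s) = W B * s by rewrite /W; ring.
pose C2 := W (AP + radius).
have C20 : 0 < C2 by apply: W0; rewrite addr_gt0// radius_gt0.
pose C3 := W ((C1 * C2 + 1) * C2).
have CC : 0 < C1 * C2 + 1 by rewrite ltr_wpDl// mulr_ge0// ltW.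
have C30 : 0 < C3 by apply: W0; rewrite mulr_gt0.
pose C4 := W ((C1 * C2 + 1) * Ck + C2).
have C40 : 0 < C4 by apply: W0; rewrite addr_gt0// mulr_gt0.
exists (C3 + C4); first exact: addr_gt0.
exists D => c h sh fh; have [ce bh] := sh; have [eh _ _ _] := bh.
have [bk fk] := DP c h sh; set k := D c h in bk fk *.
have [ek _ _ _] := bk.
have dFL c0 h0 u A : small c0 h0 -> bnd u A -> L2le (fun x => dsource c0 h0 x * u x) (source_lip * A).
  move=> s bu; have [_ b0'] := s; have [_ _ Lu _] := bu; apply: (L2le_dom source_lip_gt0 _ _ Lu).
    by apply: ctsM; [apply: cdF; exact: bnd_cont b0'|exact: bnd_cont bu].
  by move=> x; rewrite normrM ler_wpM2r// dF_le'.
have LPhN h0 : bnd h0 radius -> L2le (fun x => - (Phi x + h0 x)) (AP + radius).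
  by move=> b; have [_ _ L _] := bndN (bndD bPhi b).
have Lk := L2leD (dFL _ _ _ _ sh bk) (LPhN h bh).
have kE x : dsource c h (- x) * k (- x) - (Phi (- x) + h (- x)) = dsource c h x * k x - (Phi x + h x).
  by rewrite dFE// ek PhiE eh.
split.
  have [_ [us uE Hu]] := step bk Lk kE.
  by exists us, (rho * Ck + CB * (source_lip * Ck + (AP + radius))); rewrite uE -fk.
move=> c' h' sh' fh' cc; have [ce' bh'] := sh'; have [eh' _ _ _] := bh'.
set s := c' - c; have s0' : 0 < `|s| by rewrite normr_gt0 subr_eq0.
have sch' : small c h' by split.
have sc'h : small c' h by split.
have LFh := F_all_L2 sh bh ce radius_gt0; have LFh' := F_all_L2 sh' bh' ce' radius_gt0.
have fd : reduced_eq (fun x => h' x - h x) (fun x => source c' h' x - source c h x).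
  have := reduced_eq_lin (-1) bh bh' LFh LFh' fh fh'.
  have -> : (fun x => -1 * h x + h' x) = fun x => h' x - h x by apply/funext => x; ring.
  by have -> : (fun x => -1 * source c h x + source c' h' x) = (fun x => source c' h' x - source c h x)
    by apply/funext => x; ring.
have bd0 := bndB bh' bh.
have sAP : 0 < (AP + radius) * `|s| by rewrite mulr_gt0// addr_gt0// radius_gt0.
have [||bd _] := absorb bd0 sAP fd.
- by move=> x; rewrite !FE.
- move=> A hA.
  have L1 := F_L2 sc'h sh' hA.
  have sN : `|- s| <= `|s| by rewrite normrN.
  have [_ _ L2 _] := bndZ sN s0' (bndD bPhi bh).
  have := L2leD L1 L2; rewrite [`|s| * _]mulrC.
  by congr L2le; apply/funext => x; rewrite (F_c c c' h) -/s; ring.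
have {}bd : bnd (fun x => h' x - h x) (C2 * `|s|) by rewrite -WM.
have [_ bdx Ld _] := bd.
have Cs0 : 0 < (C1 * C2 + 1) * `|s| by exact: mulr_gt0.
have LFd : L2le (fun x => source c' h' x - source c h x)
    ((source_lip * radius + radius * AP) + (source_lip * radius + radius * AP)).
  have n1 : `|-1| <= 1 :> R by rewrite normrN1.
  have := L2leD LFh' (L2leZ n1 ltr01 LFh); rewrite mul1r.
  by congr L2le; apply/funext => x; ring.
split.
  pose e x := h' x - h x - s * k x.
  have fe : reduced_eq e (fun x => source c' h' x - source c h x - s * (dsource c h x * k x - (Phi x + h x))).
    have := reduced_eq_lin (- s) bk bd Lk LFd fk fd.
    have -> : (fun x => - s * k x + (h' x - h x)) = e by apply/funext => x; rewrite /e; ring.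
    by have -> : (fun x => - s * (dsource c h x * k x - (Phi x + h x)) + (source c' h' x - source c h x))
      = (fun x => source c' h' x - source c h x - s * (dsource c h x * k x - (Phi x + h x)))
      by apply/funext => x; ring.
  have [A0 be] : exists A, bnd e A.
    exists (C2 * `|s| + `|s| * Ck).
    by apply: bndB bd _; apply: bndZ bk.
  pose rem x := source c h' x - source c h x - dsource c h x * (h' x - h x) - s * (h' x - h x).
  have Lrem : L2le rem ((C1 * C2 + 1) * C2 * `|s| ^+ 2).
    have -> : (C1 * C2 + 1) * C2 * `|s| ^+ 2 = (C1 * C2 + 1) * `|s| * (C2 * `|s|) by ring.
    apply: (L2le_dom Cs0 _ _ Ld).
      have ch := bnd_cont bh; have ch' := bnd_cont bh'.
      apply: ctsB; last by apply: ctsM; [exact: cts_cst|exact: ctsB].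
      by apply: ctsB; [apply: ctsB; exact: cF|apply: ctsM; [exact: cdF|exact: ctsB]].
    move=> x; apply: le_trans (ler_normB _ _) _; rewrite normrM.
    have h1 := F_taylor x sh sch'; have := bdx x; set d := h' x - h x => dx.
    have h2 : C1 * `|d| ^+ 2 <= C1 * (C2 * `|s|) * `|d|.
      by rewrite expr2 [leLHS]mulrA ler_wpM2r// ler_wpM2l.
    have -> : (C1 * C2 + 1) * `|s| * `|d| = C1 * (C2 * `|s|) * `|d| + `|s| * `|d| by ring.
    by apply: lerD => //; exact: le_trans h1 h2.
  have Bp : 0 < (C1 * C2 + 1) * C2 * `|s| ^+ 2 by apply: mulr_gt0; [exact: mulr_gt0|exact: exprn_gt0].
  have [||_ [us uE Hu]] := absorb be Bp fe.
  - by move=> x; rewrite !FE// kE.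
  - move=> A hA; have := L2leD (dFL _ _ _ _ sh hA) Lrem.
    congr L2le; apply/funext => x; rewrite (F_c c c' h') -/s /rem /e; ring.
  exists us => //; apply: H4le_mono Hu; rewrite -/(W _) WM -/C3 real_normK ?num_real//.
  by rewrite ler_wpM2r ?sqr_ge0// lerDl ltW.
have [bk' fk'] := DP c' h' sh'; set k' := D c' h' in bk' fk' *.
have [ek' _ _ _] := bk'.
have Lk' := L2leD (dFL _ _ _ _ sh' bk') (LPhN h' bh').
have bg := bndB bk' bk.
have fg : reduced_eq (fun x => k' x - k x) (fun x => (dsource c' h' x * k' x - (Phi x + h' x)) - (dsource c h x * k x - (Phi x + h x))).
  have := reduced_eq_lin (-1) bk bk' Lk Lk' fk fk'.
  have -> : (fun x => -1 * k x + k' x) = fun x => k' x - k x by apply/funext => x; ring.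
  by have -> : (fun x => -1 * (dsource c h x * k x - (Phi x + h x)) + (dsource c' h' x * k' x - (Phi x + h' x)))
    = (fun x => (dsource c' h' x * k' x - (Phi x + h' x)) - (dsource c h x * k x - (Phi x + h x)))
    by apply/funext => x; ring.
have Bp : 0 < ((C1 * C2 + 1) * Ck + C2) * `|s| by rewrite mulr_gt0// addr_gt0// mulr_gt0.
have [||_ [us uE Hu]] := absorb bg Bp fg.
- by move=> x; rewrite kE dFE// ek' PhiE eh'.
- move=> A hA.
  have L1 := dFL _ _ _ _ sh hA.
  have [_ _ Lkk _] := bk'.
  have L2 : L2le (fun x => (dsource c' h' x - dsource c h x) * k' x) ((C1 * C2 + 1) * `|s| * Ck).
    apply: (L2le_dom Cs0 _ _ Lkk).
      apply: ctsM; last exact: bnd_cont bk'.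
      by apply: ctsB; apply: cdF; [exact: bnd_cont bh'|exact: bnd_cont bh].
    move=> x; rewrite normrM ler_wpM2r//.
    have -> : dsource c' h' x - dsource c h x = (Phi x + h' x) ^+ p - (Phi x + h x) ^+ p - s.
      by rewrite /dsource /s; ring.
    apply: le_trans (ler_normB _ _) _; rewrite mulrDl mul1r; apply: lerD => //.
    have [t _] := C1P (sM x sh') (sM x sh); apply: le_trans t _.
    have -> : Phi x + h' x - (Phi x + h x) = h' x - h x by ring.
    by rewrite -mulrA ler_wpM2l.
  have [_ _ L3 _] := bndN bd.
  have := L2leD L1 (L2leD L2 L3).
  have -> : source_lip * A + ((C1 * C2 + 1) * `|s| * Ck + C2 * `|s|) = source_lip * A + ((C1 * C2 + 1) * Ck + C2) * `|s| by ring.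
  by congr L2le; apply/funext => x; ring.
exists us => //; apply: H4le_mono Hu; rewrite -/(W _) WM -/C4.
by rewrite ler_wpM2r// lerDr ltW.
Qed.

(** The source [Pot h + source c h] of the equation for [h]. *)
Definition full_source c h x : R :=
  (Phi x + h x) ^+ p.+1 / (p%:R + 1) - Phi x ^+ p.+1 / (p%:R + 1) - (c - 1) * (Phi x + h x).

Lemma reduced_eq_resolvent c h : small c h -> exists2 B, L2le (full_source c h) B &
  (reduced_eq h (source c h) <-> h = resolvent (full_source c h) 0%N).
Proof.
move=> sh; have [ce bh] := sh; have [LP _] := resolvent_potential bh.
have LF := F_all_L2 sh bh ce radius_gt0.
have e : (fun x => Pot x * h x + source c h x) = full_source c h.
  by apply/funext => x; rewrite /full_source /source; ring.
have LS := L2leD LP LF; rewrite e in LS; exists (amp ^+ p * (weight * radius) + (source_lip * radius + radius * AP)) => //.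
have [eh _ _ _] := bh; rewrite -e.
by split; [exact: resolvent_of_reduced bh LF (FE c eh)|exact: reduced_of_resolvent bh LF (FE c eh)].
Qed.

End Oper.

(** * Bump functions *)

Section QuadDerive.
Context {R : realType} {V : normedModType R}.

(** Along the branch and for [flat] at 0 the increments are estimated to second order. *)
Lemma quadratic_derive (f : R -> V) (x : R) (l : V) (C d : R) : 0 < d -> 0 <= C ->
  (forall h, `|h| < d -> `|f (h + x) - f x - h *: l| <= C * h ^+ 2) ->
  is_derive x 1 f l.
Proof.
move=> d0 C0 hq.
suff cv : (fun h : R => h^-1 *: (f (h *: (1 : R) + x) - f x)) @ 0^' --> l.
  by apply: DeriveDef; [apply/cvg_ex; exists l|exact: cvg_lim].
apply/cvgrPdist_le => e e0; near=> h.
have h0 : h != 0 by near: h; exact: nbhs_dnbhs_neq.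
have hd : `|h| < d.
  near: h; apply: dnbhs0_lt => //.
have hC : `|h| <= e / (C + 1).
  near: h; apply: dnbhs0_le; by rewrite divr_gt0// ltr_wpDl.
have -> : h *: (1 : R) = h by exact: mulr1.
have -> : l - h^-1 *: (f (h + x) - f x) = - (h^-1 *: (f (h + x) - f x - h *: l)).
  by rewrite [in RHS]scalerBr scalerA mulVf// scale1r opprB.
rewrite normrN normrZ normfV.
have nh : 0 < `|h| by rewrite normr_gt0.
rewrite mulrC ler_pdivrMr//; apply: le_trans (hq h hd) _.
rewrite -[h ^+ 2]real_normK ?num_real// expr2 mulrA ler_pM2r//.
have : (C + 1) * `|h| <= e by rewrite mulrC -ler_pdivlMr// ltr_wpDl.
by rewrite mulrDl mul1r; have := normr_ge0 h; lra.
Unshelve. all: by end_near. Qed.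
End QuadDerive.

Section Smooth.
Context {R : realType}.
Implicit Types (f g : R -> R) (n k : nat).

Fixpoint diffn n f : Prop := if n is m.+1 then exists2 g, dv f g & diffn m g else True.

Lemma diffnW n f : diffn n.+1 f -> diffn n f.
Proof. by elim: n f => [//|n IH] f [g dg sg]; exists g => //; exact: IH. Qed.

Lemma diffn_cst n (a : R) : diffn n (fun=> a).
Proof. by elim: n a => // n IH a; exists (fun=> 0) => //; exact: dv_cst. Qed.

Lemma diffnD n f g : diffn n f -> diffn n g -> diffn n (fun x => f x + g x).
Proof.
elim: n f g => // n IH f g [f' df sf] [g' dg sg].
by exists (fun x => f' x + g' x); [exact: dvD|exact: IH].
Qed.

Lemma diffnM n f g : diffn n f -> diffn n g -> diffn n (fun x => f x * g x).
Proof.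
elim: n f g => // n IH f g sf sg.
have [f' df sf'] := sf; have [g' dg sg'] := sg.
exists (fun x => f' x * g x + f x * g' x); first exact: dvM.
by apply: diffnD; apply: IH => //; exact: diffnW.
Qed.

Lemma diffn_affine n f a b : diffn n f -> diffn n (fun x => f (a * x + b)).
Proof.
elim: n f => // n IH f [f' df sf'].
exists (fun x => f' (a * x + b) * a).
  apply: (dv_eq (dv_comp df (dvD (dvM (dv_cst a) dv_id) (dv_cst b)))) => x; ring.
by apply: diffnM; [exact: IH|exact: diffn_cst].
Qed.

Lemma diffn_exp n (a : R) : diffn n (fun x => expR (a * x)).
Proof.
elim: n => // n IH; exists (fun x => a * expR (a * x)); first exact: dv_expl.
by apply: diffnM => //; exact: diffn_cst.
Qed.

Definition smooth f := forall n, diffn n f.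

Lemma smooth_derivable f : smooth f -> forall n x, derivable (derive1n n f) x 1.
Proof.
move=> sf n; move: (sf n.+1) => {sf}; elim: n f => [|n IH] f.
  by move=> [g dg _] x; have [] := dg x.
move=> [g dg sg]; rewrite derive1Sn (dv_derive1 dg); exact: IH.
Qed.

Lemma smooth_primitive F f : dv F f -> smooth f -> smooth F.
Proof. by move=> dF sf [|n] //; exists f. Qed.

Lemma smooth_dv f f' : smooth f -> dv f f' -> smooth f'.
Proof.
move=> sf df n; have [g dg sg] := sf n.+1.
by have <- : g = f' by rewrite -(dv_derive1 dg) -(dv_derive1 df).
Qed.

(** The powers are there to make the family stable under differentiation: see [dv_flat]. *)
Definition flat k x : R := if 0 < x then x ^- k * expR (- x^-1) else 0.

Lemma exp_ge_pow (y : R) n : 0 <= y -> y ^+ n <= n%:R ^+ n * expR y.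
Proof.
move=> y0; case: n => [|n]; first by rewrite !expr0 mul1r; apply: le_trans (expR_ge1Dx y); lra.
have n0 : 0 < n.+1%:R :> R by [].
have -> : expR y = expR (y / n.+1%:R) ^+ n.+1.
  by rewrite -expRM_natl mulrC divfK// gt_eqF.
rewrite -exprMn; apply: lerXn2r; rewrite ?nnegrE//.
have h := ler_wpM2l (ltW n0) (expR_ge1Dx (y / n.+1%:R)).
apply: le_trans h; rewrite mulrDr mulrCA divff ?gt_eqF// !mulr1; lra.
Qed.

Lemma flat_quad k h : `|flat k h| <= (k.+2%:R ^+ k.+2) * h ^+ 2.
Proof.
rewrite /flat; case: ifPn => h0; last by rewrite normr0 mulr_ge0 ?sqr_ge0 ?exprn_ge0.
have i0 : 0 <= h^-1 by rewrite invr_ge0 ltW.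
rewrite ger0_norm ?mulr_ge0 ?expR_ge0//; last by rewrite -exprVn exprn_ge0.
have := exp_ge_pow k.+2 i0.
rewrite expRN => e; have ep := expR_gt0 h^-1.
rewrite ler_pdivrMr//.
have -> : h ^- k = h ^+ 2 * h^-1 ^+ k.+2.
  by rewrite -exprVn !exprSr expr0 mul1r; field; rewrite gt_eqF.
have h2 : 0 <= h ^+ 2 by exact: sqr_ge0.
by have := ler_wpM2l h2 e; rewrite [leRHS]mulrCA mulrA.
Qed.

Lemma dv_flat k : dv (flat k) (fun x => - k%:R * flat k.+1 x + flat k.+2 x).
Proof.
move=> x; have [x0|x0|->] := ltgtP x 0.
- have -> : - k%:R * flat k.+1 x + flat k.+2 x = 0.
    by rewrite /flat ltNge (ltW x0)/=; ring.
  have : is_derive x (1 : R) (fun _ : R => (0 : R)) 0 by exact: is_derive_cst.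
  apply: near_eq_is_derive; near=> y.
  have y0 : y < 0 by near: y; exact: lt_nbhsl.
  by rewrite /flat ltNge (ltW y0).
- have xn : x != 0 by rewrite gt_eqF.
  have d1 : is_derive x (1 : R) (fun y : R => y^-1) (- x ^- 2 * 1).
    by apply: (is_derive_eq (@is_deriveV _ (fun y => y) x _ 1 xn (is_derive_id _ _))).
  have d2 : is_derive x (1 : R) (fun y : R => expR (- y^-1)) (expR (- x^-1) * (x ^- 2)).
    have dN := @is_deriveN _ _ _ _ _ _ _ d1.
    have := @is_derive1_comp _ expR (fun y => - y^-1) x _ _ (is_derive_expR _) dN.
    by move=> h; apply: (is_derive_eq h); rewrite mulr1 opprK.
  have dpow : dv (fun y : R => y ^+ k) (fun y => k%:R * y ^+ k.-1).
    case: k => [|k]; first by apply: (dv_eq (dv_cst 1)) => y; rewrite mul0r.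
    by apply: (dv_eq (dvX k dv_id)) => y; rewrite mulr1.
  have xk : x ^+ k != 0 by rewrite expf_neq0.
  have d3 := @is_deriveV _ (fun y => y ^+ k) x _ 1 xk (dpow x).
  have d4 := @is_deriveM _ _ _ _ _ _ _ _ d3 d2.
  have : is_derive x (1 : R) (fun y => (y ^+ k)^-1 * expR (- y^-1)) (- k%:R * flat k.+1 x + flat k.+2 x).
    apply: (is_derive_eq d4); rewrite /flat x0 /GRing.scale/=.
    set E := expR _; case: k xk {dpow d3 d4} => [|k] xk.
      by rewrite !expr0 expr2 expr1; field.
    rewrite /= !exprS; set y := x ^+ k.
    have y0 : y != 0 by rewrite expf_neq0.
    by field; rewrite xn y0.
  apply: near_eq_is_derive; near=> y.
  have y0 : 0 < y by near: y; exact: lt_nbhsr.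
  by rewrite /flat y0.
- have -> : - k%:R * flat k.+1 0 + flat k.+2 0 = 0 by rewrite /flat ltxx; ring.
  have C0 : 0 <= k.+2%:R ^+ k.+2 :> R by rewrite exprn_ge0.
  apply: (@quadratic_derive _ _ _ _ _ _ 1 ltr01 C0).
  move=> h _; rewrite addr0 scaler0 subr0 {2}/flat ltxx subr0; exact: flat_quad.
Unshelve. all: by end_near. Qed.

Lemma smooth_flat k : smooth (flat k).
Proof.
move=> n; elim: n k => // n IH k.
exists (fun x => - k%:R * flat k.+1 x + flat k.+2 x); first exact: dv_flat.
by apply: diffnD => //; apply: diffnM => //; exact: diffn_cst.
Qed.

Lemma flat_ge0 x : 0 <= flat 0 x.
Proof. by rewrite /flat; case: ifP => // _; rewrite mulr_ge0 ?expR_ge0// invr1. Qed.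

Lemma flat_gt0 x : 0 < x -> 0 < flat 0 x.
Proof. by move=> x0; rewrite /flat x0 expr0 invr1 mul1r expR_gt0. Qed.

Lemma flat_le1 x : flat 0 x <= 1.
Proof.
rewrite /flat; case: ifP => // x0; rewrite expr0 invr1 mul1r -[leRHS]expR0 ler_expR.
by rewrite oppr_le0 invr_ge0 ltW.
Qed.

Lemma flat_le0 k x : x <= 0 -> flat k x = 0.
Proof. by move=> x0; rewrite /flat ltNge x0. Qed.

(** A smooth function supported in [[a, b]], which tends to the indicator of the open interval as [m]
grows. *)
Definition bump (m a b : R) x : R := flat 0 (m * (x - a)) * flat 0 (m * (b - x)).

Lemma smooth_bump m a b : smooth (bump m a b).
Proof.
move=> n; apply: diffnM.
  have -> : (fun x => flat 0 (m * (x - a))) = (fun x => flat 0 (m * x + - (m * a))).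
    by apply/funext => x; congr flat; ring.
  by apply: diffn_affine; exact: smooth_flat.
have -> : (fun x => flat 0 (m * (b - x))) = (fun x => flat 0 (- m * x + m * b)).
  by apply/funext => x; congr flat; ring.
by apply: diffn_affine; exact: smooth_flat.
Qed.

Lemma bump_out m a b x : 0 <= m -> ~~ (a < x < b) -> bump m a b x = 0.
Proof.
move=> m0; rewrite negb_and -!leNgt => /orP[xa|bx]; rewrite /bump.
  by rewrite flat_le0 ?mul0r// mulr_ge0_le0// subr_le0.
by rewrite [X in _ * X]flat_le0 ?mulr0// mulr_ge0_le0// subr_le0.
Qed.

Lemma bump_ge0 m a b x : 0 <= bump m a b x.
Proof. by rewrite mulr_ge0 ?flat_ge0. Qed.

Lemma bump_le1 m a b x : bump m a b x <= 1.
Proof. by rewrite mulr_ile1 ?flat_ge0 ?flat_le1. Qed.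

Lemma bump_gt0 m a b x : 0 < m -> a < x < b -> 0 < bump m a b x.
Proof.
by move=> m0 /andP[ax xb]; rewrite mulr_gt0// flat_gt0// mulr_gt0// subr_gt0.
Qed.

Lemma bump_cvg a b x : a < x < b -> bump n.+1%:R a b x @[n --> \oo] --> (1 : R).
Proof.
move=> /andP[ax xb]; have fl (c : R) : 0 < c -> flat 0 (n.+1%:R * c) @[n --> \oo] --> (1 : R).
  move=> c0.
  have -> : (fun n : nat => flat 0 (n.+1%:R * c)) = (fun n => expR (- (harmonic n * c^-1))).
    apply/funext => n; rewrite /flat pmulr_rgt0// c0 expr0 invr1 mul1r /harmonic/= invfM//.
  have h : - (harmonic n * c^-1) @[n --> \oo] --> - (0 * c^-1 : R).
    by apply: cvgN; apply: cvgM; [exact: cvg_harmonic|exact: cvg_cst].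
  rewrite mul0r oppr0 in h; rewrite -[X in _ --> X]expR0.
  exact: (cvg_comp _ _ h (@continuous_expR R 0)).
by rewrite -[X in _ --> X]mulr1; apply: cvgM; apply: fl; rewrite subr_gt0.
Qed.

Lemma test_of_smooth f M : smooth f -> (forall x, M < `|x| -> f x = 0) -> test_function f.
Proof. by move=> sf fM; split; [exact: smooth_derivable|exists M]. Qed.

Lemma smooth_of_test f : test_function f -> smooth f.
Proof.
move=> [df _] n; elim: n f df => // n IH f df; exists (derive1 f).
  by move=> x; rewrite derive1E; apply: DeriveDef => //; exact: (df 0%N).
by apply: IH => k x; rewrite -derive1Sn; exact: df.
Qed.

End Smooth.

(** * The lemma of du Bois-Reymond *)

Section Integral.
Context {R : realType}.
Local Notation mu := (@lebesgue_measure R).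
Implicit Types (f g h F G H w : R -> R) (a b x y M : R).

Definition locint f := forall a b, mu.-integrable `[a, b] (EFin \o f).

Lemma cts_locint f : continuous f -> locint f.
Proof.
move=> cf a b; apply: continuous_compact_integrable; first exact: segment_compact.
exact: continuous_subspaceT.
Qed.

Lemma Rintegral_dv H h a b : continuous h -> dv H h -> a <= b ->
  \int[mu]_(x in `[a, b]) h x = H b - H a.
Proof.
move=> ch dH; rewrite le_eqVlt => /orP[/eqP->|ab].
  by rewrite set_itv1 Rintegral_set1 subrr.
have cH := dv_continuous dH.
rewrite /Rintegral (@continuous_FTC2 R h H a b ab)//.
- exact: continuous_subspaceT.
- split; first by move=> x _; have [] := dH x.
  + by apply: cvg_at_right_filter; exact: cH.
  + by apply: cvg_at_left_filter; exact: cH.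
- by move=> x _; rewrite (dv_derive1 dH).
Qed.

Lemma Rintegral_supp f a b : (forall x, ~~ (a <= x <= b) -> f x = 0) ->
  \int[mu]_x f x = \int[mu]_(x in `[a, b]) f x.
Proof.
move=> f0; rewrite [RHS]Rintegral_mkcond; apply: eq_Rintegral => x _.
rewrite patchE; case: ifPn => //.
by rewrite notin_setE/= in_itv/= => /negP; exact: f0.
Qed.

Lemma locintM w g : locint w -> continuous g -> locint (fun x => w x * g x).
Proof.
move=> lw cg a b; have mw : measurable_fun `[a, b] w.
  by have /integrableP[/measurable_EFinP] := lw a b.
have mg : measurable_fun `[a, b] g by apply: measurable_funTS; exact: continuous_measurable_fun.
have [M hM] : exists M, forall x, a <= x <= b -> `|g x| <= M.
  have [ab|ba] := leP a b; last first.
    exists 0 => x /andP[ax xb]; move: (le_trans ax xb); rewrite leNgt ba//.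
  have cn : {within `[a, b], continuous (fun x => `|g x|)}.
    by apply: continuous_subspaceT => x; apply: (@continuous_comp _ _ _ g (fun y : R => `|y|)); [exact: cg|exact: norm_continuous].
  have [c _ hc] := EVT_max ab cn.
  by exists (`|g c|) => x axb; apply: hc; rewrite in_itv.
have iM : mu.-integrable `[a, b] (fun x => (M%:E * (w x)%:E)%E).
  by apply: integrableZl => //; exact: lw.
apply: (le_integrable _ _ _ iM) => //.
  by apply/measurable_EFinP; exact: measurable_funM.
move=> x; rewrite /= in_itv/= => /hM gM; rewrite lee_fin !normrM mulrC.
by rewrite ler_wpM2r//; apply: le_trans gM (ler_norm _).
Qed.

Lemma locintD w g : locint w -> locint g -> locint (fun x => w x + g x).
Proof.
move=> lw lg a b.
have : mu.-integrable `[a, b] ((EFin \o w) \+ (EFin \o g))%E.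
  by apply: integrableD.
by [].
Qed.

Lemma locintN w : locint w -> locint (fun x => - w x).
Proof.
move=> lw a b; have : mu.-integrable `[a, b] (\- (EFin \o w))%E.
  by apply: integrableN.
by [].
Qed.

Lemma locint_test w (psi : R -> R) : locint w -> test_function psi ->
  mu.-integrable setT (EFin \o (fun x => w x * psi x)).
Proof.
move=> lw tp; have [g /dv_continuous cp _] := smooth_of_test tp 1%N.
have [_ [M hM]] := tp.
have lwp := locintM lw cp.
have : mu.-integrable setT ((EFin \o (fun x => w x * psi x)) \_ `[- M, M]).
  by rewrite -integrable_mkcond//; exact: lwp.
congr (_.-integrable _ _); apply/funext => x; rewrite patchE; case: ifPn => //.
rewrite notin_setE/= in_itv/= -ler_norml => /negP; rewrite -ltNge => /hM /= ->.
by rewrite mulr0.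
Qed.

(** Lebesgue's differentiation theorem for the indefinite integral. *)
Lemma zero_itv_ae w : locint w -> (forall a b, a < b -> \int[mu]_(x in `[a, b]) w x = 0) ->
  {ae mu, forall x, w x = 0}.
Proof.
move=> lw w0.
suff h (n : nat) : {ae mu, forall x, - n%:R < x < n%:R -> w x = 0}.
  have := ae_foralln h; apply: filterS => x hx.
  apply: (hx (Num.truncn `|x|).+1); rewrite -ltr_norml; exact: truncnS_gt.
pose I : set R := [set` `[- n%:R, n%:R]]; pose f := w \_ I.
have fi : mu.-integrable setT (EFin \o f).
  rewrite /f -restrict_EFin -integrable_mkcond; [exact: (lw (- n%:R) n%:R)|exact: measurable_itv].
have fl : locally_integrable setT f by exact: open_integrable_locally openT fi.
have fy (y : R) : mu.-integrable [set` Interval (BLeft (- n%:R)) (BRight y)] (EFin \o f).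
  exact: integrableS fi.
have := FTC1 fy fl; apply: filterS; first exact: (ae_filter_ringOfSetsType mu).
move=> x hx /andP[nx xn].
have [_ e] := hx nx.
have <- : f x = w x.
  by rewrite /f patchE ifT// inE /I/= in_itv/= !ltW.
rewrite -e derive1E (@near_eq_derive _ _ _ _ (cst 0)) ?derive_cst//.
near=> y.
have ny : - n%:R < y by near: y; exact: lt_nbhsr.
have yn : y < n%:R by near: y; exact: lt_nbhsl.
transitivity (\int[mu]_(t in `[- n%:R, y]) w t); last exact: w0.
apply: eq_Rintegral => z; rewrite inE/= in_itv/= => /andP[z1 z2].
by rewrite /f patchE ifT// inE /I/= in_itv/= z1 (le_trans z2)// ltW.
Unshelve. all: by end_near. Qed.

(** Bump functions tend to the indicator of any interval, and the integrals converge by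
domination: all integrals of [w] over intervals vanish. *)
Lemma du_bois_reymond w : locint w ->
  (forall psi, test_function psi -> \int[mu]_x (w x * psi x) = 0) ->
  {ae mu, forall x, w x = 0}.
Proof.
move=> lw h; apply: zero_itv_ae => // a b ab.
pose psi (n : nat) := bump n.+1%:R a b.
have tpsi n : test_function (psi n).
  apply: (@test_of_smooth _ _ (`|a| + `|b|)); first exact: smooth_bump.
  move=> x hx; apply: bump_out => //; apply/negP => /andP[ax xb].
  have := ler_norm b; have := ler_norm (- a); rewrite normrN.
  have := normr_ge0 b; have := normr_ge0 a.
  by case: (ger0P x) hx => _; lra.
have cpsi n : continuous (psi n).
  by have [g dg _] := @smooth_bump R n.+1%:R a b 1%N; exact: dv_continuous dg.
have mw : measurable_fun `[a, b] w by have /integrableP[/measurable_EFinP] := lw a b.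
pose one x : R := if a < x < b then 1 else 0.
have mone : measurable_fun `[a, b] one.
  have -> : one = \1_(`]a, b[ : set R).
    apply/funext => x; rewrite indicE /one; case: ifPn => [axb|/negP axb].
      by rewrite mem_set//= in_itv.
    by rewrite memNset//= in_itv.
  exact: measurable_funTS.
have [|||||i1 _ cv] := @dominated_convergence _ _ _ mu `[a, b]%classic (measurable_itv `[a, b])
   (fun n x => (w x * psi n x)%:E) (fun x => (w x * one x)%:E) (fun x => `|w x|%:E).
- move=> n; apply/measurable_EFinP; apply: measurable_funM => //.
  by apply: measurable_funTS; exact: continuous_measurable_fun.
- by apply/measurable_EFinP; exact: measurable_funM.
- apply: aeW => x _; apply/fine_cvgP; split; first by apply: nearW.
  rewrite /comp/=; apply: cvgM; first exact: cvg_cst.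
  rewrite /one; case: ifPn => axb; first exact: bump_cvg.
  have -> : (fun n => psi n x) = fun=> 0 by apply/funext => n; exact: bump_out.
  exact: cvg_cst.
- have := lw a b => /integrable_norm; by [].
- apply: aeW => x n _; rewrite /= lee_fin normrM ler_piMr// ger0_norm ?bump_ge0//.
  exact: bump_le1.
have lim0 : (\int[mu]_(x in `[a, b]) (w x * one x)%:E = 0)%E.
  have e0 n : (\int[mu]_(x in `[a, b]) (w x * psi n x)%:E = 0)%E.
    have := h _ (tpsi n); rewrite (@Rintegral_supp _ a b); last first.
      move=> x axb; rewrite /psi bump_out ?mulr0//; apply: contra axb => /andP[ax xb].
      by rewrite !ltW.
    rewrite /Rintegral => e; rewrite -[LHS]fineK ?e//.
    apply: integrable_fin_num => //; exact: locintM.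
  have e1 : (fun n => \int[mu]_(x in `[a, b]) (w x * psi n x)%:E)%E = fun=> 0%E.
    by apply/funext => n; exact: e0.
  have := cvg_lim _ cv; rewrite /= e1 => <- //; exact: lim_cst.
have oo : mu.-integrable `]a, b[ (EFin \o w).
  by apply: integrableS (lw a b) => //; exact: subset_itv_oo_cc.
have oo' : mu.-integrable `]a, b[ (EFin \o (fun x => w x * one x)).
  by apply: integrableS i1 => //; exact: subset_itv_oo_cc.
have co g : mu.-integrable `[a, b] (EFin \o g) ->
  \int[mu]_(x in `[a, b]) g x = \int[mu]_(x in `]a, b[) g x.
  move=> ig; rewrite -Rintegral_itv_obnd_cbnd; last first.
    by apply: integrableS ig => //; exact: subset_itv_oc_cc.
  rewrite -Rintegral_itv_bndo_bndc//.
  by apply: integrableS ig => //; exact: subset_itv_oo_cc.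
rewrite co//; transitivity (\int[mu]_(x in `]a, b[) (w x * one x)).
  by apply: eq_Rintegral => x; rewrite inE/= in_itv/= /one => ->; rewrite mulr1.
by rewrite -co// /Rintegral lim0.
Qed.

End Integral.

(** * Weak derivatives *)

Section Weak.
Context {R : realType}.
Local Notation mu := (@lebesgue_measure R).
Implicit Types (f g h F G H w psi phi : R -> R) (a b x y z M : R).

Lemma ae_imply (P Q : R -> Prop) : (forall x, P x -> Q x) ->
  {ae mu, forall x, P x} -> {ae mu, forall x, Q x}.
Proof. by move=> PQ; apply: filterS => //; exact: (ae_filter_ringOfSetsType mu). Qed.

Lemma ae_imply2 (P Q S : R -> Prop) : (forall x, P x -> Q x -> S x) ->
  {ae mu, forall x, P x} -> {ae mu, forall x, Q x} -> {ae mu, forall x, S x}.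
Proof. by move=> PQ; apply: filterS2 => //; exact: (ae_filter_ringOfSetsType mu). Qed.

Lemma dv_flat_itv F f a b : dv F f -> a <= b -> (forall z, a < z < b -> f z = 0) -> F a = F b.
Proof.
move=> dF ab f0; apply/le_anti/andP; split.
  by apply: (dv_le dF _ ab) => z /f0 ->.
have : - F a <= - F b by apply: (dv_le (dvN dF) _ ab) => z /f0 ->; rewrite oppr0.
by rewrite lerN2.
Qed.

Lemma test_cts psi : test_function psi -> continuous psi.
Proof. by move=> tp; have [g dg _] := smooth_of_test tp 1%N; exact: dv_continuous dg. Qed.

Lemma test_dv psi : test_function psi -> dv psi (derive1 psi).
Proof. by move=> tp x; rewrite derive1E; apply: DeriveDef => //; exact: tp.1 0%N x. Qed.

Lemma test_derive psi : test_function psi -> test_function (derive1 psi).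
Proof.
move=> tp; have [_ [M hM]] := tp; apply: (@test_of_smooth _ _ M).
  exact: smooth_dv (smooth_of_test tp) (test_dv tp).
exact: derive1_outside.
Qed.

Lemma test_derive1n n psi : test_function psi -> test_function (derive1n n psi).
Proof. by move=> tp; elim: n => [//|n IH]; rewrite derive1nS; exact: test_derive. Qed.

Lemma test_comb (c : R) phi psi : test_function phi -> test_function psi ->
  test_function (fun x => phi x - c * psi x).
Proof.
move=> tf tg; have [_ [M hM]] := tf; have [_ [N hN]] := tg.
apply: (@test_of_smooth _ _ (Num.max M N)).
  move=> n; have -> : (fun x => phi x - c * psi x) = (fun x => phi x + (- c) * psi x).
    by apply/funext => x; ring.
  apply: diffnD; first exact: smooth_of_test.
  by apply: diffnM; [exact: diffn_cst|exact: smooth_of_test].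
by move=> x; rewrite gt_max => /andP[/hM -> /hN ->]; rewrite mulr0 subrr.
Qed.

Definition mollifier : R -> R := bump 1 (-1) 1.

Lemma test_mollifier : test_function mollifier.
Proof.
apply: (@test_of_smooth _ _ 1); first exact: smooth_bump.
move=> x x1; apply: bump_out => //; rewrite -ltr_norml -leNgt; exact: ltW.
Qed.

Lemma Rint_mollifier_gt0 : 0 < \int[mu]_x mollifier x.
Proof.
rewrite (@Rintegral_supp _ _ (-1) 1); last first.
  by move=> x h; apply: bump_out => //; apply: contra h => /andP[h1 h2]; rewrite !ltW.
have cm := test_cts test_mollifier; have [P dP] := primitive cm.
have N11 : -1 < 1 :> R by lra.
rewrite (Rintegral_dv cm dP (ltW N11)).
have [|c] := @MVT _ P _ _ _ N11 (fun x _ => dP x).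
  by apply: continuous_subspaceT; exact: (dv_continuous dP).
rewrite in_itv/= => cI ->; apply: mulr_gt0; last by rewrite opprK addr_gt0.
exact: bump_gt0.
Qed.

Lemma RintegralB_test w phi psi (c : R) : locint w -> test_function phi -> test_function psi ->
  \int[mu]_x (w x * (phi x - c * psi x)) = \int[mu]_x (w x * phi x) - c * \int[mu]_x (w x * psi x).
Proof.
move=> lw tf tg; rewrite -RintegralZl//; last exact: locint_test.
rewrite -RintegralB//.
- by apply: eq_Rintegral => x _; ring.
- exact: locint_test.
- have : mu.-integrable setT (fun x => (c%:E * (w x * psi x)%:E)%E).
    by apply: integrableZl => //; exact: locint_test.
  by [].
Qed.

Lemma test_primitive psi : test_function psi -> \int[mu]_x psi x = 0 ->
  exists2 E, test_function E & derive1 E = psi.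
Proof.
move=> tp i0; have [_ [M hM]] := tp; have cp := test_cts tp.
have [P dP] := primitive cp.
pose N := `|M| + 1.
have MN : M < N by rewrite /N; have := ler_norm M; lra.
have N0 : 0 <= N by rewrite addr_ge0.
have NN : - N <= N by lra.
have PN : P N = P (- N).
  apply/eqP; rewrite -subr_eq0 -(Rintegral_dv cp dP NN) -Rintegral_supp ?i0//.
  move=> x; rewrite -ler_norml -ltNge => h; apply: hM; exact: lt_trans h.
exists (fun x => P x - P (- N)); last first.
  by apply: dv_derive1; apply: (dv_eq (dvB dP (dv_cst _))) => x; rewrite subr0.
apply: (@test_of_smooth _ _ N).
  apply: (@smooth_primitive _ _ psi); last exact: smooth_of_test.
  by apply: (dv_eq (dvB dP (dv_cst _))) => x; rewrite subr0.
move=> x; rewrite ltr_normr => /orP[h|h].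
  rewrite -PN (dv_flat_itv dP (ltW h)) ?subrr// => z /andP[Nz _]; apply: hM.
  by apply: lt_trans MN _; apply: lt_le_trans Nz (ler_norm _).
have xN : x <= - N by lra.
rewrite (dv_flat_itv dP xN) ?subrr// => z /andP[_ zN]; apply: hM.
by apply: lt_trans MN _; have := ler_norm (- z); rewrite normrN; lra.
Qed.

(** A test function minus the appropriate multiple of a fixed one has integral 0, hence is the
derivative of a test function; so [w] minus a constant is orthogonal to all test functions. *)
Lemma weak_derivative_zero w : locint w ->
  (forall E, test_function E -> \int[mu]_x (w x * derive1 E x) = 0) ->
  exists k, {ae mu, forall x, w x = k}.
Proof.
move=> lw h; pose I := \int[mu]_x mollifier x.
have I0 : I != 0 by rewrite gt_eqF// Rint_mollifier_gt0.
have tm := test_mollifier.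
have l1 : locint (fun=> 1 : R) by apply: cts_locint; exact: cts_cst.
have int1 psi : \int[mu]_x (1 * psi x) = \int[mu]_x psi x.
  by apply: eq_Rintegral => x _; rewrite mul1r.
pose k := \int[mu]_x (w x * mollifier x) / I.
exists k.
suff : {ae mu, forall x, w x + - k = 0} by apply: ae_imply => x; lra.
apply: du_bois_reymond; first by apply: locintD => //; apply: cts_locint; exact: cts_cst.
move=> psi tpsi.
pose c := (\int[mu]_x psi x) / I.
have tc := test_comb c tpsi tm.
have [E tE dE] : exists2 E, test_function E & derive1 E = fun x => psi x - c * mollifier x.
  apply: test_primitive => //.
  rewrite -int1 (RintegralB_test _ l1 tpsi tm) !int1 /c divfK// subrr//.
have := h _ tE; rewrite dE (RintegralB_test _ lw tpsi tm) => e.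
have -> : \int[mu]_x ((w x + - k) * psi x) = \int[mu]_x (w x * psi x) - k * \int[mu]_x psi x.
  have ip : mu.-integrable setT (EFin \o psi).
    have := locint_test l1 tpsi; congr (_.-integrable _ _).
    by apply/funext => x /=; rewrite mul1r.
  rewrite -RintegralZl// -RintegralB//.
  - by apply: eq_Rintegral => x _; ring.
  - exact: locint_test.
  - have : mu.-integrable setT (fun x => (k%:E * (psi x)%:E)%E) by exact: integrableZl.
    by [].
have -> : \int[mu]_x (w x * psi x) = c * \int[mu]_x (w x * mollifier x) by lra.
by rewrite /c /k; field.
Qed.

(** [z exp (- s x)] has zero weak derivative. *)
Lemma weak_exp s (z : R -> R) : locint z ->
  (forall E, test_function E -> \int[mu]_x (z x * (derive1 E x + s * E x)) = 0) ->
  exists k, {ae mu, forall x, z x = k * expR (s * x)}.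
Proof.
move=> lz h.
have ce a : continuous (fun x => expR (a * x)) by exact: (dv_continuous (dv_expl a)).
have [|E tE|k hk] := @weak_derivative_zero (fun x => z x * expR (- s * x)).
- exact: locintM.
- have tf : test_function (fun x => expR (- s * x) * E x).
    have [_ [M hM]] := tE; apply: (@test_of_smooth _ _ M).
      by move=> n; apply: diffnM; [exact: diffn_exp|exact: smooth_of_test].
    by move=> x /hM ->; rewrite mulr0.
  rewrite -[RHS](h _ tf); apply: eq_Rintegral => x _.
  by rewrite (dv_derive1 (dvM (dv_expl (- s)) (test_dv tE))); ring.
exists k; move: hk; apply: ae_imply => x <-.
by rewrite -mulrA -expRD mulNr addNr expR0 mulr1.
Qed.

Lemma weak_deriv_classical f g : dv f g -> continuous g -> weak_deriv 1 f g.
Proof.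
move=> df cg phi tf; rewrite expr1 mulN1r /=.
have cf := dv_continuous df; have [_ [M hM]] := tf.
have dphi := test_dv tf; have cphi := test_cts tf; have cdphi := test_cts (test_derive tf).
pose N := `|M| + 1.
have MN : M < N by rewrite /N; have := ler_norm M; lra.
have N0 : 0 <= N by rewrite addr_ge0.
have NN : - N <= N by lra.
have out x : ~~ (- N <= x <= N) -> M < `|x|.
  by rewrite -ler_norml -ltNge => h; exact: lt_trans h.
rewrite (@Rintegral_supp _ _ (- N) N); last first.
  by move=> x /out /(derive1_outside hM) ->; rewrite mulr0.
rewrite [in RHS](@Rintegral_supp _ _ (- N) N); last by move=> x /out /hM ->; rewrite mulr0.
have [P dP] := primitive (ctsM cf cdphi); have [Q dQ] := primitive (ctsM cg cphi).
rewrite (Rintegral_dv (ctsM cf cdphi) dP NN) (Rintegral_dv (ctsM cg cphi) dQ NN).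
have d0 := dvB (dvM df dphi) (dvD dQ dP).
have e := dv0_cst d0 (fun z => subrr _) N (- N).
have pN : phi N = 0 by apply: hM; rewrite ger0_norm.
have pNN : phi (- N) = 0 by apply: hM; rewrite normrN ger0_norm.
by move: e; rewrite pN pNN; lra.
Qed.

End Weak.

(** * Square-integrable classes *)

Section L2Interface.
Context {R : realType}.
Local Notation mu := (@lebesgue_measure R).
Local Notation L2 := (LfunType mu (lee1n 2)).
Implicit Types (f g h F G H w psi phi : R -> R) (a b x y z M A B : R) (u v : L2).

Lemma L2norm_sqr u : (\int[mu]_x ((u x ^+ 2)%:E) = ((L2norm u) ^+ 2)%:E)%E.
Proof.
have := @powR_Lnorm _ _ _ mu (EFin \o u) 2 _.
rewrite -finite_norm_fine => /(_ (lt0r_neq0 (ltr0Sn _ 1))).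
rewrite poweR_EFin powR_mulrn ?L2norm_ge0// => ->.
by apply: eq_integral => x _; rewrite /= powR_mulrn// real_normK// num_real.
Qed.

Lemma L2_sqr_integrable u : mu.-integrable setT (EFin \o (fun x => u x ^+ 2)).
Proof. by apply: Lfun2_integrable_sqr; exact: LfunP. Qed.

Lemma L2_measurable u : measurable_fun setT (u : R -> R).
Proof. by have := LfunP u; rewrite inE => /andP[+ _]; rewrite inE. Qed.

Lemma L2_locint u : locint u.
Proof.
move=> a b.
have i1 : mu.-integrable `[a, b] (EFin \o (fun x => 1 + u x ^+ 2)).
  have : mu.-integrable `[a, b] ((EFin \o (fun=> 1%R : R)) \+ (EFin \o (fun x => u x ^+ 2)%R))%E.
    apply: integrableD => //.
      by apply: cts_locint; exact: cts_cst.
    by apply: integrableS (L2_sqr_integrable u).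
  by [].
apply: (le_integrable _ _ _ i1) => //.
  by apply/measurable_EFinP; apply: measurable_funTS.
move=> x _; rewrite /= lee_fin [leRHS]ger0_norm ?addr_ge0 ?sqr_ge0//.
by rewrite ler_norml; have := sqr_ge0 (u x - 1); have := sqr_ge0 (u x + 1); have := sqr_ge0 (u x);
  move=> h1 h2 h3; apply/andP; split; nra.
Qed.

Lemma Rintegral_ae_eq f g (D : set R) : measurable D -> measurable_fun D f -> measurable_fun D g ->
  {ae mu, forall x, f x = g x} -> \int[mu]_(x in D) f x = \int[mu]_(x in D) g x.
Proof.
move=> mD mf mg fg; rewrite /Rintegral; congr fine; apply: ae_eq_integral => //.
- exact/measurable_EFinP.
- exact/measurable_EFinP.
- by apply: ae_imply fg => x /= ->.
Qed.

Lemma L2_cts_le u f A : continuous f -> {ae mu, forall x, u x = f x} -> L2norm u <= A -> 0 < A ->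
  L2le f A.
Proof.
move=> cf uf uA A0; apply: L2leP => // F dF x y xy.
rewrite -(Rintegral_dv (@ctsX _ _ 2 cf) dF xy).
have -> : \int[mu]_(t in `[x, y]) (f t ^+ 2) = \int[mu]_(t in `[x, y]) (u t ^+ 2).
  apply: Rintegral_ae_eq => //.
  - by apply: measurable_funTS; apply: continuous_measurable_fun; exact: ctsX.
  - by apply: measurable_funTS; apply: measurable_funX; exact: L2_measurable.
  - by apply: ae_imply uf => t ->.
have h : (\int[mu]_(t in `[x, y]) (u t ^+ 2)%:E <= ((L2norm u) ^+ 2)%:E)%E.
  rewrite -L2norm_sqr; apply: ge0_subset_integral => //.
    by apply/measurable_EFinP; apply: measurable_funX; exact: L2_measurable.
  by move=> t _; rewrite lee_fin sqr_ge0.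
have f0 : (0 <= \int[mu]_(t in `[x, y]) (u t ^+ 2)%:E)%E.
  by apply: integral_ge0 => t _; rewrite lee_fin sqr_ge0.
rewrite /Rintegral; apply: (@le_trans _ _ (L2norm u ^+ 2)).
  rewrite -lee_fin fineK//.
  rewrite ge0_fin_numE//; apply: le_lt_trans h _; exact: ltry.
by rewrite ler_sqr ?nnegrE ?L2norm_ge0// ltW.
Qed.

(** Monotone convergence along the intervals [[- n, n]]. *)
Lemma L2le_integral f A : L2le f A -> (\int[mu]_x (f x ^+ 2)%:E <= (A ^+ 2)%:E)%E.
Proof.
move=> [A0 cf [F dF hF]]; have c2 := @ctsX _ _ 2 cf.
pose I (n : nat) : set R := [set` `[- n%:R, n%:R]].
have UI : \bigcup_n I n = setT.
  apply/seteqP; split => // x _; exists (Num.truncn `|x|).+1 => //=.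
  rewrite /I/= in_itv/= -ler_norml ltW//; exact: truncnS_gt.
have : (\int[mu]_(x in I i) (f x ^+ 2)%:E)%E @[i --> \oo] --> (\int[mu]_(x in \bigcup_i I i) (f x ^+ 2)%:E)%E.
  apply: ge0_nondecreasing_set_cvg_integral.
  - move=> m n mn; apply/subsetPset; apply: subset_itv; rewrite bnd_simp ?lerN2 ler_nat//.
  - by move=> n; exact: measurable_itv.
  - move=> n; apply/measurable_EFinP; apply: measurable_funTS; exact: continuous_measurable_fun.
  - by move=> n x _; rewrite lee_fin sqr_ge0.
rewrite UI => cvI; rewrite -(cvg_lim _ cvI)//; apply: lime_le.
  by apply/cvg_ex; eexists; exact: cvI.
apply: nearW => n.
have nn : - n%:R <= n%:R :> R by have := ler0n R n; lra.
have := Rintegral_dv c2 dF nn; rewrite /Rintegral => e.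
have fin : (\int[mu]_(x in I n) (f x ^+ 2)%:E)%E \is a fin_num.
  by apply: integrable_fin_num; [exact: measurable_itv|exact: (cts_locint c2)].
by rewrite -[leLHS]fineK// lee_fin /I e.
Qed.

Lemma L2le_Lfun f A : L2le f A -> (f : measurableTypeR R -> R) \in Lfun mu 2.
Proof.
move=> fA; have h := L2le_integral fA; have [A0 cf _] := fA.
rewrite inE; apply/andP; split; rewrite inE/=.
  exact: continuous_measurable_fun.
rewrite /finite_norm unlock poweR_lty//.
apply: le_lt_trans (ltry (A ^+ 2)); apply: le_trans h; rewrite le_eqVlt; apply/orP; left.
by apply/eqP; apply: eq_integral => x _; rewrite /= powR_mulrn// real_normK// num_real.
Qed.

Lemma L2le_norm u f A : L2le f A -> {ae mu, forall x, u x = f x} -> L2norm u <= A.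
Proof.
move=> fA uf; have [A0 cf _] := fA.
have : (((L2norm u) ^+ 2)%:E <= (A ^+ 2)%:E)%E.
  rewrite -L2norm_sqr; apply: le_trans (L2le_integral fA).
  rewrite le_eqVlt; apply/orP; left; apply/eqP; apply: ae_eq_integral => //.
  - by apply/measurable_EFinP; apply: measurable_funX; exact: L2_measurable.
  - by apply/measurable_EFinP; apply: continuous_measurable_fun; exact: ctsX.
  - by apply: ae_imply uf => x /= ->.
by rewrite lee_fin ler_sqr ?nnegrE ?L2norm_ge0// ltW.
Qed.

(** Nonzero multiples of [exp (s x)] are not square-integrable. *)
Lemma weak_exp0 s u : s != 0 -> weak_deriv 1 u (fun x => s * u x) -> {ae mu, forall x, u x = 0}.
Proof.
move=> s0 wu; have [|k hk] := @weak_exp R s u (@L2_locint u).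
  move=> E tE; have := wu E tE; rewrite expr1 mulN1r /= => e.
  have lu := @L2_locint u.
  have -> : \int[mu]_x (u x * (derive1 E x + s * E x)) = \int[mu]_x (u x * (derive1 E x - (- s) * E x)).
    by apply: eq_Rintegral => x _; ring.
  rewrite (RintegralB_test _ lu (test_derive tE) tE) e.
  have -> : \int[mu]_x (s * u x * E x) = s * \int[mu]_x (u x * E x).
    rewrite -RintegralZl//; last exact: locint_test.
    by apply: eq_Rintegral => x _; ring.
  ring.
suff k0 : k = 0 by apply: ae_imply hk => x ->; rewrite k0 mul0r.
have A0 : 0 < L2norm u + 1 by rewrite ltr_wpDl// L2norm_ge0.
have cf : continuous (fun x => k * expR (s * x)).
  by apply: ctsM; [exact: cts_cst|exact: (dv_continuous (dv_expl s))].
have uA : L2norm u <= L2norm u + 1 by rewrite lerDl.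
have Lf := L2_cts_le cf hk uA A0.
have dF : dv (fun x => k ^+ 2 / (2 * s) * expR (2 * s * x)) (fun x => (k * expR (s * x)) ^+ 2).
  apply: (dv_eq (dvM (dv_cst _) (dv_expl (2 * s)))) => x.
  rewrite exprMn -expRM_natl.
  have -> : 2%:R * (s * x) = 2 * s * x by ring.
  by field.
have hF := L2le_prim Lf dF; set A := L2norm u + 1 in A0 hF.
apply/eqP; rewrite -sqrf_eq0 eq_le sqr_ge0 andbT.
apply/ler_addgt0Pr => e e0; rewrite add0r.
(* The square of k exp (s x) has a primitive proportional to exp (2 s x): with this t its increment
   between 0 and t / s exceeds any bound unless k vanishes. *)
pose t := `|s| * A ^+ 2 / e.
have t0 : 0 <= t by rewrite divr_ge0 ?mulr_ge0 ?sqr_ge0// ltW.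
have ex : 1 + 2 * t <= expR (2 * t) by exact: expR_ge1Dx.
have e2 : expR (2 * s * (t / s)) = expR (2 * t) by congr expR; field.
have key : k ^+ 2 / (2 * `|s|) * (expR (2 * t) - 1) <= A ^+ 2.
  have [sp|sn] := ltP 0 s.
    rewrite (gtr0_norm sp) mulrBr; have := hF 0 (t / s); rewrite mulr0 expR0 e2; lra.
  have := hF (t / s) 0; rewrite mulr0 expR0 e2 => h; apply: le_trans h.
  rewrite (ler0_norm sn).
  have -> : k ^+ 2 / (2 * - s) = - (k ^+ 2 / (2 * s)) by field.
  lra.
have sp : 0 < `|s| by rewrite normr_gt0.
have k2 := sqr_ge0 k.
have h1 : k ^+ 2 / (2 * `|s|) * (2 * t) <= A ^+ 2.
  apply: le_trans key; apply: ler_wpM2l; last lra.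
  by rewrite divr_ge0// mulr_ge0// ltW.
have -> : e = e / A ^+ 2 * A ^+ 2 by field; rewrite gt_eqF.
have -> : k ^+ 2 = e / A ^+ 2 * (k ^+ 2 / (2 * `|s|) * (2 * t)).
  by rewrite /t; field; rewrite !gt_eqF.
by apply: ler_wpM2l => //; rewrite divr_ge0 ?sqr_ge0// ltW.
Qed.

Lemma weak_deriv_shift k (u0 uk uk1 : R -> R) : weak_deriv k u0 uk -> weak_deriv k.+1 u0 uk1 ->
  weak_deriv 1 uk uk1.
Proof.
move=> wk wk1 phi tf; rewrite expr1 mulN1r /=.
have := wk _ (test_derive tf); have := wk1 _ tf.
rewrite derive1Sn => ->; rewrite exprS -mulrA => e.
have /eqP := e; rewrite mulrCA (inj_eq (mulfI _)) ?expf_neq0 ?oppr_eq0 ?oner_eq0//.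
by rewrite mulN1r => /eqP ->.
Qed.

Lemma weak_deriv_null k u v : weak_deriv k u v -> {ae mu, forall x, u x = 0} ->
  {ae mu, forall x, v x = 0}.
Proof.
move=> w u0; apply: du_bois_reymond; first exact: L2_locint.
move=> psi tp; have := w _ tp.
have -> : \int[mu]_x (u x * derive1n k psi x) = 0.
  have -> : \int[mu]_x (u x * derive1n k psi x) = \int[mu]_x (0 : R).
    apply: Rintegral_ae_eq => //.
      apply: measurable_funM; first exact: L2_measurable.
      by apply: continuous_measurable_fun; apply: test_cts; exact: test_derive1n.
    by apply: ae_imply u0 => x ->; rewrite mul0r.
  by rewrite Rintegral_cst// mul0r.
by move=> /esym/eqP; rewrite mulf_eq0 expf_eq0 oppr_eq0 oner_eq0 andbF => /eqP.
Qed.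

End L2Interface.

(** * Continuous representatives *)

Section H1.
Context {R : realType}.
Local Notation mu := (@lebesgue_measure R).
Local Notation L2 := (LfunType mu (lee1n 2)).
Implicit Types (f g h F G H w psi phi : R -> R) (a b c x y z M A B : R).

Lemma Rintegral_split f a b c : locint f -> a <= b -> b <= c ->
  \int[mu]_(x in `[a, c]) f x = \int[mu]_(x in `[a, b]) f x + \int[mu]_(x in `[b, c]) f x.
Proof.
move=> lf ab bc; have := @Rintegral_itvB R f (BLeft a) (BRight c) b (lf a c).
rewrite !bnd_simp => /(_ ab bc) e.
apply/eqP; rewrite addrC -subr_eq; apply/eqP.
by rewrite e Rintegral_itv_obnd_cbnd//; apply: integrableS (lf b c) => //; exact: subset_itv_oc_cc.
Qed.

Lemma integral_itvD f g a b : locint f -> locint g ->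
  \int[mu]_(x in `[a, b]) (f x + g x) = \int[mu]_(x in `[a, b]) f x + \int[mu]_(x in `[a, b]) g x.
Proof. by move=> lf lg; rewrite RintegralD. Qed.

Lemma integral_itvB f g a b : locint f -> locint g ->
  \int[mu]_(x in `[a, b]) (f x - g x) = \int[mu]_(x in `[a, b]) f x - \int[mu]_(x in `[a, b]) g x.
Proof. by move=> lf lg; rewrite RintegralB. Qed.

Lemma integral_itvZ f a b c : locint f ->
  \int[mu]_(x in `[a, b]) (c * f x) = c * \int[mu]_(x in `[a, b]) f x.
Proof. by move=> lf; rewrite RintegralZl. Qed.

Lemma indefinite_integral f : locint f ->
  exists V, forall a b, a <= b -> V b - V a = \int[mu]_(x in `[a, b]) f x.
Proof.
move=> lf; pose I a b := \int[mu]_(t in `[a, b]) f t.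
exists (fun x => I (- (`|x| + 1)) x - I (- (`|x| + 1)) 0) => a b ab.
pose M := `|a| + `|b| + 1.
have e x : `|x| + 1 <= M -> I (- (`|x| + 1)) x - I (- (`|x| + 1)) 0 = I (- M) x - I (- M) 0.
  move=> xM.
  have h1 : - (`|x| + 1) <= x by have := ler_norm (- x); rewrite normrN; lra.
  have h2 : - M <= - (`|x| + 1) by lra.
  have h3 : - (`|x| + 1) <= 0 by have := normr_ge0 x; lra.
  by rewrite /I (Rintegral_split lf h2 h1) (Rintegral_split lf h2 h3); ring.
have na := normr_ge0 a; have nb := normr_ge0 b.
rewrite (e a) ?(e b); [|rewrite /M; lra|rewrite /M; lra].
have h1 : - M <= a by rewrite /M; have := ler_norm (- a); rewrite normrN; lra.
by rewrite /I (Rintegral_split lf h1 ab); ring.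
Qed.

Lemma Rintegral_norm_le f h a b : locint f -> locint h -> (forall x, a <= x <= b -> `|f x| <= h x) ->
  `|\int[mu]_(x in `[a, b]) f x| <= \int[mu]_(x in `[a, b]) h x.
Proof.
move=> lf lh fh; apply: le_trans (le_normr_Rintegral _ (lf a b)) _ => //.
apply: le_Rintegral => //.
- by have := integrable_norm (lf a b).
Qed.

Lemma cst_integral (k : R) a b : a <= b -> \int[mu]_(x in `[a, b]) k = k * (b - a).
Proof.
move=> ab; have d : dv (fun x => k * x) (fun=> k).
  by apply: (dv_eq (dvM (dv_cst k) dv_id)) => x; ring.
by rewrite (Rintegral_dv (@cts_cst _ k) d ab) mulrBr.
Qed.

(** The Cauchy-Schwarz inequality in the form of Young, with the parameter [lam] left free: small
intervals need a large one ([indefinite_continuous]), unit intervals [lam = A] ([H1_continuous]). *)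
Lemma L2_indefinite (g : L2) V lam a b : (forall a b, a <= b -> V b - V a = \int[mu]_(x in `[a, b]) g x) ->
  0 < lam -> a <= b -> `|V b - V a| <= lam / 2 * (b - a) + (L2norm g) ^+ 2 / (2 * lam).
Proof.
move=> hV l0 ab; rewrite hV//.
have lg2 : locint (fun x => (2 * lam)^-1 * g x ^+ 2).
  move=> c d; have : mu.-integrable `[c, d] (fun x => ((2 * lam)^-1%:E * (g x ^+ 2)%:E)%E).
    apply: integrableZl; first exact: measurable_itv.
    by apply: integrableS (L2_sqr_integrable g) => //.
  by [].
have lc : locint (fun _ : R => lam / 2) by apply: cts_locint; exact: cts_cst.
have lh := locintD lc lg2.
apply: le_trans (@Rintegral_norm_le _ _ a b (@L2_locint _ g) lh _) _.
  move=> x _; have i0 : 0 <= (2 * lam)^-1 by rewrite invr_ge0 mulr_ge0// ltW.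
  have h1 := mulr_ge0 i0 (sqr_ge0 (lam - g x)); have h2 := mulr_ge0 i0 (sqr_ge0 (lam + g x)).
  have e1 : (2 * lam)^-1 * (lam - g x) ^+ 2 = lam / 2 + (2 * lam)^-1 * g x ^+ 2 - g x by field; rewrite gt_eqF.
  have e2 : (2 * lam)^-1 * (lam + g x) ^+ 2 = lam / 2 + (2 * lam)^-1 * g x ^+ 2 + g x by field; rewrite gt_eqF.
  by rewrite ler_norml; apply/andP; split; lra.
rewrite RintegralD//.
rewrite cst_integral//; apply: lerD => //.
rewrite RintegralZl//; last by apply: integrableS (L2_sqr_integrable g).
rewrite [leRHS]mulrC; apply: ler_wpM2l; first by rewrite invr_ge0 mulr_ge0// ltW.
have ii : mu.-integrable `[a, b] (EFin \o (fun x => g x ^+ 2)).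
  by apply: integrableS (L2_sqr_integrable g) => //.
rewrite /Rintegral -lee_fin fineK ?integrable_fin_num//.
rewrite -L2norm_sqr; apply: ge0_subset_integral => //.
- by apply/measurable_EFinP; apply: measurable_funX; exact: L2_measurable.
- by move=> x _; rewrite lee_fin sqr_ge0.
Qed.

Lemma indefinite_continuous (g : L2) V : (forall a b, a <= b -> V b - V a = \int[mu]_(x in `[a, b]) g x) ->
  continuous V.
Proof.
move=> hV x; apply/cvgrPdist_le => e e0.
pose G := L2norm g ^+ 2; have G0 : 0 <= G by exact: sqr_ge0.
pose lam := G / e + 1; have l0 : 0 < lam by rewrite ltr_wpDl// divr_ge0// ltW.
near=> y.
have key a b : a <= b -> b - a <= e / lam -> `|V b - V a| <= e.
  move=> ab h; apply: le_trans (L2_indefinite hV l0 ab) _.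
  have h1 : lam / 2 * (b - a) <= e / 2.
    have -> : e / 2 = lam / 2 * (e / lam) by field; rewrite gt_eqF.
    by rewrite ler_pM2l// divr_gt0.
  have h2 : G / (2 * lam) <= e / 2.
    rewrite ler_pdivrMr ?mulr_gt0//.
    have -> : e / 2 * (2 * lam) = G + e by rewrite /lam; field; rewrite gt_eqF.
    lra.
  by rewrite -/G; lra.
have yx : `|x - y| <= e / lam.
  near: y; apply/nbhs_ballP; exists (e / lam); first by rewrite /= divr_gt0.
  by move=> z; rewrite /ball /= => /ltW.
have [xy|/ltW xy] := leP x y.
  by rewrite distrC; apply: key => //; move: yx; rewrite distrC ger0_norm ?subr_ge0.
by apply: key => //; move: yx; rewrite ger0_norm ?subr_ge0.
Unshelve. all: by end_near. Qed.


Lemma L1_approx f a b e : locint f -> 0 < e ->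
  exists2 h, continuous h & \int[mu]_(x in `[a, b]) `|f x - h x| <= e.
Proof.
move=> lf e0; have fin : (mu `[a, b] < +oo)%E.
  by rewrite lebesgue_measure_itv/=; case: ifP => _; rewrite -?EFinB ltry.
have [h [ch ih /fine_cvgP[_ /cvgrPdist_le/(_ _ e0)[n _ /(_ n (leqnn n))]]]] :=
  approximation_continuous_integrable (measurable_itv _) fin (lf a b).
rewrite /= sub0r normrN => hn; exists (h n) => //.
by apply: le_trans hn; exact: ler_norm.
Qed.

Lemma test_bounded psi : test_function psi -> exists D, forall x, `|psi x| <= D.
Proof.
move=> tp; have cp := test_cts tp; have [_ [M hM]] := tp.
have MM : - `|M| <= `|M| by have := normr_ge0 M; lra.
have cn : {within `[- `|M|, `|M|], continuous (fun x => `|psi x|)}.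
  by apply: continuous_subspaceT => x; apply: cvg_norm; exact: cp.
have [c _ hc] := EVT_max MM cn.
exists `|psi c| => x; have [xM|Mx] := leP `|x| `|M|.
  by apply: hc; rewrite in_itv /= -ler_norml.
by rewrite hM ?normr0//; apply: le_lt_trans Mx; exact: ler_norm.
Qed.

(** Approximating [g] in L^1 of an interval by continuous functions, whose primitives are classically
differentiable and approach [V] uniformly on that interval. *)
Lemma weak_deriv_indefinite g V : locint g -> continuous V ->
  (forall a b, a <= b -> V b - V a = \int[mu]_(x in `[a, b]) g x) -> weak_deriv 1 V g.
Proof.
move=> lg cV hV psi tp; rewrite expr1 mulN1r /=.
have [_ [M hM]] := tp; have cp := test_cts tp; have cdp := test_cts (test_derive tp).
pose N := `|M| + 1.
have MN : M < N by rewrite /N; have := ler_norm M; lra.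
have N0 : 0 < N by rewrite ltr_wpDl.
have NN : - N <= N by lra.
have out x : ~~ (- N <= x <= N) -> M < `|x|.
  by rewrite -ler_norml -ltNge => h; exact: lt_trans h.
have sd F : \int[mu]_x (F x * derive1 psi x) = \int[mu]_(x in `[- N, N]) (F x * derive1 psi x).
  by apply: Rintegral_supp => x /out /(derive1_outside hM) ->; rewrite mulr0.
have sp F : \int[mu]_x (F x * psi x) = \int[mu]_(x in `[- N, N]) (F x * psi x).
  by apply: Rintegral_supp => x /out /hM ->; rewrite mulr0.
have [D1 hD1] := test_bounded (test_derive tp); have [D2 hD2] := test_bounded tp.
have D10 : 0 <= D1 by apply: le_trans (hD1 0).
have D20 : 0 <= D2 by apply: le_trans (hD2 0).
have lV := cts_locint cV.
apply/eqP; rewrite -subr_eq0 opprK -normr_le0; apply/ler_addgt0Pr => e e0; rewrite add0r.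
pose d := e / (D1 * (2 * N) + D2 + 1).
have q0 : 0 < D1 * (2 * N) + D2 + 1.
  by rewrite ltr_wpDl// addr_ge0// mulr_ge0// mulr_ge0// ltW.
have d0 : 0 < d by rewrite divr_gt0.
have [h ch hd] := L1_approx (- N) N lg d0.
have [P dP] := primitive ch.
pose P0 x := P x + (V (- N) - P (- N)).
have dP0 : dv P0 h by apply: (dv_eq (dvD dP (dv_cst _))) => x; rewrite addr0.
have cP0 := dv_continuous dP0.
have lgh : locint (fun x => g x - h x) by apply: locintD => //; apply: locintN; exact: cts_locint.
have lngh : locint (fun x => `|g x - h x|) by move=> x y; exact: (integrable_norm (lgh x y)).
have VP x : - N <= x <= N -> `|V x - P0 x| <= d.
  move=> /andP[x1 x2].
  have -> : V x - P0 x = \int[mu]_(t in `[- N, x]) (g t - h t).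
    rewrite (integral_itvB _ _ lg (cts_locint ch)).
    by rewrite -hV// (Rintegral_dv ch dP x1) /P0; ring.
  apply: le_trans hd.
  apply: le_trans (@Rintegral_norm_le _ (fun t => `|g t - h t|) _ _ lgh lngh (fun _ _ => lexx _)) _.
  rewrite (Rintegral_split lngh x1 x2) lerDl; exact: Rintegral_ge0.
have := weak_deriv_classical dP0 ch tp; rewrite expr1 mulN1r /= => /eqP; rewrite -subr_eq0 opprK => /eqP e1.
have lVd := locintM lV cdp; have lgd := locintM lg cp.
have lPd := locintM (cts_locint cP0) cdp; have lhd := locintM (cts_locint ch) cp.
have -> : \int[mu]_x (V x * derive1 psi x) + \int[mu]_x (g x * psi x) =
    \int[mu]_(x in `[- N, N]) ((V x - P0 x) * derive1 psi x + (g x - h x) * psi x).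
  rewrite -[LHS]subr0 -[X in _ - X]e1 !sd !sp.
  have lD := locintD lVd lgd; have lE := locintD lPd lhd.
  rewrite -(integral_itvD _ _ lVd lgd) -(integral_itvD _ _ lPd lhd) -(integral_itvB _ _ lD lE).
  by apply: eq_Rintegral => x _; ring.
have lc : locint (fun _ : R => D1 * d) by apply: cts_locint; exact: cts_cst.
have lDn : locint (fun x => D2 * `|g x - h x|).
  have -> : (fun x => D2 * `|g x - h x|) = (fun x => `|g x - h x| * D2).
    by apply/funext => x; rewrite mulrC.
  exact: locintM lngh (@cts_cst R D2).
apply: le_trans (@Rintegral_norm_le _ (fun x => D1 * d + D2 * `|g x - h x|) _ _ _ _ _) _.
- by apply: locintD; apply: locintM => //; apply: locintD => //; apply: locintN; exact: cts_locint.
- exact: locintD.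
- move=> x hx; apply: le_trans (ler_normD _ _) _; rewrite !normrM; apply: lerD.
    by rewrite mulrC; apply: ler_pM => //; exact: VP.
  by rewrite mulrC; apply: ler_pM.
rewrite (integral_itvD _ _ lc lDn) cst_integral// (integral_itvZ _ _ _ lngh).
apply: (@le_trans _ _ (D1 * d * (N - - N) + D2 * d)).
  by rewrite lerD2l; exact: ler_wpM2l.
have -> : e = d * (D1 * (2 * N) + D2 + 1) by rewrite /d; field; rewrite gt_eqF.
lra.
Qed.

(** [u] differs from the indefinite integral of [g] by a constant. For the bound, the mean value theorem
gives a point of [[x, x + 1]] where [|f| <= A], and [f] oscillates by at most [A] on this interval. *)
Lemma H1_continuous (u g : L2) : weak_deriv 1 u g ->
  exists f, [/\ continuous f, {ae mu, forall x, u x = f x} &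
    forall A, 0 < A -> L2norm u <= A -> L2norm g <= A -> forall x, `|f x| <= 2 * A].
Proof.
move=> wg; have [V hV] := indefinite_integral (@L2_locint _ g).
have cV := indefinite_continuous hV; have lV := cts_locint cV.
have lu := @L2_locint _ u.
have wV := weak_deriv_indefinite (@L2_locint _ g) cV hV.
have [|E tE|k hk] := @weak_derivative_zero _ (fun x => u x - V x).
- by apply: locintD => //; exact: locintN.
- have e : \int[mu]_x ((u x - V x) * derive1 E x) =
    \int[mu]_x (u x * derive1 E x) - \int[mu]_x (V x * derive1 E x).
    rewrite -RintegralB//; [|exact: locint_test lu (test_derive tE)|exact: locint_test lV (test_derive tE)].
    by apply: eq_Rintegral => x _; ring.
  by have := wg _ tE; have := wV _ tE; rewrite /= e => -> ->; rewrite subrr.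
pose f x := V x + k; exists f.
have cf : continuous f by apply: ctsD => //; exact: cts_cst.
have uf : {ae mu, forall x, u x = f x}.
  by apply: ae_imply hk => x /eqP; rewrite subr_eq addrC => /eqP.
split=> // A A0 uA gA x.
have hf a b : a <= b -> f b - f a = \int[mu]_(t in `[a, b]) g t.
  by move=> ab; rewrite -hV// /f; ring.
have Lf := L2_cts_le cf uf uA A0.
have [_ _ [F dF hF]] := Lf.
have [y [yx hy]] : exists y, x <= y <= x + 1 /\ `|f y| <= A.
  have [y yi e] : exists2 y, y \in `]x, (x + 1)[%R & F (x + 1) - F x = f y ^+ 2 * (x + 1 - x).
    apply: (@MVT _ F (fun t => f t ^+ 2)); first by rewrite ltrDl.
      by move=> t _; exact: dF.
    by apply: continuous_subspaceT; exact: dv_continuous dF.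
  exists y; move: yi; rewrite in_itv /= => /andP[y1 y2]; split; first by rewrite !ltW.
  have := hF x (x + 1); rewrite e addrAC subrr add0r mulr1 => h.
  by rewrite -ler_sqr ?nnegrE ?normr_ge0 ?(ltW A0)// real_normK// num_real.
move/andP: yx => [xy yx].
have := L2_indefinite hf A0 xy => h.
have h2 : L2norm g ^+ 2 / (2 * A) <= A / 2.
  rewrite ler_pdivrMr ?mulr_gt0//; have : L2norm g ^+ 2 <= A ^+ 2.
    by rewrite ler_sqr ?nnegrE ?L2norm_ge0 ?(ltW A0).
  by lra.
have h3 : A / 2 * (y - x) <= A / 2 by rewrite ler_piMr ?divr_ge0 ?(ltW A0)//; lra.
have -> : f x = f y - (f y - f x) by ring.
apply: le_trans (ler_normB _ _) _; lra.
Qed.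

End H1.

(** * Elements of the Sobolev space and chains of derivatives *)

Section Sobolev.
Context {R : realType}.
Local Notation mu := (@lebesgue_measure R).
Local Notation L2 := (LfunType mu (lee1n 2)).
Local Notation H4 := (sobolev R 4).
Implicit Types (f g : R -> R) (us vs : nat -> R -> R) (a x y A : R) (U V : H4).

(** [U] is the class of [us 0], and its weak derivatives are the classes of the other functions. *)
Definition rep U us := forall k : 'I_5, {ae mu, forall x, weak_derivative k U x = us k x}.

Lemma pi_jet_ae (u v : jet R 4) : (\pi_(H4) u)%qT = (\pi_(H4) v)%qT ->
  forall k, {ae mu, forall x, jet_val u k x = jet_val v k x}.
Proof.
move=> /pi_sobolevP/asboolP h k; apply: ae_imply (h k) => x /(_ I); rewrite !ffunE => e; apply/eqP; rewrite -subr_eq0; apply/eqP; exact: e.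
Qed.

Lemma repr_pi_ae (u : jet R 4) k : {ae mu, forall x, weak_derivative k (\pi_(H4) u)%qT x = jet_val u k x}.
Proof. by apply: pi_jet_ae; rewrite reprK. Qed.

Lemma weak_deriv_component U (k : 'I_5) : weak_deriv k (sobolev_fun U) (weak_derivative k U).
Proof. by have /asboolP/(_ k) := jetP (repr U). Qed.

Lemma rep_uniq U V us : rep U us -> rep V us -> U = V.
Proof.
move=> hU hV; rewrite -[U]reprK -[V]reprK; apply/pi_sobolevP/asboolP => k.
have := ae_imply2 (S := fun x => jet_val (repr U) k x = jet_val (repr V) k x) _ (hU k) (hV k).
move=> h; apply: ae_imply (h _).
- by move=> x e _; rewrite !ffunE; apply: (etrans _ (subrr (jet_val (repr V) k x))); rewrite -[X in _ = X - _]e.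
- by move=> x; rewrite /weak_derivative => -> ->.
Qed.

Lemma rep_lin a U V us vs : rep U us -> rep V vs -> rep (a *: U + V) (fun k x => a * us k x + vs k x).
Proof.
move=> hU hV k.
have e : (\pi_(H4) (repr (a *: U + V)) = \pi_(H4) (a *: repr U + repr V))%qT.
  by rewrite reprK pi_sobolevD pi_sobolevZ !reprK.
have h := pi_jet_ae e k; have h2 := ae_imply2 (S := fun x => a * weak_derivative k U x + weak_derivative k V x =
  a * us k x + vs k x) (fun x e1 e2 => congr2 (fun s t => a * s + t) e1 e2) (hU k) (hV k).
apply: ae_imply2 h h2 => x h1 h2; rewrite /weak_derivative h1 -h2 !ffunE; exact: erefl.
Qed.

Lemma component_norm U k : L2norm (jet_val (repr U) k) <= `|U|.
Proof.
rewrite /Num.Def.normr /= /sobolev_norm /jet_norm /l2norm.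
rewrite -[leLHS]ger0_norm ?L2norm_ge0// -sqrtr_sqr ler_wsqrtr// (bigD1 k)//= lerDl.
by apply: sumr_ge0 => i _; exact: sqr_ge0.
Qed.

Lemma rep_norm U us A : rep U us -> H4le us A -> `|U| <= 3 * A.
Proof.
move=> hU [_ _ uL].
have A0 : 0 < A by have [] := uL 0%N isT.
have h : l2norm (fun k : 'I_5 => L2norm (jet_val (repr U) k)) <= l2norm (fun k : 'I_5 => A).
  apply: ler_l2norm => k; rewrite L2norm_ge0 /=; apply: L2le_norm (uL k (ltn_ord k)) _; exact: hU.
apply: le_trans h _; rewrite /l2norm sumr_const card_ord.
rewrite -[leRHS]ger0_norm; last by rewrite mulr_ge0// ltW.
rewrite -sqrtr_sqr ler_wsqrtr//; have := sqr_ge0 A; rewrite -mulr_natr exprMn; lra.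
Qed.

Lemma chain_weak us : chain us -> continuous (us 4%N) -> forall k, (k < 5)%N -> weak_deriv k (us 0%N) (us k).
Proof.
move=> cu c4; have cts k : (k < 5)%N -> continuous (us k).
  rewrite ltnS leq_eqVlt => /orP[/eqP -> //|k4]; exact: dv_continuous (cu k k4).
elim=> [_ phi tp|k IH k5]; first by rewrite expr0 mul1r.
move=> phi tp; rewrite derive1Sn; rewrite (IH (ltnW k5) _ (test_derive tp)).
have /= -> := weak_deriv_classical (cu k k5) (cts _ k5) tp.
by rewrite expr1 exprSr -!mulrA.
Qed.

Lemma rep_exists us A : H4le us A -> exists U, rep U us.
Proof.
move=> [cu _ uL].
have L k (k5 : (k < 5)%N) := L2le_Lfun (uL k k5).
pose v : {ffun 'I_5 -> L2} := [ffun k : 'I_5 => Lfun_Sub (lee1n 2) (L k (ltn_ord k))].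
have jv : v \in @jet_pred R 4.
  apply/asboolP => k; rewrite !ffunE; apply: chain_weak cu _ k (ltn_ord k).
  by have [] := uL 4%N isT.
exists (\pi_(H4) (Jet jv))%qT => k.
by apply: ae_imply (repr_pi_ae (Jet jv) k) => x ->; rewrite /= ffunE.
Qed.

(** Weak derivatives are unique, so the jet is null as soon as its first component is. *)
Lemma sobolev_fun_null U : {ae mu, forall x, sobolev_fun U x = 0} -> U = 0.
Proof.
move=> h; rewrite -[U]reprK.
transitivity (\pi_(H4) (0 : jet R 4))%qT; last exact: (@raddf0 _ _ (\pi_(Quotient.quot (null_jet (R := R) (m:=4))))%qT).
apply/pi_sobolevP; rewrite subr0; apply/asboolP => k.
have := weak_deriv_null (weak_deriv_component U k) h.
by apply: ae_imply => x e _; exact: e.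
Qed.

(** Lebesgue measure is invariant under reflection. *)
Lemma ae_opp (P : R -> Prop) : {ae mu, forall x, P x} -> {ae mu, forall x, P (- x)}.
Proof.
move=> [B [mB B0 PB]]; exists (-%R @^-1` B); split.
- by rewrite -[X in measurable X]setTI; apply: oppr_measurable.
- by have := lebesgue_measureN mB; rewrite /pushforward B0.
- by move=> x /= nP; exact: PB.
Qed.

Lemma cts_ae_eq f g : continuous f -> continuous g -> {ae mu, forall x, f x = g x} -> f = g.
Proof.
move=> cf cg fg.
have lf := cts_locint cf; have [F dF] := primitive cf; have [G dG] := primitive cg.
have h a b : a <= b -> F b - F a = G b - G a.
  move=> ab; rewrite -(Rintegral_dv cf dF ab) -(Rintegral_dv cg dG ab).
  by apply: Rintegral_ae_eq fg => //; apply: measurable_funTS; exact: continuous_measurable_fun.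
have e : F = (fun x => G x + (F 0 - G 0)).
  apply/funext => x; have [x0|/ltW x0] := leP 0 x; have := h _ _ x0; lra.
apply/funext => x; have d := dvD dG (dv_cst (F 0 - G 0)); rewrite -e in d.
by have := dv_uniq dF d x; rewrite addr0.
Qed.

End Sobolev.

Section SobolevMore.
Context {R : realType}.
Local Notation mu := (@lebesgue_measure R).
Local Notation L2 := (LfunType mu (lee1n 2)).
Local Notation H4 := (sobolev R 4).
Implicit Types (f g : R -> R) (us vs : nat -> R -> R) (a b x y A : R) (U V W : H4).

(** [U] is the class of the classical H^4 function [f]. Unlike [rep] it mentions [f] only, which determines
its derivatives. *)
Definition of_fun U f := exists us A, [/\ rep U us, H4le us A & us 0%N = f].

Lemma of_fun_uniq U V f : of_fun U f -> of_fun V f -> U = V.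
Proof.
move=> [us [A [rU [cu _ _] u0]]] [vs [B [rV [cv _ _] v0]]].
apply: (rep_uniq rU) => k; have e := chain_determined cu cv _ (ltn_ord k).
by apply: ae_imply (rV k) => x ->; rewrite e// u0 v0.
Qed.

Lemma of_fun_exists f us A : H4le us A -> us 0%N = f -> exists U, of_fun U f.
Proof. by move=> h u0; have [U hU] := rep_exists h; exists U, us, A. Qed.

Lemma of_fun_lin a U V f g : of_fun U f -> of_fun V g -> of_fun (a *: U + V) (fun x => a * f x + g x).
Proof.
move=> [us [A [rU hu <-]]] [vs [B [rV hv <-]]].
exists (fun k x => a * us k x + vs k x), ((`|a| + 1) * A + B); split => //; first exact: rep_lin.
by apply: H4leD => //; apply: H4leZ => //; rewrite ?lerDl ?ltr_wpDl.
Qed.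

Lemma of_fun_norm U f us A : of_fun U f -> H4le us A -> us 0%N = f -> `|U| <= 3 * A.
Proof.
move=> hU hu u0; have [V hV] := rep_exists hu.
have -> : U = V by apply: of_fun_uniq hU _; exists us, A.
exact: rep_norm hV hu.
Qed.

Lemma of_fun_ae U f : of_fun U f -> {ae mu, forall x, sobolev_fun U x = f x}.
Proof. by move=> [us [A [rU _ <-]]]; exact: rU. Qed.

Lemma of_fun_even U f : of_fun U f -> (forall x, f (- x) = f x) -> sobolev_even U.
Proof.
move=> hU ef; have h := of_fun_ae hU; apply: ae_imply2 h (ae_opp h) => x e1 e2.
by rewrite e2 ef e1.
Qed.

Lemma weak_deriv_lin1 a (u g v h : L2) : weak_deriv 1 u g -> weak_deriv 1 v h ->
  weak_deriv 1 (a *: u + v : L2) (a *: g + h : L2).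
Proof. exact: (@weak_deriv_linear R 1 a u v g h (LfunP u) (LfunP v) (LfunP g) (LfunP h)). Qed.

Lemma weak_first_order s (u g : L2) : s != 0 -> weak_deriv 1 u g ->
  {ae mu, forall x, g x = s * u x} -> {ae mu, forall x, u x = 0}.
Proof.
move=> s0 w e; apply: (weak_exp0 s0) => phi tp; rewrite (w _ tp); congr (_ * _).
have mp : measurable_fun setT phi by apply: continuous_measurable_fun; exact: test_cts.
apply: Rintegral_ae_eq => //.
- by apply: measurable_funM => //; exact: L2_measurable.
- by apply: measurable_funM => //; apply: measurable_funM => //; exact: L2_measurable.
- by apply: ae_imply e => x ->.
Qed.

(** As in [Msol0], the factors [d - a], [d + a], [d - b] and [d + b] are removed one at a time; here
square-integrability replaces boundedness. *)
Lemma weak_homogeneous a b W : 0 < a -> 0 < b ->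
  {ae mu, forall x, weak_derivative (inord 4) W x - (a ^+ 2 + b ^+ 2) * weak_derivative (inord 2) W x
     + a ^+ 2 * b ^+ 2 * sobolev_fun W x = 0} -> W = 0.
Proof.
move=> a0 b0 e; pose w k : L2 := jet_val (repr W) (inord k).
have w0E : sobolev_fun W = w 0%N.
  by rewrite /w (_ : inord 0 = ord0)//; apply: val_inj; rewrite /= inordK.
have wk k : (k < 5)%N -> weak_deriv k (w 0%N) (w k).
  by move=> k5; have := weak_deriv_component W (inord k); rewrite w0E inordK.
have d k : (k < 4)%N -> weak_deriv 1 (w k) (w k.+1).
  by move=> k4; apply: weak_deriv_shift (wk k _) (wk k.+1 _) => //; exact: ltnW.
have d0 := d 0%N isT; have d1 := d 1%N isT; have d2 := d 2%N isT; have d3 := d 3%N isT.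
have an : a != 0 by rewrite gt_eqF.
have bn : b != 0 by rewrite gt_eqF.
have Nan : - a != 0 by rewrite oppr_eq0.
have Nbn : - b != 0 by rewrite oppr_eq0.
apply: sobolev_fun_null; rewrite w0E.
have z1 := weak_deriv_lin1 b d0 d1.
have z2 := weak_deriv_lin1 (- b ^+ 2) d0 d2.
have z2' := weak_deriv_lin1 (- b ^+ 2) d1 d3.
have z3 := weak_deriv_lin1 a z2 z2'.
have ev (s : R) (u v : L2) x : (s *: u + v : L2) x = s * u x + v x by [].
have s3 : {ae mu, forall x, w 3%N x + a * w 2%N x - b ^+ 2 * w 1%N x - a * b ^+ 2 * w 0%N x = 0}.
  apply: ae_imply (weak_first_order an z3 _) => [x|].
    by rewrite !ev => h; rewrite -[RHS]h; ring.
  apply: ae_imply e => x; rewrite w0E -![weak_derivative _ _ _]/(w _ x) !ev => h.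
  by apply/eqP; rewrite -subr_eq0 -[X in _ == X]h; apply/eqP; ring.
have s2 : {ae mu, forall x, w 2%N x - b ^+ 2 * w 0%N x = 0}.
  apply: ae_imply (weak_first_order Nan z2 _) => [x|].
    by rewrite !ev => h; rewrite -[RHS]h; ring.
  apply: ae_imply s3 => x h; rewrite !ev.
  by apply/eqP; rewrite -subr_eq0 -[X in _ == X]h; apply/eqP; ring.
have s1 : {ae mu, forall x, w 1%N x + b * w 0%N x = 0}.
  apply: ae_imply (weak_first_order bn z1 _) => [x|].
    by rewrite !ev => h; rewrite -[RHS]h; ring.
  apply: ae_imply s2 => x h; rewrite !ev.
  by apply/eqP; rewrite -subr_eq0 -[X in _ == X]h; apply/eqP; ring.
apply: (weak_first_order Nbn d0); apply: ae_imply s1 => x h.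
by apply/eqP; rewrite -subr_eq0 -[X in _ == X]h; apply/eqP; ring.
Qed.

Lemma sobolev_component_lin a U V k : {ae mu, forall x, weak_derivative k (a *: U + V) x =
   a * weak_derivative k U x + weak_derivative k V x}.
Proof.
pose us (X : H4) (n : nat) := weak_derivative (inord n) X.
have rX X : rep X (us X) by move=> j; apply: aeW => x; rewrite /us inord_val.
by have := rep_lin a (rX U) (rX V) k; apply: ae_imply => x ->; rewrite /us inord_val.
Qed.

(** Regularity: the difference with the classical solution satisfies the homogeneous equation weakly. *)
Lemma weak_is_classical m a b f us V A : 0 < a -> 0 < b -> 0 < m ->
  m * (a ^+ 2 + b ^+ 2) = 1 -> m * (a ^+ 2 * b ^+ 2) = 1 ->
  Msol a b (fun x => f x / m) us -> H4le us A ->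
  {ae mu, forall x, m * weak_derivative (inord 4) V x - weak_derivative (inord 2) V x + sobolev_fun V x = f x} ->
  rep V us.
Proof.
move=> a0 b0 m0 h1 h2 [_ _ eu] hu eV; have [U rU] := rep_exists hu.
suff -> : V = U by [].
apply/eqP; rewrite -subr_eq0; apply/eqP; have -> : V - U = -1 *: U + V by rewrite scaleN1r addrC.
apply: (weak_homogeneous a0 b0).
have l4 := sobolev_component_lin (-1) U V (inord 4).
have l2 := sobolev_component_lin (-1) U V (inord 2).
have l0 := sobolev_component_lin (-1) U V ord0.
have u4 := rU (inord 4); have u2 := rU (inord 2); have u0 := rU ord0.
rewrite !inordK// in u4 u2.
have := ae_imply2 (fun x => @conj _ _) l4 (ae_imply2 (fun x => @conj _ _) l2 l0).
have := ae_imply2 (fun x => @conj _ _) u4 (ae_imply2 (fun x => @conj _ _) u2 u0).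
move=> hU hL; apply: ae_imply2 eV (ae_imply2 (fun x => @conj _ _) hU hL) => x e.
rewrite /sobolev_fun in e *.
move=> [[v4 [v2 v0]] [-> [-> ->]]]; rewrite v4 v2 v0.
have fact A4 A2 A0 : m * (A4 - (a ^+ 2 + b ^+ 2) * A2 + a ^+ 2 * b ^+ 2 * A0) = m * A4 - A2 + A0.
  by rewrite -[in RHS](mul1r A2) -[in RHS](mul1r A0) -{1}h1 -h2; ring.
have e2 := eu x; have mn : m != 0 by rewrite gt_eqF.
have e3 : m * us 4%N x - us 2%N x + us 0%N x = f x.
  have -> : m * us 4%N x - us 2%N x + us 0%N x =
    m * (us 4%N x - (a ^+ 2 + b ^+ 2) * us 2%N x + a ^+ 2 * b ^+ 2 * us 0%N x).
    by rewrite fact.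
  by rewrite e2; field.
apply: (mulfI mn); rewrite mulr0 fact; move: e e3; move: (weak_derivative _ _ _) (weak_derivative _ _ _) (weak_derivative _ _ _) => A4 A2 A0 e e3; lra.
Qed.

Lemma sobolev_continuous U : exists f, [/\ continuous f, {ae mu, forall x, sobolev_fun U x = f x} &
  forall A, 0 < A -> `|U| <= A -> (forall x, `|f x| <= 2 * A) /\ L2le f A].
Proof.
have [f [cf uf hf]] : exists f, [/\ continuous f, {ae mu, forall x, sobolev_fun U x = f x} &
    forall A, 0 < A -> L2norm (jet_val (repr U) ord0) <= A -> L2norm (jet_val (repr U) (inord 1)) <= A ->
      forall x, `|f x| <= 2 * A].
  apply: H1_continuous; have := weak_deriv_component U (inord 1); rewrite inordK//.
exists f; split=> // A A0 UA.
have h0 : L2norm (jet_val (repr U) ord0) <= A by apply: le_trans UA; exact: component_norm.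
have h1 : L2norm (jet_val (repr U) (inord 1)) <= A by apply: le_trans UA; exact: component_norm.
split; first exact: hf.
exact: L2_cts_le cf uf h0 A0.
Qed.

End SobolevMore.

(** * The branch in the Sobolev space *)

Section Branch.
Context {R : realType} (beta r m amp : R) (p : nat).
Hypotheses (beta0 : 0 < beta) (r0 : 0 < r) (m0 : 0 < m) (amp0 : 0 < amp).
Hypotheses (p1 : (1 <= p)%N) (rp : r * p%:R = 4).
Hypothesis (Hal : m * (beta ^+ 2 * (r ^+ 2 + (r + 2) ^+ 2)) = 1).
Hypothesis (Hga : m * (beta ^+ 4 * r ^+ 2 * (r + 2) ^+ 2) = 1).
Hypothesis (Hamp : amp ^+ p = (p%:R + 1) * (m * beta ^+ 4 * lam0 r)).
Local Notation mu := (@lebesgue_measure R).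
Local Notation H4 := (sobolev R 4).
Local Notation a := (beta * r).
Local Notation b := (beta * (r + 2)).
Local Notation phi := (Phi beta r amp).
Local Notation src := (full_source beta r amp p).
Local Notation eps := (weight beta r m amp p).
Local Notation et := (radius beta0 r0 m0 amp0 p1).
Local Notation reduced_sol c h := (reduced_eq beta r m amp p h (source beta r amp p c h)).
Implicit Types (c x : R) (h : R -> R) (U V : H4).

Let a0 : 0 < a. Proof. exact: mulr_gt0. Qed.
Let b0 : 0 < b. Proof. by rewrite mulr_gt0// addr_gt0. Qed.
Let Hab : m * (a ^+ 2 + b ^+ 2) = 1.
Proof. by rewrite -[RHS]Hal; ring. Qed.
Let Habm : m * (a ^+ 2 * b ^+ 2) = 1.
Proof. by rewrite -[RHS]Hga; ring. Qed.
Let p10 : p%:R + 1 != 0 :> R. Proof. by rewrite gt_eqF// ltr_wpDl. Qed.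

Lemma Msol_equation f us x : Msol a b (fun x => f x / m) us ->
  m * us 4%N x - us 2%N x + us 0%N x = f x.
Proof.
move=> [_ _ /(_ x) e]; have mn : m != 0 by rewrite gt_eqF.
have <- : m * (f x / m) = f x by field.
have e2 : us 2%N x = m * (a ^+ 2 + b ^+ 2) * us 2%N x by rewrite Hab mul1r.
have e0 : us 0%N x = m * (a ^+ 2 * b ^+ 2) * us 0%N x by rewrite Habm mul1r.
by rewrite -e [in LHS]e2 [in LHS]e0; ring.
Qed.

Lemma ground_state_equation x : m * (amp * ground_chain beta r 4 x) - amp * ground_chain beta r 2 x
  + amp * ground_chain beta r 0 x = phi x ^+ p.+1 / (p%:R + 1).
Proof.
have s := ground_Msol beta0 r0; have mn : m != 0 by rewrite gt_eqF.
have e := @Msol_equation (fun x => m * (beta ^+ 4 * lam0 r * sechs beta x ^+ 4 * ground beta r x)) _ x.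
have <- : amp * (m * ground_chain beta r 4 x - ground_chain beta r 2 x + ground_chain beta r 0 x) =
  m * (amp * ground_chain beta r 4 x) - amp * ground_chain beta r 2 x
  + amp * ground_chain beta r 0 x by ring.
rewrite e; last first.
  by move: s; congr Msol; apply/funext => y; field.
rewrite [phi x ^+ p.+1]exprSr (Phi_pow beta amp rp) Hamp /Phi; field.
exact: p10.
Qed.

Lemma ground_state_exists : exists U, rep U (fun (n : nat) x => amp * ground_chain beta r n x).
Proof.
have [A hA] := ground_H4 beta0 r0; apply: rep_exists; apply: (@H4leZ _ _ _ _ amp _ _ hA) => //.
by rewrite gtr0_norm.
Qed.

Variable phi1 : H4.
Hypothesis rphi1 : rep phi1 (fun (n : nat) x => amp * ground_chain beta r n x).

Let phi1E : {ae mu, forall x, sobolev_fun phi1 x = phi x}.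
Proof. exact: rphi1 ord0. Qed.

Let phiE x : phi (- x) = phi x. Proof. by rewrite /Phi ground_even. Qed.

Lemma ground_solution : is_solution m 1 p phi1.
Proof.
have h4 := rphi1 (inord 4); have h2 := rphi1 (inord 2); have h0 := rphi1 ord0.
rewrite !inordK// in h4 h2.
apply: ae_imply2 h4 (ae_imply2 (fun x => @conj _ _) h2 h0) => x e4 [e2 e0].
rewrite /sobolev_fun e4 e2 e0 mul1r ground_state_equation /= /Phi; field.
exact: p10.
Qed.

(** The equation for [U = phi1 + V] in terms of [V], the equation of the ground state being subtracted. *)
Lemma is_solution_perturbed c U : is_solution m c p U <->
  {ae mu, forall x, m * weak_derivative (inord 4) (U - phi1) x - weak_derivative (inord 2) (U - phi1) x
    + sobolev_fun (U - phi1) x = src c (sobolev_fun (U - phi1)) x}.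
Proof.
have lE k : {ae mu, forall x, weak_derivative k (U - phi1) x = weak_derivative k U x - amp * ground_chain beta r k x}.
  have := sobolev_component_lin (-1) phi1 U k; rewrite scaleN1r addrC => h.
  by apply: ae_imply2 h (rphi1 k) => x -> ->; ring.
have h0 : {ae mu, forall x, weak_derivative ord0 (U - phi1) x = weak_derivative ord0 U x - phi x} := lE ord0.
have h4 := lE (inord 4); have h2 := lE (inord 2); rewrite !inordK// in h4 h2.
have hh := ae_imply2 (fun x => @conj _ _) h4 (ae_imply2 (fun x => @conj _ _) h2 h0).
suff key x : [/\ weak_derivative (inord 4) (U - phi1) x = weak_derivative (inord 4) U x - amp * ground_chain beta r 4 x,
    weak_derivative (inord 2) (U - phi1) x = weak_derivative (inord 2) U x - amp * ground_chain beta r 2 x &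
    weak_derivative ord0 (U - phi1) x = weak_derivative ord0 U x - phi x] ->
    (m * weak_derivative (inord 4) U x - weak_derivative (inord 2) U x + c * sobolev_fun U x
      = 1 / (p%:R + 1) * sobolev_fun U x ^+ p.+1) <->
    (m * weak_derivative (inord 4) (U - phi1) x - weak_derivative (inord 2) (U - phi1) x
      + sobolev_fun (U - phi1) x = src c (sobolev_fun (U - phi1)) x).
  by split=> hs; apply: ae_imply2 hs hh => x e [e4 [e2 e0]]; apply/key.
move=> [e4 e2 e0]; rewrite /full_source /sobolev_fun e4 e2 e0.
have -> : phi x + (weak_derivative ord0 U x - phi x) = weak_derivative ord0 U x by ring.
rewrite -(ground_state_equation x) -/(phi x) [_ / _]mulrC -[_^-1]div1r.
split=> e.
  by apply/eqP; rewrite -subr_eq0; move/eqP: e; rewrite -subr_eq0 => /eqP <-; apply/eqP; rewrite /Phi /=; ring.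
by apply/eqP; rewrite -subr_eq0; move/eqP: e; rewrite -subr_eq0 => /eqP <-; apply/eqP; rewrite /Phi /=; ring.
Qed.

(** Characterizes the functions [h] for which [phi1 + h] is a solution in the range of uniqueness of
[solution_uniq]. *)
Definition admissible c h := [/\ `|c - 1| <= et, bnd beta eps h et & reduced_sol c h].

Lemma admissible_small c h : admissible c h -> `|c - 1| <= et /\ bnd beta eps h et.
Proof. by case. Qed.

Lemma admissible_eq c h (k : R -> R) : admissible c h -> admissible c k -> h = k.
Proof. by move=> [h1 h2 h3] [k1 k2 k3]; apply: (solution_uniq rp Hamp (conj h1 h2) (conj k1 k2)). Qed.

Lemma admissible_solution c h U : admissible c h -> of_fun (U - phi1) h ->
  sobolev_even U /\ is_solution m c p U.
Proof.
move=> ad hU; have sm := admissible_small ad.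
have [B LB [ff _]] := reduced_eq_resolvent rp Hamp sm.
have [_ [eh _ _ _] /ff hres] := ad.
have [ms hs] := resolventP beta0 r0 m0 LB.
split.
  have hV := of_fun_even hU eh; have := sobolev_component_lin 1 (U - phi1) phi1 ord0.
  rewrite scale1r subrK => hl.
  have pe : {ae mu, forall x, sobolev_fun phi1 (- x) = sobolev_fun phi1 x}.
    by apply: ae_imply2 phi1E (ae_opp phi1E) => x e1 e2; rewrite e2 e1; exact: phiE.
  have hh := ae_imply2 (fun x => @conj _ _) hl (ae_opp hl).
  apply: ae_imply2 hh (ae_imply2 (fun x => @conj _ _) hV pe) => x [e1 e2] [e3 e4].
  by rewrite /sobolev_fun e1 e2 -!/(sobolev_fun _) e3 e4.
apply/is_solution_perturbed.
have [us [A [rU [cu _ _] u0]]] := hU; have [cv _ _] := hs.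
have e k : (k < 5)%N -> us k =1 resolvent beta r m (src c h) k.
  by apply: chain_determined cu cv _ _; rewrite u0 {1}hres.
have h4 := rU (inord 4); have h2 := rU (inord 2); have h0 := rU ord0.
rewrite !inordK// in h4 h2.
apply: ae_imply2 h4 (ae_imply2 (fun x => @conj _ _) h2 h0) => x e4 [e2 e0].
have es : src c (sobolev_fun (U - phi1)) x = src c h x.
  by rewrite /full_source /sobolev_fun e0 /= u0.
by rewrite es /sobolev_fun e4 e2 e0 !e//; exact: Msol_equation ms.
Qed.

(** The continuous representative of [U - phi1] inherits smallness from the H^4 norm and evenness from
[U]; by [weak_is_classical] it is [T] of its own source. *)
Lemma solution_admissible c U : `|c - 1| <= et -> sobolev_even U -> is_solution m c p U ->
  2 * `|U - phi1| < et -> `|U - phi1| < eps * et ->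
  exists2 h, admissible c h & of_fun (U - phi1) h.
Proof.
move=> ce eU sU n1 n2.
have [h [ch Vh hb]] := sobolev_continuous (U - phi1).
have e0 := weight_gt0 p beta0 r0 m0 amp0.
pose A := Num.min (et / 2) (eps * et).
have et0 : 0 < et := radius_gt0 beta0 r0 m0 amp0 p1.
have A0 : 0 < A by rewrite /A lt_min divr_gt0// mulr_gt0.
have A1 : 2 * A <= et by rewrite -ler_pdivlMl// mulrC /A ge_min lexx.
have A2 : A <= eps * et by rewrite /A ge_min lexx orbT.
have VA : `|U - phi1| <= A by rewrite /A le_min (ltW n2) andbT ler_pdivlMr// mulrC ltW.
have [hA LA] := hb A A0 VA.
have eh x : h (- x) = h x.
  suff e : (fun x => h (- x)) = h by rewrite -{2}e.
  apply: cts_ae_eq => //.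
    by move=> y; apply: continuous_comp; [exact: oppr_continuous|exact: ch].
  have hl := sobolev_component_lin (-1) phi1 U ord0; rewrite scaleN1r addrC in hl.
  have h1 := ae_imply2 (fun x => @conj _ _) hl (ae_opp hl).
  have h2 := ae_imply2 (fun x => @conj _ _) phi1E (ae_opp phi1E).
  have h3 := ae_imply2 (fun x => @conj _ _) Vh (ae_opp Vh).
  have h4 := ae_imply2 (fun x => @conj _ _) h2 h3.
  apply: ae_imply2 eU (ae_imply2 (fun x => @conj _ _) h1 h4) => y.
  move=> e1 [[e2 e3] [[e4 e5] [e6 e7]]].
  by rewrite -e7 -e6 /sobolev_fun e2 e3 -!/(sobolev_fun _) e1 e4 e5 phiE.
have bh : bnd beta eps h et.
  split => //.
  - by move=> x; apply: le_trans A1; exact: hA.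
  - apply: L2le_mono LA; lra.
  - apply: L2le_mono A2 _; have := LA; rewrite -{1}(mul1r A).
    have c1 : continuous (fun x => sechs beta x ^+ 2 * h x).
      by apply: ctsM => //; apply: ctsX; exact: dv_continuous (dv_sechs beta).
    move=> LA1; rewrite -(mul1r A); apply: (L2le_dom ltr01 c1 _ LA) => x.
    rewrite normrM mul1r ler_piMl// ger0_norm ?sqr_ge0// expr_le1//.
      exact: sechs_le1.
    exact/ltW/sechs_gt0.
have [B LB [_ ff]] := reduced_eq_resolvent rp Hamp (conj ce bh).
have [ms hs] := resolventP beta0 r0 m0 LB.
have rV : rep (U - phi1) (resolvent beta r m (src c h)).
  apply: (weak_is_classical a0 b0 m0 Hab Habm ms hs).
  move/is_solution_perturbed: sU => sU.
  by apply: ae_imply2 sU Vh => x -> e; rewrite /full_source e.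
have hE : h = resolvent beta r m (src c h) 0.
  apply: cts_ae_eq => //.
    by have [_ _ /(_ 0%N isT) []] := hs.
  by apply: ae_imply2 Vh (rV ord0) => x <- <-.
exists h; first by split=> //; exact: ff.
by exists (resolvent beta r m (src c h)), (resolvent_norm beta r m * B).
Qed.

(** The radius [dl] of the ball is small enough for every even solution in it to be admissible, and the
branch is constructed with [6 e1 < dl] so that it stays in this ball. *)
Lemma smooth_branch : exists delta delta' : R,
  0 < delta /\ 0 < delta' /\
  (forall c : R, `|c - 1| < delta ->
    exists! phi : sobolev R 4,
      sobolev_even phi /\ is_solution m c p phi /\ ball phi1 delta' phi) /\
  (exists Phi : R -> sobolev R 4,
    (forall c : R, 1 - delta < c < 1 + delta ->
      sobolev_even (Phi c) /\ is_solution m c p (Phi c) /\ ball phi1 delta' (Phi c)) /\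
    C1_on_oo Phi (1 - delta) (1 + delta)).
Proof.
have et0 : 0 < et := radius_gt0 beta0 r0 m0 amp0 p1.
have eps0 := weight_gt0 p beta0 r0 m0 amp0.
pose dl := Num.min (et / 2) (eps * et).
have dl0 : 0 < dl by rewrite /dl lt_min divr_gt0// mulr_gt0.
have dl1 : dl <= et / 2 by rewrite /dl ge_min lexx.
have dl2 : dl <= eps * et by rewrite /dl ge_min lexx orbT.
pose e1 := Num.min et (dl / 7).
have e10 : 0 < e1 by rewrite /e1 lt_min et0 divr_gt0.
have e1e : e1 <= et by rewrite /e1 ge_min lexx.
have e1d : e1 <= dl / 7 by rewrite /e1 ge_min lexx orbT.
have [d d0 hd] := small_solution rp Hamp e10 e1e.
pose de := Num.min d et.
have de0 : 0 < de by rewrite /de lt_min d0.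
have cd c : `|c - 1| < de -> `|c - 1| < d /\ `|c - 1| <= et.
  by rewrite /de lt_min => /andP[h1 h2]; split=> //; exact: ltW.
have ballE U : ball phi1 dl U <-> `|U - phi1| < dl.
  by rewrite -ball_normE /= distrC.
have /choice[S hS] : forall c, exists hU : (R -> R) * H4, `|c - 1| < de ->
    [/\ admissible c hU.1, of_fun hU.2 hU.1 & `|hU.2| < dl].
  move=> c; have [cde|n] := ltP `|c - 1| de; last by exists ((fun=> 0), 0).
  have [c1 c2] := cd c cde; have [h bh [fh [us u0 hus]]] := hd c c1.
  have [U hU] := of_fun_exists hus u0; exists (h, U) => _; split => //=.
    by split => //; exact: (bnd_mono eps0 e1e bh).
  apply: le_lt_trans (of_fun_norm hU hus u0) _; lra.
have solS c : `|c - 1| < de -> sobolev_even (phi1 + (S c).2) /\ is_solution m c p (phi1 + (S c).2) /\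
    ball phi1 dl (phi1 + (S c).2).
  move=> cde; have [ad oS nS] := hS c cde.
  have oS' : of_fun (phi1 + (S c).2 - phi1) (S c).1 by rewrite addrAC subrr add0r.
  have [h1 h2] := admissible_solution ad oS'.
  by split=> //; split=> //; apply/ballE; rewrite addrAC subrr add0r.
exists de, dl; split=> //; split=> //; split.
  move=> c cde; exists (phi1 + (S c).2); split; first exact: solS.
  move=> U [eU [sU /ballE bU]].
  have [ad oS nS] := hS c cde; have [_ ce] := cd c cde.
  have [||h adh oh] := solution_admissible ce eU sU.
  - lra.
  - exact: lt_le_trans dl2.
  rewrite -(admissible_eq ad adh) in oh.
  by rewrite (of_fun_uniq oS oh) addrC subrK.
have inE c : 1 - de < c < 1 + de -> `|c - 1| < de.
  by move=> /andP[h1 h2]; rewrite ltr_norml; apply/andP; split; lra.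
exists (fun c => phi1 + (S c).2); split; first by move=> c /inE; exact: solS.
have [C C0 [D hD]] := branch_C1 beta0 r0 m0 amp0 p1 rp Hamp.
have /choice[V hV] : forall c, exists V : H4, `|c - 1| < de -> of_fun V (D c (S c).1).
  move=> c; have [cde|n] := ltP `|c - 1| de; last by exists 0.
  have [ad _ _] := hS c cde; have [[us [A [u0 hu]]] _] := hD c _ (admissible_small ad) (let: And3 _ _ k := ad in k).
  by have [U hU] := of_fun_exists hu u0; exists U.
have diff c c' : `|c - 1| < de -> `|c' - 1| < de ->
    `|(S c').2 - (S c).2 - (c' - c) *: V c| <= 3 * C * (c' - c) ^+ 2 /\ `|V c' - V c| <= 3 * C * `|c' - c|.
  move=> cde cde'; have [->|ne] := eqVneq c' c.
    by rewrite !subrr scale0r subr0 !normr0 expr0n /= !mulr0.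
  have [ad oS _] := hS c cde; have [ad' oS' _] := hS c' cde'.
  have [_ hd2] := hD c _ (admissible_small ad) (let: And3 _ _ k := ad in k).
  have [[us u0 hu] [vs v0 hv]] := hd2 c' _ (admissible_small ad') (let: And3 _ _ k := ad' in k) ne.
  have oV := hV c cde; have oV' := hV c' cde'.
  split.
    have o1 := of_fun_lin (- (c' - c)) oV (of_fun_lin (-1) oS oS').
    have -> : (S c').2 - (S c).2 - (c' - c) *: V c = - (c' - c) *: V c + (-1 *: (S c).2 + (S c').2).
      by rewrite scaleNr scaleN1r addrC [(S c').2 - _]addrC.
    rewrite -mulrA; apply: of_fun_norm o1 hu _; rewrite u0; apply/funext => x; ring.
  have o1 := of_fun_lin (-1) oV oV'.
  have -> : V c' - V c = -1 *: V c + V c' by rewrite scaleN1r addrC.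
  rewrite -mulrA; apply: of_fun_norm o1 hv _; rewrite v0; apply/funext => x; ring.
have dPhi c : `|c - 1| < de -> is_derive c 1 (fun c => phi1 + (S c).2) (V c).
  move=> cde; have C30 : 0 <= 3 * C by rewrite mulr_ge0// ltW.
  have k0 : 0 < de - `|c - 1| by rewrite subr_gt0.
  apply: (quadratic_derive k0 C30) => t ht.
  have tde : `|t + c - 1| < de.
    by rewrite -addrA; apply: le_lt_trans (ler_normD _ _) _; rewrite -ltrBrDr.
  have [h1 _] := diff c (t + c) cde tde; rewrite addrK in h1.
  by rewrite opprD addrACA subrr add0r.
move=> c /inE cde; split; first exact: (@ex_derive _ _ _ _ _ _ _ (dPhi c cde)).
have dE y : `|y - 1| < de -> derive1 (fun c => phi1 + (S c).2) y = V y.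
  by move=> yde; rewrite derive1E; exact: (@derive_val _ _ _ _ _ _ _ (dPhi y yde)).
apply/cvgrPdist_le => e ee.
pose t := Num.min (de - `|c - 1|) (e / (3 * C)).
have t0 : 0 < t by rewrite /t lt_min subr_gt0 cde divr_gt0// mulr_gt0.
apply/nbhs_ballP; exists t => // y; rewrite /ball /= distrC => yt.
have [y1 y2] : `|y - c| < de - `|c - 1| /\ `|y - c| < e / (3 * C).
  by move: yt; rewrite /t lt_min => /andP[].
have yde : `|y - 1| < de.
  have -> : y - 1 = (y - c) + (c - 1) by ring.
  by apply: le_lt_trans (ler_normD _ _) _; rewrite -ltrBrDr.
rewrite dE// dE// distrC; have [_ h2] := diff c y cde yde; apply: le_trans h2 _.
by rewrite mulrC -ler_pdivlMr ?mulr_gt0// ltW.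
Qed.

End Branch.

(** * The parameters of the explicit solution *)

Section Wave.
Context {R : realType} (p : nat).
Hypothesis p1 : (1 <= p)%N.

Definition wave_power : R := 4 / p%:R.
Definition wave_number : R := p%:R * Num.sqrt (p%:R ^+ 2 + 4 * p%:R + 8) / (4 * (p%:R + 2)).
Definition wave_height : R :=
  (((p%:R + 1) * (p%:R + 4) * (3 * p%:R + 4)) / (8 * (p%:R + 2))) `^ (1 / p%:R).

Let pp : 0 < p%:R :> R. Proof. by rewrite ltr0n. Qed.
Let Q0 : 0 < p%:R ^+ 2 + 4 * p%:R + 8 :> R.
Proof. by have := sqr_ge0 (p%:R : R); move: pp; lra. Qed.

Lemma wave_power_gt0 : 0 < wave_power.
Proof. exact: divr_gt0. Qed.

Lemma wave_number_gt0 : 0 < wave_number.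
Proof. by rewrite divr_gt0 ?mulr_gt0 ?sqrtr_gt0 ?Q0 ?addr_gt0. Qed.

Let K0 : 0 < ((p%:R + 1) * (p%:R + 4) * (3 * p%:R + 4)) / (8 * (p%:R + 2)) :> R.
Proof. by rewrite divr_gt0 ?mulr_gt0 ?addr_gt0 ?mulr_gt0. Qed.

Lemma wave_height_gt0 : 0 < wave_height.
Proof. exact: powR_gt0. Qed.

Lemma mu_gt0 : 0 < mu_ p :> R.
Proof. by rewrite divr_gt0 ?mulr_gt0 ?exprn_gt0 ?Q0 ?ltr_wpDl. Qed.

Lemma wave_power_mul : wave_power * p%:R = 4.
Proof. by rewrite /wave_power; field; rewrite gt_eqF. Qed.

Lemma wave_number_sqr :
  wave_number ^+ 2 = p%:R ^+ 2 * (p%:R ^+ 2 + 4 * p%:R + 8) / (16 * (p%:R + 2) ^+ 2).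
Proof.
rewrite /wave_number expr_div_n exprMn sqr_sqrtr ?ltW//; field.
by rewrite gt_eqF// addr_gt0.
Qed.

Lemma wave_height_pow : wave_height ^+ p = ((p%:R + 1) * (p%:R + 4) * (3 * p%:R + 4)) / (8 * (p%:R + 2)).
Proof. by rewrite -powR_mulrn ?powR_ge0// -powRrM div1r mulVf ?gt_eqF// powRr1 ?ltW. Qed.

Let pn : p%:R != 0 :> R. Proof. by rewrite gt_eqF. Qed.
Let p2n : p%:R + 2 != 0 :> R. Proof. by rewrite gt_eqF// addr_gt0. Qed.
Let Qn : p%:R ^+ 2 + 4 * p%:R + 8 != 0 :> R. Proof. by rewrite gt_eqF. Qed.

(** With [wave_zeroth_order]: [mu d^4 - d^2 + 1 = mu (d^2 - a^2) (d^2 - b^2)]. *)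
Lemma wave_second_order :
  mu_ p * (wave_number ^+ 2 * (wave_power ^+ 2 + (wave_power + 2) ^+ 2)) = 1.
Proof. by rewrite wave_number_sqr /wave_power /mu_; field; rewrite Qn p2n pn. Qed.

Lemma wave_zeroth_order :
  mu_ p * (wave_number ^+ 4 * wave_power ^+ 2 * (wave_power + 2) ^+ 2) = 1.
Proof.
have -> : wave_number ^+ 4 = (wave_number ^+ 2) ^+ 2 by rewrite -exprM.
by rewrite wave_number_sqr /wave_power /mu_; field; rewrite Qn p2n pn.
Qed.

(** The amplitude for which [Phi ^ p] is the potential [beta^4 lam1 S^4] times [mu]. *)
Lemma wave_amplitude :
  wave_height ^+ p = (p%:R + 1) * (mu_ p * wave_number ^+ 4 * lam0 wave_power).
Proof.
have -> : wave_number ^+ 4 = (wave_number ^+ 2) ^+ 2 by rewrite -exprM.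
by rewrite wave_height_pow wave_number_sqr /lam0 /wave_power /mu_; field; rewrite Qn p2n pn.
Qed.

End Wave.

Theorem lemma2p2 (R : realType) (p : nat) (hp : (1 <= p)%N) :
  exists phi1 : sobolev R 4,
    represents phi1 (explicit_solution p) /\
    is_solution (mu_ p) 1 p phi1 /\
    exists delta delta' : R,
      0 < delta /\ 0 < delta' /\
      (forall c : R, 0 < c -> `|c - 1| < delta ->
        exists! phi : sobolev R 4,
          sobolev_even phi /\ is_solution (mu_ p) c p phi /\
          ball phi1 delta' phi) /\
      (exists Phi : R -> sobolev R 4,
        (forall c : R, 1 - delta < c < 1 + delta ->
          sobolev_even (Phi c) /\ is_solution (mu_ p) c p (Phi c) /\
          ball phi1 delta' (Phi c)) /\
        C1_on_oo Phi (1 - delta) (1 + delta)).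
Proof.
have be0 := @wave_number_gt0 R p hp; have r0 := @wave_power_gt0 R p hp.
have m0 := @mu_gt0 R p hp; have am0 := @wave_height_gt0 R p hp.
have Hal := @wave_second_order R p hp; have Hga := @wave_zeroth_order R p hp.
have Ham := @wave_amplitude R p hp; have rp := @wave_power_mul R p hp.
have [phi1 rphi1] := ground_state_exists be0 r0 am0.
exists phi1; split.
  apply: ae_imply (rphi1 ord0) => x e; rewrite /sobolev_fun e.
  exact: (congr1 (fun t => wave_height p * t) (groundE _ _ _)).
split; first exact: (ground_solution be0 r0 m0 rp Hal Hga Ham rphi1).
have [de [dl [h1 [h2 [h3 h4]]]]] := smooth_branch be0 r0 m0 am0 hp rp Hal Hga Ham rphi1.
by exists de, dl; split=> //; split=> //; split=> // c _; exact: h3.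
Qed.
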